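(* Let $\Omega\subset\mathbb R^n$ be a bounded polyhedral Lipschitz domain, let $\mathcal T$ be a regular triangulation of $\Omega$ into $n$-simplices and $\hat{\mathcal T}\in\mathbb T(\mathcal T)$ a refinement of $\mathcal T$ by successive bisections. Let $C(n)$ be the constant of the discrete Poincaré inequality (i.e. $C(n)^2=(4M-3)/(3n(n+2))$ with $M$ such that $M$-fold bisection halves diameters of all simplices) and set $\kappa_{NC}^2:=C(n)^2+\frac{1}{(n+1)(n+2)n^2}$. For $\hat v_{CR}\in CR^1_0(\hat{\mathcal T})$ let $I_{NC}\hat v_{CR}\in CR^1_0(\mathcal T)$ be defined by $(I_{NC}\hat v_{CR})(\operatorname{mid}(E))=|E|^{-1}\int_E\hat v_{CR}\,ds$ for all sides $E$ of $\mathcal T$. Then for every $K\in\mathcal T$, $$h_K^{-1}\|\hat v_{CR}-I_{NC}\hat v_{CR}\|_{L^2(K)}\le\kappa_{NC}\,\|\nabla_{NC}(\hat v_{CR}-I_{NC}\hat v_{CR})\|_{L^2(K)}.$$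
   Context: Bisection is as follows: an $n$-simplex $T=\operatorname{conv}\{P_1,\dots,P_{n+1}\}$ is identified with the ordered tuple $(P_1,\dots,P_{n+1})$ and split into $\operatorname{conv}\{P_1,(P_1+P_{n+1})/2,P_2,\dots,P_n\}$ and $\operatorname{conv}\{P_{n+1},(P_1+P_{n+1})/2,P_2,\dots,P_n\}$, with children orderings fixed by the bisection rule (newest vertex bisection for $n=2$, Stevenson's rule for $n\ge 3$); $\mathbb T(\mathcal T)$ is the set of regular triangulations obtained from $\mathcal T$ by finitely many successive bisections. $CR^1_0(\mathcal T)$ is the Crouzeix–Raviart space: piecewise affine functions on $\mathcal T$ that are continuous at the barycenter $\operatorname{mid}(E)$ of every interior side $E$ and vanish at the barycenter of every boundary side. $\nabla_{NC}$ is the piecewise gradient, $h_K=\operatorname{diam}(K)$. *)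

(* Defs.v *)
From HB Require Import structures.
From mathcomp Require Import all_boot all_order all_algebra.
From mathcomp Require Import all_classical all_reals all_analysis.
Set Implicit Arguments. Unset Strict Implicit. Unset Printing Implicit Defensive.
Import Order.TTheory GRing.Theory Num.Theory.
Import numFieldNormedType.Exports.
Local Open Scope classical_set_scope.
Local Open Scope ring_scope.

Section Defs.
Variables (R : realType) (n : nat).
Notation point := 'rV[R]_n.

Definition dotp (u v : point) : R := \sum_(i < n) u 0 i * v 0 i.
Definition enorm (u : point) : R := Num.sqrt (dotp u u).
Definition diam (A : set point) : R :=
  sup [set d : R | exists x y, A x /\ A y /\ d = enorm (x - y)].

(** Bounded Lipschitz domain: open, bounded, and near each boundary point
    the domain lies strictly below the graph of a Lipschitz function
    (in a rotated coordinate system: direction e, graph over e^perp). *)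
Definition lipschitz_domain (Om : set point) : Prop :=
  open Om /\ (exists r : R, forall x, Om x -> enorm x <= r) /\
  forall x, closure Om x -> ~ Om x ->
    exists r : R, 0 < r /\ exists e : point, enorm e = 1 /\
    exists (L : R) (g : point -> R),
      (forall y z, `|g y - g z| <= L * enorm (y - z)) /\
      forall y, enorm (y - x) < r ->
        (Om y <-> dotp (y - x) e < g ((y - x) - dotp (y - x) e *: e)).

Definition hull (s : seq point) : set point :=
  [set x | exists lam : nat -> R, (forall i, 0 <= lam i) /\
     \sum_(i < size s) lam i = 1 /\ x = \sum_(i < size s) lam i *: nth 0 s i].

Definition nondegenerate (s : seq point) : bool :=
  \det (\matrix_(i < n, j < n) (nth 0 s i.+1 - nth 0 s 0) 0 j) != 0.

(** Ordered (tagged) simplices: vertex list (P_1,...,P_{n+1}) and the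
    Stevenson type gamma in {0,...,n-1}. *)
Definition tsimplex := (seq point * nat)%type.

(** Bisection: refinement edge P_1 P_{n+1}; children orderings by
    Stevenson's rule (which for n = 2 is newest vertex bisection). *)
Definition bisect (T : tsimplex) : seq tsimplex :=
  let s := T.1 in let g := T.2 in
  let x0 := nth 0 s 0 in let xn := nth 0 s n in
  let m := 2^-1 *: (x0 + xn) in
  let inner := [seq nth 0 s i | i <- iota 1 n.-1] in
  let g' := (g.+1 %% n)%N in
  [:: (x0 :: m :: inner, g'); (xn :: m :: take g inner ++ rev (drop g inner), g')].

Definition bisect_step (Tr Tr' : seq tsimplex) : Prop :=
  exists2 T, T \in Tr & perm_eq Tr' (rem T Tr ++ bisect T).

Inductive bisect_reach : seq tsimplex -> seq tsimplex -> Prop :=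
| br_refl Tr : bisect_reach Tr Tr
| br_step Tr Tr' Tr'' : bisect_step Tr Tr' -> bisect_reach Tr' Tr'' ->
    bisect_reach Tr Tr''.

Definition regular_triangulation (Om : set point) (Tr : seq tsimplex) : Prop :=
  uniq Tr /\
  (forall T, T \in Tr -> [/\ size T.1 = n.+1, nondegenerate T.1 & (T.2 < n)%N]) /\
  closure Om = [set x | exists2 T, T \in Tr & hull T.1 x] /\
  (forall T T', T \in Tr -> T' \in Tr -> T != T' ->
     ~~ perm_eq T.1 T'.1 /\
     hull T.1 `&` hull T'.1 = hull [seq P <- T.1 | P \in T'.1]).

Definition refinement (Om : set point) (Tr Trh : seq tsimplex) : Prop :=
  bisect_reach Tr Trh /\ regular_triangulation Om Trh.

Fixpoint desc (k : nat) (T : tsimplex) : seq tsimplex :=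
  if k is k'.+1 then flatten [seq desc k' C | C <- bisect T] else [:: T].

Definition halving (Tr : seq tsimplex) (M : nat) : Prop :=
  forall K, K \in Tr -> forall k D, D \in desc k K ->
  forall D', D' \in desc M D -> diam (hull D'.1) <= diam (hull D.1) / 2.

Definition paff := tsimplex -> point * R.
Definition aff (gc : point * R) (x : point) : R := dotp x gc.1 + gc.2.

Definition sides (s : seq point) : seq (seq point) :=
  [seq [seq nth 0 s j | j <- iota 0 (size s) & j != i] | i <- iota 0 (size s)].
Definition mid (E : seq point) : point := (size E)%:R^-1 *: \sum_(P <- E) P.

Definition CR0 (Tr : seq tsimplex) (v : paff) : Prop :=
  forall T, T \in Tr -> forall E, E \in sides T.1 ->
   (forall T', T' \in Tr -> T' != T -> forall E', E' \in sides T'.1 ->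
       perm_eq E E' -> aff (v T) (mid E) = aff (v T') (mid E')) /\
   ((forall T', T' \in Tr -> T' != T -> forall E', E' \in sides T'.1 ->
       ~~ perm_eq E E') -> aff (v T) (mid E) = 0).

(** Restriction to K (simplex of the coarse mesh) of a piecewise affine
    function on the fine mesh Trh, and of its piecewise gradient. *)
Definition piece (Trh : seq tsimplex) (K : tsimplex) (x : point) : option tsimplex :=
  let p := fun T : tsimplex => `[< hull T.1 `<=` hull K.1 /\ hull T.1 x >] in
  if has p Trh then Some (nth K Trh (find p Trh)) else None.
Definition evalK (Trh : seq tsimplex) (K : tsimplex) (v : paff) (x : point) : R :=
  if piece Trh K x is Some T then aff (v T) x else 0.
Definition gradK (Trh : seq tsimplex) (K : tsimplex) (v : paff) (x : point) : point :=
  if piece Trh K x is Some T then (v T).1 else 0.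

Definition ncons (x : R) (y : nat -> R) : nat -> R :=
  fun i => if i is j.+1 then y j else x.
Fixpoint iint (m : nat) (f : (nat -> R) -> \bar R) : \bar R :=
  if m is m'.+1 then
    (\int[@lebesgue_measure R]_(x in setT) iint m' (fun y => f (ncons x y)))%E
  else f (fun _ => 0).
Definition integral_over (A : set point) (f : point -> R) : R :=
  fine (iint n (fun y => let x := \row_(i < n) y i in
                  if `[< A x >] then (f x)%:E else 0%E)).

(** Surface integral over a side E = conv{Q_0,...,Q_{n-1}} via its affine
    parametrisation over the standard (n-1)-simplex (area formula with the
    Gram determinant), and the integral mean |E|^-1 int_E f ds. *)
Definition side_integral (E : seq point) (f : point -> R) : R :=
  let Dm := \matrix_(i < n.-1, j < n) (nth 0 E i.+1 - nth 0 E 0) 0 j in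
  let par := fun lam : nat -> R =>
     nth 0 E 0 + \sum_(i < n.-1) lam i *: (nth 0 E i.+1 - nth 0 E 0) in
  Num.sqrt (\det (Dm *m Dm^T)) *
  fine (iint n.-1 (fun lam =>
     if `[< (forall i, (i < n.-1)%N -> 0 <= lam i) /\ \sum_(i < n.-1) lam i <= 1 >]
     then (f (par lam))%:E else 0%E)).
Definition side_mean (E : seq point) (f : point -> R) : R :=
  side_integral E f / side_integral E (fun _ => 1).

Definition Cpoinc2 (M : nat) : R := (4 * M%:R - 3) / (3 * n%:R * (n%:R + 2)).
Definition kappaNC (M : nat) : R :=
  Num.sqrt (Cpoinc2 M + ((n.+1 * n.+2 * n ^ 2)%N%:R)^-1).

End Defs.

(* Main.v *)
Require Import Defs.
From HB Require Import structures.
From mathcomp Require Import all_boot all_order all_algebra.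
From mathcomp Require Import all_classical all_reals all_analysis.
From mathcomp Require Import measurable_realfun ring lra.
Set Implicit Arguments.
Unset Strict Implicit.
Unset Printing Implicit Defensive.
Import Order.TTheory GRing.Theory Num.Theory.
Import numFieldNormedType.Exports.
Local Open Scope classical_set_scope.
Local Open Scope ring_scope.

                                                                                  
                                                                                
                                                                                      
                                                                                    
                                                                                      
                                                                                  
                                                                                     
                                
                                                                                   
                                                                                   
                                                                                
                                                                           
                                                                              
                                                                                
                                                                                       

                                                                              
                                                                                    
                                                                                     
                                      

                           

(** Fix [K] and let f be the difference [vh - INCvh] on the fine simplices inside [K]. These are the
    leaves of a binary bisection tree rooted at [K] ([reach_leaves]). Every bisection halves the
    volume, so a mean over [K] is an iterated average of leaf values ([tavg], [bint_tavg]). Let Q, F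
    and G be the means over [K] of f^2, f and the squared gradient of f. The claim amounts to Q <=
    kappa^2 h_K^2 G, and it is proved by splitting Q = (Q - F^2) + F^2.

    The main tool is [trace_identity]: n times (mean over a simplex minus mean over the side
    opposite P) equals minus the mean of (x - P) . grad f. On one leaf it is elementary. It passes
    to unions of leaves because the Crouzeix-Raviart condition gives f the same mean from both sides
    of every interior side ([bint_side], [savg_match]), so jumps do not contribute.

    For the variance Q - F^2, the law of total variance at a bisection adds ((F1 - F2) / 2)^2 to the
    average of the variances of the two children. The children share the side that cuts their
    parent, so subtracting their trace identities leaves gradients only. Cauchy-Schwarz and the
    second moment of a child about a vertex then give [haar_step]. There are M levels at one scale
    of diameters before diameters halve, so the levels add up to M (1 + 1/4 + 1/16 + ...) = 4M/3
    ([var_bound]). The variance inside a leaf fits into the same sum ([haar_const_leaf]), because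
    halving all diameters takes at least n bisections ([halving_ge]).

    For F, the interpolation condition makes every side mean of f over [K] vanish. Averaging the
    trace identity over the vertices of [K] then bounds F by the second moment of [K] about its
    barycenter ([mean_bound]). The two constants together stay below kappa^2 ([kappa_sq_ge]).

    The integration theory starts from iterated Lebesgue integrals. An affine change of variables is
    established up to an unspecified positive factor ([rint_aff]). All means are taken over a
    reference simplex, where such factors cancel, and the moments of barycentric coordinates follow
    from bisection itself ([mom_half], [mom1E]). *)

Section TupleIntegral.

(** * Iterated Lebesgue integrals over tuples: Tonelli and translation invariance *)

Context (R : realType).
Local Notation RR := (measurableTypeR R).
Local Notation leb := (@lebesgue_measure R).

(** Tuples carry the measurable structure that Tonelli requires; [iint_tint] links this integral to
    [iint], whose variables are functions on [nat]. *)
Fixpoint tint m : (m.-tuple RR -> \bar R) -> \bar R :=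
  match m with
  | 0 => fun f => f [tuple]
  | m'.+1 => fun f => (\int[leb]_x tint (fun t : m'.-tuple RR => f (cons_tuple x t)))%E
  end.

Lemma measurable_cons_tuple d (P : measurableType d) m (f : P -> RR)
    (g : P -> m.-tuple RR) : measurable_fun setT f -> measurable_fun setT g ->
  measurable_fun setT (fun p => cons_tuple (f p) (g p)).
Proof. exact: measurable_cons. Qed.

(** Tonelli gives measurability for nonnegative integrands, so [G] is split into its positive and
    negative parts. *)
Lemma measurable_integral_param d (P : measurableType d) (G : P * RR -> \bar R) :
  measurable_fun setT G -> measurable_fun setT (fun p => \int[leb]_x G (p, x))%E.
Proof.
move=> mG.
rewrite (_ : (fun p => _) =
  (fun p => \int[leb]_x (G^\+ (p, x)) - \int[leb]_x (G^\- (p, x)))%E); last first.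
  apply/funext => p; rewrite [LHS]integralE; congr (_ - _)%E; apply: eq_integral => x _.
    by rewrite !funeposE.
  by rewrite !funenegE.
apply: emeasurable_funB.
- apply: (@measurable_fun_fubini_tonelli_F _ _ P RR R leb G^\+%E); first exact: measurable_funepos.
  by move=> q; exact: funepos_ge0.
- apply: (@measurable_fun_fubini_tonelli_F _ _ P RR R leb G^\-%E); first exact: measurable_funeneg.
  by move=> q; exact: funeneg_ge0.
Qed.

Lemma measurable_tint d (P : measurableType d) m (F : P * m.-tuple RR -> \bar R) :
  measurable_fun setT F -> measurable_fun setT (fun p => tint (fun t => F (p, t))).
Proof.
elim: m d P F => [|m IH] d P F mF /=.
  by apply: measurableT_comp => //; exact: measurable_fun_pair.
apply: (@measurable_integral_param _ _ (fun q => tint (fun t => F (q.1, cons_tuple q.2 t)))).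
apply: (IH _ _ (fun q : (P * RR) * m.-tuple RR => F (q.1.1, cons_tuple q.1.2 q.2))).
apply: measurableT_comp => //; apply: measurable_fun_pair.
  exact: measurableT_comp.
by apply: measurable_cons_tuple => //; exact: measurableT_comp.
Qed.

Lemma measurable_tint_cons m (f : m.+1.-tuple RR -> \bar R) :
  measurable_fun setT f ->
  measurable_fun setT (fun x : RR => tint (fun t => f (cons_tuple x t))).
Proof.
move=> mf; apply: (@measurable_tint _ _ _ (fun q => f (cons_tuple q.1 q.2))).
by apply: measurableT_comp => //; exact: measurable_cons_tuple.
Qed.

Lemma measurable_consr m (x : RR) d (T : measurableType d) (f : m.+1.-tuple RR -> T) :
  measurable_fun setT f -> measurable_fun setT (fun t : m.-tuple RR => f (cons_tuple x t)).
Proof. by move=> mf; apply: measurableT_comp => //; exact: measurable_cons_tuple. Qed.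

Lemma eq_tint m (f g : m.-tuple RR -> \bar R) : f =1 g -> tint f = tint g.
Proof. by move=> /funext ->. Qed.

Lemma tint_ge0 m (f : m.-tuple RR -> \bar R) :
  (forall t, 0 <= f t)%E -> (0 <= tint f)%E.
Proof. by elim: m f => [|m IH] f f0 //=; apply: integral_ge0 => x _; exact: IH. Qed.

Lemma tintZl m (f : m.-tuple RR -> \bar R) (k : \bar R) :
  measurable_fun setT f -> (forall t, 0 <= f t)%E -> (0 <= k)%E ->
  tint (fun t => k * f t)%E = (k * tint f)%E.
Proof.
elim: m f => [|m IH] f mf f0 k0 //=.
rewrite -ge0_integralZl //.
- by apply: eq_integral => x _; apply: IH => //; exact: measurable_consr.
- exact: measurable_tint_cons.
- by move=> x _; exact: tint_ge0.
Qed.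

Lemma tint_tonelli1 m (F : RR * m.-tuple RR -> \bar R) :
  measurable_fun setT F -> (forall q, 0 <= F q)%E ->
  (\int[leb]_x tint (fun t => F (x, t)) = tint (fun t => \int[leb]_x F (x, t)))%E.
Proof.
elim: m F => [|m IH] F mF F0 //=.
have mG : measurable_fun setT (fun q : RR * RR => tint (fun t => F (q.1, cons_tuple q.2 t))).
  apply: (@measurable_tint _ _ _ (fun p : (RR * RR) * m.-tuple RR =>
     F (p.1.1, cons_tuple p.1.2 p.2))).
  apply: measurableT_comp => //; apply: measurable_fun_pair; first exact: measurableT_comp.
  by apply: measurable_cons_tuple => //; exact: measurableT_comp.
rewrite (@fubini_tonelli _ _ RR RR R leb leb (fun q => tint (fun t => F (q.1, cons_tuple q.2 t)))) //; last first.
  by move=> q; exact: tint_ge0.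
apply: eq_integral => y _ /=.
apply: (IH (fun q => F (q.1, cons_tuple y q.2))) => //.
by apply: measurableT_comp => //; apply: measurable_fun_pair => //; exact: measurable_cons_tuple.
Qed.

Lemma tint_tonelli k m (F : k.-tuple RR * m.-tuple RR -> \bar R) :
  measurable_fun setT F -> (forall q, 0 <= F q)%E ->
  tint (fun x => tint (fun y => F (x, y))) = tint (fun y => tint (fun x => F (x, y))).
Proof.
elim: k F => [|k IH] F mF F0 //=.
transitivity (\int[leb]_z tint (fun y => tint (fun x => F (cons_tuple z x, y))))%E.
  apply: eq_integral => z _; apply: (IH (fun q => F (cons_tuple z q.1, q.2))) => //.
  by apply: measurableT_comp => //; apply: measurable_fun_pair => //; exact: measurable_cons_tuple.
apply: (@tint_tonelli1 _ (fun q => tint (fun x => F (cons_tuple q.1 x, q.2)))).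
- apply: (@measurable_tint _ _ _ (fun p => F (cons_tuple p.1.1 p.2, p.1.2))).
  apply: measurableT_comp => //; apply: measurable_fun_pair; last exact: measurableT_comp.
  by apply: measurable_cons_tuple => //; exact: measurableT_comp.
- by move=> q; exact: tint_ge0.
Qed.

(** The image of Lebesgue measure under the shift has the right value on half-open intervals, hence
    it is Lebesgue measure. *)
Lemma ge0_integral_shift (a : R) (f : RR -> \bar R) :
  measurable_fun setT f -> (forall x, 0 <= f x)%E ->
  (\int[leb]_x f (x + a)%R = \int[leb]_x f x)%E.
Proof.
move=> mf f0.
have ms : measurable_fun setT ((fun x => x + a) : RR -> RR).
  exact: measurable_funD.
transitivity (\int[pushforward leb ((fun x => x + a)%R : RR -> RR)]_x f x)%E.
  by rewrite ge0_integral_pushforward // preimage_setT.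
apply: eq_measure_integral => A mA _; apply/esym.
apply: lebesgue_measure_unique => //= _ [[u v]] _ <-.
rewrite /pushforward /= (_ : _ @^-1` _ = `]u - a, v - a]%classic); last first.
  by apply/seteqP; split => x /=; rewrite !in_itv /= ltrBlDr lerBrDr.
by rewrite !lebesgue_measure_itv /= !lte_fin ltrD2r -!EFinD opprD addrACA subrr addr0.
Qed.

Definition tadd m (s t : m.-tuple RR) : m.-tuple RR := [tuple (tnth s i + tnth t i : RR)  | i < m].

Lemma tint_shift m (a : m.-tuple RR) (f : m.-tuple RR -> \bar R) :
  measurable_fun setT f -> (forall t, 0 <= f t)%E ->
  tint (fun t => f (tadd t a)) = tint f.
Proof.
elim: m a f => [|m IH] a f mf f0 /=; first by congr f; rewrite tuple0.
case/tupleP: a => a0 a.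
transitivity (\int[leb]_x tint (fun t => f (cons_tuple (x + a0)%R t)))%E; last first.
  apply: (@ge0_integral_shift _ (fun x => tint (fun t => f (cons_tuple x t)))).
    exact: measurable_tint_cons.
  by move=> x; exact: tint_ge0.
apply: eq_integral => x _; rewrite -(IH a (fun t => f (cons_tuple (x+a0)%R t))) //.
  apply: eq_tint => t; congr f; apply: eq_from_tnth => i.
  rewrite tnth_mktuple; case: (unliftP ord0 i) => [j|] ->.
    by rewrite !tnthS tnth_mktuple.
  by rewrite !tnth0.
exact: measurable_consr.
Qed.

End TupleIntegral.

(** * Finiteness and linearity for bounded functions of bounded support *)

Section BoundedSupport.
Context (R : realType).
Local Notation RR := (measurableTypeR R).
Local Notation leb := (@lebesgue_measure R).

Definition tbox m (r : R) (t : m.-tuple RR) : bool := all (fun x : R => `|x| <= r) t.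

Lemma tbox_cons m r (x : R) (t : m.-tuple RR) :
  tbox r (cons_tuple x t) = (`|x| <= r) && tbox r t.
Proof. by []. Qed.

Definition bal (r x : R) : R := (`|x| <= r)%R%:R.

Lemma balE (r x : R) : bal r x = \1_(`[- r, r]%classic) x.
Proof.
rewrite /bal ler_norml indicE; congr (nat_of_bool _)%:R.
apply/idP/idP => [H|/set_mem /=]; last by rewrite in_itv.
by apply/mem_set; rewrite /= in_itv.
Qed.

(** One constant bounds both the size of [f] and the box outside which it vanishes. *)
Definition tbsupp m (f : m.-tuple RR -> R) : Prop :=
  measurable_fun setT f /\
  exists r : R, 0 <= r /\ forall t, `|f t| <= r * (tbox r t)%:R.

Lemma integral_ball (r c : R) : 0 <= r -> 0 <= c ->
  (\int[leb]_x (c * bal r x)%:E = (c * (2 * r))%:E)%E.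
Proof.
move=> r0 c0.
rewrite (_ : (fun x => _) = (fun x => c%:E * (\1_(`[- r, r]%classic : set RR) x)%:E)%E); last first.
  by apply/funext => x; rewrite -EFinM balE.
rewrite ge0_integralZl//; last first.
  exact/measurable_EFinP/measurable_indic.
rewrite integral_indic//= setIT lebesgue_measure_itv /= lte_fin.
rewrite EFinM; congr (_ * _)%E; case: ltP => [_|rr]; first by rewrite -EFinD; congr _%:E; ring.
by congr _%:E; lra.
Qed.

Lemma measurable_ball (r c : R) : measurable_fun setT (fun x : RR => (c * bal r x)%:E).
Proof.
rewrite (_ : (fun x => _) = (fun x => c%:E * (\1_(`[- r, r]%classic : set RR) x)%:E)%E); last first.
  by apply/funext => x; rewrite -EFinM balE.
apply: emeasurable_funM => //; exact/measurable_EFinP/measurable_indic.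
Qed.

(** Every variable contributes an interval of length [2 * r]. The height [c] is separate from [r] so
    that the induction can take it to be 0 on slices outside the box. *)
Lemma tint_bound m (f : m.-tuple RR -> R) r : measurable_fun setT f -> 0 <= r ->
  forall c, 0 <= c -> (forall t, `|f t| <= c * (tbox r t)%:R) ->
  (`|tint (EFin \o f)| <= (c * (2 * r) ^+ m)%:E)%E.
Proof.
move=> + r0; elim: m f => [|m IH] f mf c c0 fr /=.
  by rewrite expr0 mulr1 lee_fin (le_trans (fr _))//= mulr1.
apply: le_trans (le_abse_integral _ _ _) _ => //.
  by apply: (@measurable_tint_cons _ _ (EFin \o f)); exact/measurable_EFinP.
apply: (@le_trans _ _ (\int[leb]_x ((c * (2 * r) ^+ m) * bal r x)%:E)%E).
  apply: ge0_le_integral => //.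
  - by apply: measurableT_comp => //; apply: (@measurable_tint_cons _ _ (EFin \o f)); exact/measurable_EFinP.
  - exact: measurable_ball.
  - move=> x _; have [xr|xr] := boolP (`|x : R| <= r)%R.
      rewrite /bal xr mulr1; apply: IH => //; first exact: measurable_consr.
      by move=> t; rewrite (le_trans (fr _))// tbox_cons xr.
    rewrite (_ : (fun t => _) = EFin \o (fun t : m.-tuple RR => f (cons_tuple x t)))//.
    rewrite /bal (negbTE xr) mulr0 -(mul0r ((2 * r) ^+ m)); apply: IH => //; first exact: measurable_consr.
    by move=> t; rewrite (le_trans (fr _))// tbox_cons (negbTE xr) mulr0 mul0r.
rewrite integral_ball// ?mulr_ge0 ?exprn_ge0 ?mulr_ge0//.
by rewrite -mulrA -exprSr.
Qed.

Lemma tbsupp_consr m (f : m.+1.-tuple RR -> R) x :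
  tbsupp f -> tbsupp (fun t : m.-tuple RR => f (cons_tuple x t)).
Proof.
move=> [mf [r [r0 fr]]]; split; first exact: measurable_consr.
exists r; split => // t; rewrite (le_trans (fr _))// ler_wpM2l// ler_nat.
by rewrite /tbox /=; case: (_ <= r).
Qed.

Lemma tint_fin_num m (f : m.-tuple RR -> R) : tbsupp f -> tint (EFin \o f) \is a fin_num.
Proof.
move=> [mf [r [r0 fr]]]; rewrite fin_num_abs; apply: le_lt_trans (ltry _).
exact: tint_bound fr.
Qed.

Lemma tint_integrable m (f : m.+1.-tuple RR -> R) : tbsupp f ->
  leb.-integrable setT (fun x : RR => tint (fun t : m.-tuple RR => (f (cons_tuple x t))%:E)).
Proof.
move=> [mf [r [r0 fr]]]; apply/integrableP; split.
  by apply: (@measurable_tint_cons _ _ (EFin \o f)); exact/measurable_EFinP.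
apply: (@le_lt_trans _ _ (\int[leb]_x ((r * (2 * r) ^+ m) * bal r x)%:E)%E).
  apply: ge0_le_integral => //.
  - apply: measurableT_comp => //.
    by apply: (@measurable_tint_cons _ _ (EFin \o f)); exact/measurable_EFinP.
  - exact: measurable_ball.
  - move=> x _; have [xr|xr] := boolP (`|x : R| <= r)%R.
      rewrite /bal xr mulr1; apply: tint_bound => //; first exact: measurable_consr.
      by move=> t; rewrite (le_trans (fr _))// tbox_cons xr.
    rewrite /bal (negbTE xr) mulr0 -(mul0r ((2 * r) ^+ m)).
    apply: (@tint_bound _ (fun t : m.-tuple RR => f (cons_tuple x t))) => //.
      exact: measurable_consr.
    by move=> t; rewrite (le_trans (fr _))// tbox_cons (negbTE xr) mulr0 mul0r.
by rewrite integral_ball ?ltry // mulr_ge0 ?exprn_ge0 ?mulr_ge0.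
Qed.

Lemma tintD m (f g : m.-tuple RR -> R) : tbsupp f -> tbsupp g ->
  (tint (fun t => (f t + g t)%:E) = tint (EFin \o f) + tint (EFin \o g))%E.
Proof.
elim: m f g => [|m IH] f g nf ng //=.
rewrite -integralD//=; [|exact: tint_integrable..].
by apply: eq_integral => x _; apply: (IH (fun t => f (cons_tuple x t)));
  exact: tbsupp_consr.
Qed.

Lemma tintZ m (f : m.-tuple RR -> R) k : tbsupp f ->
  (tint (fun t => (k * f t)%:E) = k%:E * tint (EFin \o f))%E.
Proof.
elim: m f => [|m IH] f nf //=.
rewrite -integralZl//=; last exact: tint_integrable.
by apply: eq_integral => x _; apply: (IH (fun t => f (cons_tuple x t))); exact: tbsupp_consr.
Qed.

End BoundedSupport.

(** * The same integral for functions of row vectors *)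

Section RowIntegral.
Context (R : realType).
Local Notation RR := (measurableTypeR R).

Definition row_t m (t : m.-tuple RR) : 'rV[R]_m := \row_i tnth t i.
Definition rmeas m (f : 'rV[R]_m -> R) : Prop :=
  measurable_fun setT (fun t : m.-tuple RR => f (row_t t)).
Definition vbox m (r : R) (x : 'rV[R]_m) : bool := [forall i, `|x 0 i| <= r].
Definition bsupp m (f : 'rV[R]_m -> R) : Prop :=
  [/\ rmeas f, exists C, forall x, `|f x| <= C &
      exists r, forall x, ~~ vbox r x -> f x = 0].
Definition erint m (f : 'rV[R]_m -> R) : \bar R :=
  tint (fun t : m.-tuple RR => (f (row_t t))%:E).
Definition rint m (f : 'rV[R]_m -> R) : R := fine (erint f).

Lemma row_tK m (x : 'rV[R]_m) : row_t [tuple (x 0 i : RR) | i < m] = x.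
Proof. by apply/rowP => i; rewrite mxE tnth_mktuple. Qed.

Lemma tbox_row m r (t : m.-tuple RR) : tbox r t = vbox r (row_t t).
Proof.
apply/all_tnthP/forallP => H i; first by rewrite mxE.
by have := H i; rewrite mxE.
Qed.

Lemma vbox_le m r r' (x : 'rV[R]_m) : r <= r' -> vbox r x -> vbox r' x.
Proof. by move=> rr /forallP H; apply/forallP => i; exact: le_trans (H i) rr. Qed.

Lemma bsupp_tbsupp m (f : 'rV[R]_m -> R) : bsupp f -> tbsupp (fun t => f (row_t t)).
Proof.
move=> [mf [C fC] [r fr]]; split => //.
exists (`|C| + `|r|); split; first by rewrite addr_ge0.
move=> t; have [H|H] := boolP (tbox _ t).
  by rewrite mulr1 (le_trans (fC _))// (le_trans (ler_norm _)) ?lerDl.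
rewrite mulr0 fr ?normr0//; apply: contra H; rewrite tbox_row.
by apply: vbox_le; rewrite (le_trans (ler_norm _))// lerDr.
Qed.

Lemma erintE m (f : 'rV[R]_m -> R) : bsupp f -> erint f = (rint f)%:E.
Proof. by move=> /bsupp_tbsupp nf; rewrite fineK//; exact: tint_fin_num. Qed.

Lemma rintD m (f g : 'rV[R]_m -> R) : bsupp f -> bsupp g ->
  rint (fun x => f x + g x) = rint f + rint g.
Proof.
move=> nf ng; rewrite /rint /erint tintD; [|exact: bsupp_tbsupp..].
by rewrite fineD//; apply: tint_fin_num; exact: bsupp_tbsupp.
Qed.

Lemma rintZ m (f : 'rV[R]_m -> R) k : bsupp f -> rint (fun x => k * f x) = k * rint f.
Proof.
move=> nf; rewrite /rint /erint tintZ; last exact: bsupp_tbsupp.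
by rewrite fineM//; apply: tint_fin_num; exact: bsupp_tbsupp.
Qed.

Lemma eq_rint m (f g : 'rV[R]_m -> R) : f =1 g -> rint f = rint g.
Proof. by move=> /funext ->. Qed.

Lemma rint_ge0 m (f : 'rV[R]_m -> R) : (forall x, 0 <= f x) -> 0 <= rint f.
Proof. by move=> f0; apply/fine_ge0/tint_ge0 => t; rewrite lee_fin. Qed.

Lemma rmeas_comp d (P : measurableType d) m (h : P -> 'rV[R]_m) (f : 'rV[R]_m -> R) :
  rmeas f -> (forall i, measurable_fun setT (fun p => h p 0 i)) ->
  measurable_fun setT (fun p => f (h p)).
Proof.
move=> mf mh.
rewrite (_ : (fun p => _) = (fun t : m.-tuple RR => f (row_t t)) \o
   (fun p => [tuple (h p 0 i : RR) | i < m])); last first.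
  by apply/funext => p /=; rewrite row_tK.
apply: measurableT_comp => //; apply/measurable_fun_tnthP => i.
apply: eq_measurable_fun (mh i) => p _ /=; by rewrite tnth_mktuple.
Qed.

Lemma measurable_mulmx d (P : measurableType d) k m (h : P -> k.-tuple RR)
    (A : 'M[R]_(k, m)) i :
  measurable_fun setT h -> measurable_fun setT (fun p => (row_t (h p) *m A) 0 i).
Proof.
move=> mh.
rewrite (_ : (fun p => _) = (fun p => \sum_j (tnth (h p) j : R) * A j i)); last first.
  by apply/funext => p; rewrite mxE; apply: eq_bigr => j _; rewrite mxE.
apply: measurable_sum => j; apply: measurable_funM => //.
by apply: (measurableT_comp (measurable_tnth j) mh).
Qed.

Lemma measurable_row d (P : measurableType d) k (h : P -> k.-tuple RR) i :
  measurable_fun setT h -> measurable_fun setT (fun p => row_t (h p) 0 i).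
Proof.
move=> mh; rewrite (_ : (fun p => _) = (fun p => tnth (h p) i)).
  by apply: (measurableT_comp (measurable_tnth i) mh).
by apply/funext => p; rewrite mxE.
Qed.

Lemma rmeas_aff k m (f : 'rV[R]_m -> R) a (A : 'M[R]_(k, m)) :
  rmeas f -> rmeas (fun x => f (a + x *m A)).
Proof.
move=> mf; apply: (@rmeas_comp _ _ _ (fun t => a + row_t t *m A)) => // i.
rewrite (_ : (fun p => _) = (fun p => a 0 i + (row_t p *m A) 0 i)).
  by apply: measurable_funD => //; apply: (@measurable_mulmx _ _ _ _ id).
by apply/funext => p; rewrite mxE.
Qed.

Lemma vbox_mulmx k m (A : 'M[R]_(k, m)) r : exists r', forall (x : 'rV[R]_k),
  vbox r x -> vbox r' (x *m A).
Proof.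
exists (\sum_i \sum_j (`|r| * `|A i j|)) => x /forallP xr; apply/forallP => j.
rewrite mxE; apply: le_trans (ler_norm_sum _ _ _) _; apply: ler_sum => i _.
rewrite normrM; apply: (@le_trans _ _ (`|r| * `|A i j|)).
  by rewrite ler_wpM2r// (le_trans (xr i))// ler_norm.
by rewrite (bigD1 j)//= lerDl sumr_ge0// => l _; exact: mulr_ge0.
Qed.

Lemma vboxD m r r' (x y : 'rV[R]_m) : vbox r x -> vbox r' y -> vbox (r + r') (x + y).
Proof.
move=> /forallP xr /forallP yr; apply/forallP => i; rewrite mxE.
by apply: le_trans (ler_normD _ _) _; rewrite lerD.
Qed.

Lemma vboxN m r (x : 'rV[R]_m) : vbox r (- x) = vbox r x.
Proof. by apply: eq_forallb => i; rewrite mxE normrN. Qed.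

Lemma vbox_ex m (x : 'rV[R]_m) : exists r, vbox r x.
Proof.
exists (\sum_i `|x 0 i|); apply/forallP => i.
by rewrite (bigD1 i)//= lerDl sumr_ge0.
Qed.

Lemma bsupp_aff m (f : 'rV[R]_m -> R) a (A : 'M[R]_m) : A \in unitmx ->
  bsupp f -> bsupp (fun x => f (a + x *m A)).
Proof.
move=> uA [mf [C fC] [r fr]]; split; [exact: rmeas_aff|by exists C|].
have [ra Ha] := vbox_ex (- a).
have [r' Hr'] := vbox_mulmx (invmx A) (r + ra).
exists r' => x xr; apply: fr; apply: contra xr => xr.
by have := Hr' _ (vboxD xr Ha); rewrite addrAC subrr add0r mulmxK.
Qed.

Lemma bsupp_box m r : bsupp (fun x : 'rV[R]_m => (vbox r x)%:R).
Proof.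
split.
- rewrite /rmeas (_ : (fun t => _) = (fun t : m.-tuple RR => \prod_i bal r (tnth t i))).
    have mb : measurable_fun setT (bal r : RR -> RR).
      rewrite (_ : bal r = \1_(`[- r, r]%classic)); first exact: measurable_indic.
      by apply: funext => x; rewrite balE.
    by apply: measurable_prod => i _; exact: (measurableT_comp mb (measurable_tnth i)).
  apply/funext => t; have [/forallP H|/forallPn[i H]] := boolP (vbox r _).
    by rewrite big1// => i _; rewrite /bal; have := H i; rewrite mxE => ->.
  by rewrite (bigD1 i)//= /bal; move: H; rewrite mxE => /negbTE ->; rewrite mul0r.
- by exists 1 => x; case: vbox; rewrite ?normr1 ?normr0.
- by exists r => x /negbTE ->.
Qed.

Lemma erint_shift m (f : 'rV[R]_m -> R) a : rmeas f -> (forall x, 0 <= f x) ->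
  erint (fun x => f (x + a)) = erint f.
Proof.
move=> mf f0.
rewrite /erint -[RHS](@tint_shift _ _ [tuple (a 0 i : RR) | i < m]); last 2 first.
- exact/measurable_EFinP.
- by move=> t; rewrite lee_fin.
apply: eq_tint => t; congr (f _)%:E; apply/rowP => i.
by rewrite !mxE !tnth_mktuple.
Qed.

Lemma erintZl m (f : 'rV[R]_m -> R) k : rmeas f -> (forall x, 0 <= f x) -> 0 <= k ->
  erint (fun x => k * f x) = (k%:E * erint f)%E.
Proof.
move=> mf f0 k0; rewrite /erint -tintZl//; last by move=> t; rewrite lee_fin.
exact/measurable_EFinP.
Qed.

Lemma erint_ge0 m (f : 'rV[R]_m -> R) : (forall x, 0 <= f x) -> (0 <= erint f)%E.
Proof. by move=> f0; apply: tint_ge0 => t; rewrite lee_fin. Qed.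

End RowIntegral.

                                    

(** * Affine changes of variables up to a positive factor *)

Section ChangeOfVariables.
Context (R : realType).
Local Notation RR := (measurableTypeR R).

Lemma erint_tonelli k m (F : 'rV[R]_k -> 'rV[R]_m -> R) :
  measurable_fun setT
    (fun q : k.-tuple RR * m.-tuple RR => F (row_t q.1) (row_t q.2)) ->
  (forall x y, 0 <= F x y) ->
  tint (fun s : k.-tuple RR => erint (F (row_t s))) =
  tint (fun t : m.-tuple RR => erint (fun x => F x (row_t t))).
Proof.
move=> mF F0.
apply: (@tint_tonelli _ _ _ (fun q => (F (row_t q.1) (row_t q.2))%:E)).
  exact/measurable_EFinP.
by move=> q; rewrite lee_fin.
Qed.

Lemma measurable_joint d (P : measurableType d) k m l (h1 : P -> k.-tuple RR)
    (h2 : P -> m.-tuple RR) (A : 'M[R]_(k, l)) (B : 'M[R]_(m, l)) (f : 'rV[R]_l -> R) :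
  measurable_fun setT h1 -> measurable_fun setT h2 -> rmeas f ->
  measurable_fun setT (fun p => f (row_t (h1 p) *m A + row_t (h2 p) *m B)).
Proof.
move=> m1 m2 mf; apply: rmeas_comp => // i.
rewrite (_ : (fun p => _) =
  (fun p => (row_t (h1 p) *m A) 0 i + (row_t (h2 p) *m B) 0 i)); last first.
  by apply/funext => p; rewrite mxE.
by apply: measurable_funD; exact: measurable_mulmx.
Qed.

                                                                                
                                                    
(** This is the argument for uniqueness of Haar measure. The double integral of
    [f x * g (x + y *m A)] is evaluated in both orders, each time after a translation, and evenness
    of [f] turns [f (x - y *m A)] into [f (- x + y *m A)]. With [f] the indicator of a cube, it
    shows that the ratio of the integrals of [g (y *m A)] and [g y] does not depend on [g]. *)
Lemma erint_mulmx_swap m (f g : 'rV[R]_m -> R) (A : 'M[R]_m) :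
  A \in unitmx -> rmeas f -> rmeas g ->
  (forall x, 0 <= f x) -> (forall x, 0 <= g x) -> (forall x, f (- x) = f x) ->
  (erint f * erint (fun y => g (y *m A)) = erint g * erint (fun y => f (y *m A)))%E.
Proof.
move=> uA mf mg f0 g0 fN.
have mA (h : 'rV[R]_m -> R) : rmeas h -> rmeas (fun y => h (y *m A)).
  move=> mh; rewrite (_ : (fun y => _) = (fun y => h (0 + y *m A))); first exact: rmeas_aff.
  by apply/funext => y; rewrite add0r.
have mAx (h : 'rV[R]_m -> R) x : rmeas h -> rmeas (fun y => h (x + y *m A)).
  exact: rmeas_aff.
have fstT := @measurable_fst _ _ (m.-tuple RR) (m.-tuple RR).
have sndT := @measurable_snd _ _ (m.-tuple RR) (m.-tuple RR).
transitivity (tint (fun s : m.-tuple RR => erint (fun y => f (row_t s) * g (row_t s + y *m A)))).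
  rewrite muleC {2}/erint -tintZl; last 3 first.
  - exact/measurable_EFinP.
  - by move=> t; rewrite lee_fin.
  - exact: erint_ge0.
  apply: eq_tint => s; rewrite erintZl//; last exact: mAx.
  rewrite muleC; congr (_ * _)%E.
  rewrite -[LHS](@erint_shift _ _ _ (row_t s *m invmx A))//; last exact: mA.
  by congr erint; apply/funext => y; rewrite mulmxDl mulmxKV// addrC.
rewrite (@erint_tonelli _ _ (fun x y => f x * g (x + y *m A))); last 2 first.
- apply: measurable_funM; first exact: (measurableT_comp mf).
  have := @measurable_joint _ _ _ _ _ fst snd 1%:M A g fstT sndT mg.
  by under eq_fun do rewrite mulmx1.
- by move=> x y; rewrite mulr_ge0.
transitivity (tint (fun t : m.-tuple RR => erint (fun x => f (x - row_t t *m A) * g x))).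
  apply: eq_tint => t.
  rewrite -[RHS](@erint_shift _ _ _ (row_t t *m A)).
  - by congr erint; apply/funext => x; rewrite addrK.
  - apply: measurable_funM; last exact: mg.
    have := @rmeas_aff _ _ _ f (- (row_t t *m A)) 1%:M mf.
    by apply: eq_measurable_fun => x _; rewrite mulmx1 addrC.
  - by move=> x; rewrite mulr_ge0.
rewrite -(@erint_tonelli _ _ (fun x y => f (x - y *m A) * g x)); last 2 first.
- apply: measurable_funM; last exact: (measurableT_comp mg).
  have := @measurable_joint _ _ _ _ _ fst snd 1%:M (- A) f fstT sndT mf.
  by under eq_fun do rewrite mulmx1 mulmxN.
- by move=> x y; rewrite mulr_ge0.
rewrite muleC [erint g]/erint -tintZl; last 3 first.
- exact/measurable_EFinP.
- by move=> t; rewrite lee_fin.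
- exact: erint_ge0.
apply: eq_tint => s.
transitivity (erint (fun y => g (row_t s) * f (- row_t s + y *m A))).
  by congr erint; apply/funext => y; rewrite mulrC -fN opprB addrC.
rewrite erintZl//; last exact: mAx.
rewrite muleC; congr (_ * _)%E.
rewrite -[RHS](@erint_shift _ _ _ (- row_t s *m invmx A))//; last exact: mA.
by congr erint; apply/funext => y; rewrite mulmxDl mulmxKV// addrC.
Qed.

Lemma rint_box m r : 0 <= r -> rint (fun x : 'rV[R]_m => (vbox r x)%:R) = (2 * r) ^+ m.
Proof.
move=> r0; rewrite /rint /erint.
under eq_tint do rewrite -tbox_row.
suff -> : tint (fun t : m.-tuple RR => (tbox r t)%:R%:E) = ((2 * r) ^+ m)%:E by [].
elim: m => [|m IH] //=.
transitivity (\int[@lebesgue_measure R]_x ((2 * r) ^+ m * bal r x)%:E)%E.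
  apply: eq_integral => x _; rewrite EFinM -IH muleC.
  rewrite -(@tintZl _ _ (fun t : m.-tuple RR => (tbox r t)%:R%:E)); last 3 first.
  - have [H _ _] := @bsupp_box R m r; apply/measurable_EFinP.
    by apply: eq_measurable_fun H => t _; rewrite tbox_row.
  - by move=> t; rewrite lee_fin.
  - by rewrite lee_fin /bal.
  by apply: eq_tint => t; rewrite tbox_cons -EFinM /bal -natrM mulnb.
by rewrite integral_ball ?exprn_ge0 ?mulr_ge0// -exprSr.
Qed.

Lemma bsupp_mulmx m (f : 'rV[R]_m -> R) (A : 'M[R]_m) : A \in unitmx ->
  bsupp f -> bsupp (fun x => f (x *m A)).
Proof.
move=> uA nf; rewrite (_ : (fun x => _) = (fun x => f (0 + x *m A))).
  exact: bsupp_aff.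
by apply/funext => x; rewrite add0r.
Qed.

                                                                   
(** The factor is read off from the unit cube by means of [erint_mulmx_swap]. *)
Lemma rint_mulmx_ge0 m (A : 'M[R]_m) : A \in unitmx ->
  exists2 c, 0 < c & forall g, bsupp g -> (forall x, 0 <= g x) ->
    rint (fun x => g (x *m A)) = c * rint g.
Proof.
move=> uA.
pose b (x : 'rV[R]_m) : R := (vbox 1 x)%:R.
have nb : bsupp b by exact: bsupp_box.
have b0 x : 0 <= b x by exact: ler0n.
have bN x : b (- x) = b x by rewrite /b vboxN.
have Ib : rint b = 2 ^+ m by rewrite rint_box// mulr1.
have key B g : B \in unitmx -> bsupp g -> (forall x, 0 <= g x) ->
    2 ^+ m * rint (fun x => g (x *m B)) = rint g * rint (fun x => b (x *m B)).
  move=> uB ng g0; have [mb _ _] := nb; have [mg _ _] := ng.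
  have := erint_mulmx_swap uB mb mg b0 g0 bN.
  rewrite !erintE//; [|exact: bsupp_mulmx..].
  by move=> /(congr1 fine) /=; rewrite Ib.
have m0 : (2 ^+ m : R) != 0 by rewrite expf_neq0.
exists (rint (fun x => b (x *m A)) / 2 ^+ m); last first.
  by move=> g ng g0; apply: (mulfI m0); rewrite key//; field.
rewrite divr_gt0 ?exprn_gt0// lt0r rint_ge0// andbT.
(* A zero factor would make the integral of the unit cube vanish, as seen by undoing [A] with its
   inverse. *)
apply/eqP => c0.
have uA' : invmx A \in unitmx by rewrite unitmx_inv.
have := key (invmx A) (fun x => b (x *m A)) uA' (bsupp_mulmx uA nb) (fun x => b0 _).
rewrite c0 mul0r (_ : (fun x => _) = b) ?Ib.
  by move/eqP; rewrite mulf_eq0 (negbTE m0).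
by apply/funext => x; rewrite mulmxKV.
Qed.

Lemma bsupp_max0 m (f : 'rV[R]_m -> R) : bsupp f -> bsupp (fun x => Num.max (f x) 0).
Proof.
move=> [mf [C fC] [r fr]]; split.
- by apply: measurable_maxr.
- exists C => x; have := fC x; case: (lerP (f x) 0) => [_|//].
  by rewrite normr0; apply: le_trans.
- by exists r => x /fr ->; rewrite maxxx.
Qed.

Lemma bsuppZ m (f : 'rV[R]_m -> R) k : bsupp f -> bsupp (fun x => k * f x).
Proof.
move=> [mf [C fC] [r fr]]; split.
- by apply: measurable_funM.
- by exists (`|k| * C) => x; rewrite normrM ler_wpM2l.
- by exists r => x /fr ->; rewrite mulr0.
Qed.

Lemma bsuppD m (f g : 'rV[R]_m -> R) : bsupp f -> bsupp g -> bsupp (fun x => f x + g x).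
Proof.
move=> [mf [C fC] [r fr]] [mg [D gD] [s gs]]; split.
- exact: measurable_funD.
- by exists (C + D) => x; apply: le_trans (ler_normD _ _) _; rewrite lerD.
- exists (Num.max r s) => x H; rewrite fr ?gs ?addr0//; apply: contra H;
  by apply: vbox_le; rewrite le_max lexx ?orbT.
Qed.

Lemma rint_mulmx m (A : 'M[R]_m) : A \in unitmx ->
  exists2 c, 0 < c & forall g, bsupp g -> rint (fun x => g (x *m A)) = c * rint g.
Proof.
move=> uA; have [c c0 H] := rint_mulmx_ge0 uA; exists c => // g ng.
pose g1 x := Num.max (g x) 0; pose g2 x := Num.max (-1 * g x) 0.
have n1 : bsupp g1 by exact: bsupp_max0.
have n2 : bsupp g2 by apply/bsupp_max0/bsuppZ.
have E x : g x = g1 x + -1 * g2 x.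
  by rewrite /g1 /g2; case: (leP (g x) 0); case: (leP (-1 * g x) 0) => *; lra.
have p1 x : 0 <= g1 x by rewrite /g1 le_max lexx orbT.
have p2 x : 0 <= g2 x by rewrite /g2 le_max lexx orbT.
rewrite (eq_rint E) rintD//; last exact: bsuppZ.
rewrite rintZ// (eq_rint (fun x => E (x *m A))) (@rintD _ _ (fun x => g1 (x *m A)) (fun x => -1 * g2 (x *m A))).
- rewrite (@rintZ _ _ (fun x => g2 (x *m A))) ?H//; last exact: bsupp_mulmx.
  by ring.
- exact: bsupp_mulmx.
- by apply: bsuppZ; exact: bsupp_mulmx.
Qed.

Lemma rint_shift m (f : 'rV[R]_m -> R) a : bsupp f -> rint (fun x => f (a + x)) = rint f.
Proof.
move=> nf.
pose g1 x := Num.max (f x) 0; pose g2 x := Num.max (-1 * f x) 0.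
have n1 : bsupp g1 by exact: bsupp_max0.
have n2 : bsupp g2 by apply/bsupp_max0/bsuppZ.
have E x : f x = g1 x + -1 * g2 x.
  by rewrite /g1 /g2; case: (leP (f x) 0); case: (leP (-1 * f x) 0) => *; lra.
have sh g : bsupp g -> bsupp (fun x => g (a + x)).
  move=> /(bsupp_aff a (unitmx1 _ _)).
  by under eq_fun do rewrite mulmx1.
have S g : bsupp g -> (forall x, 0 <= g x) -> rint (fun x => g (a + x)) = rint g.
  move=> [mg _ _] g0; rewrite /rint -(erint_shift a mg g0); congr (fine (erint _)).
  by apply/funext => x; rewrite addrC.
have p1 x : 0 <= g1 x by rewrite /g1 le_max lexx orbT.
have p2 x : 0 <= g2 x by rewrite /g2 le_max lexx orbT.
rewrite (eq_rint E) rintD//; last exact: bsuppZ.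
rewrite rintZ// (eq_rint (fun x => E (a + x))) (@rintD _ _ (fun x => g1 (a + x)) (fun x => -1 * g2 (a + x))).
- by rewrite (@rintZ _ _ (fun x => g2 (a + x))) ?S//; exact: sh.
- exact: sh.
- by apply: bsuppZ; exact: sh.
Qed.

Lemma rint_aff m (A : 'M[R]_m) : A \in unitmx ->
  exists2 c, 0 < c & forall g a, bsupp g -> rint (fun x => g (a + x *m A)) = c * rint g.
Proof.
move=> uA; have [c c0 H] := rint_mulmx uA; exists c => // g a ng.
rewrite -[in RHS](@rint_shift _ _ a)// -H//.
by have := bsupp_aff a (unitmx1 _ _) ng; under eq_fun do rewrite mulmx1.
Qed.

End ChangeOfVariables.

                             

(** * Hyperplanes are null sets *)

Section NullSets.
Context (R : realType).
Local Notation RR := (measurableTypeR R).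

Lemma le_rint m (f g : 'rV[R]_m -> R) : bsupp f -> bsupp g -> (forall x, f x <= g x) ->
  rint f <= rint g.
Proof.
move=> nf ng fg; rewrite (@eq_rint _ _ g (fun x => f x + (g x + -1 * f x))); last first.
  by move=> x; ring.
rewrite rintD//; last by apply: bsuppD => //; exact: bsuppZ.
by rewrite lerDl rint_ge0// => x; have := fg x; lra.
Qed.

Lemma rint0 m : rint (fun _ : 'rV[R]_m => 0) = 0.
Proof.
have nb := @bsupp_box R m 0.
rewrite -[RHS](mul0r (rint (fun x : 'rV[R]_m => (vbox 0 x)%:R))) -rintZ//.
by apply: eq_rint => x; rewrite mul0r.
Qed.

Lemma bsupp0 m : bsupp (fun _ : 'rV[R]_m => 0).
Proof.
have := bsuppZ 0 (@bsupp_box R m 0).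
by under eq_fun do rewrite mul0r.
Qed.

Lemma rint_sum m (I : Type) (s : seq I) (F : I -> 'rV[R]_m -> R) :
  (forall i, bsupp (F i)) ->
  bsupp (fun x => \sum_(i <- s) F i x) /\
  rint (fun x => \sum_(i <- s) F i x) = \sum_(i <- s) rint (F i).
Proof.
move=> nF; elim: s => [|i s [IH1 IH2]].
  rewrite big_nil; under eq_fun do rewrite big_nil.
  by split; [exact: bsupp0|exact: rint0].
rewrite big_cons; under eq_fun do rewrite big_cons.
by split; [exact: bsuppD|rewrite rintD// IH2].
Qed.

Lemma bsupp_shift m (f : 'rV[R]_m -> R) a : bsupp f -> bsupp (fun x => f (a + x)).
Proof.
by move=> /(bsupp_aff a (unitmx1 _ _)); under eq_fun do rewrite mulmx1.
Qed.

                                                                             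
(** Translating [f] across the hyperplane gives N functions with disjoint supports, equal integrals
    and values at most [C], all inside one box that does not depend on N. Hence N times the integral
    is bounded for every N. *)
Lemma rint_hyperplane_ge0 m (f : 'rV[R]_m -> R) (c : 'cV[R]_m) d :
  bsupp f -> (forall x, 0 <= f x) -> c != 0 ->
  (forall x, f x != 0 -> (x *m c) 0 0 = d) -> rint f = 0.
Proof.
move=> nf f0 c0 fd; have [_ [C fC] [r fr]] := nf.
have [i ci] : exists i, c i 0 != 0.
  by have /cV0Pn := c0.
(* A transversal direction, scaled so that adding [w] raises the linear form by exactly 1. *)
pose w : 'rV[R]_m := (c i 0)^-1 *: delta_mx 0 i.
have wc : (w *m c) 0 0 = 1.
  by rewrite -scalemxAl mxE -rowE mxE mulVf.
have [rw Hw] := vbox_ex w.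
have C0 : 0 <= C by rewrite (le_trans _ (fC 0)).
pose r' := `|r| + `|rw|.
pose B := C * (2 * r') ^+ m.
have bnd N : N%:R * rint f <= B.
  pose F k x := f ((k%:R / N%:R) *: w + x).
  have nF k : bsupp (F k) by exact: bsupp_shift.
  have [nS IS] := rint_sum (iota 0 N) nF.
  have -> : N%:R * rint f = rint (fun x => \sum_(k <- iota 0 N) F k x).
    rewrite IS (eq_bigr (fun=> rint f)); last by move=> k _; exact: rint_shift.
    by rewrite big_const_seq count_predT size_iota iter_addr_0 mulr_natl.
  have nb : bsupp (fun x : 'rV[R]_m => C * (vbox r' x)%:R) by apply: bsuppZ; exact: bsupp_box.
  have -> : B = rint (fun x : 'rV[R]_m => C * (vbox r' x)%:R).
    by rewrite rintZ ?rint_box ?addr_ge0//; exact: bsupp_box.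
  apply: le_rint => // x.
  have [/hasP[k kN Fk]|] := boolP (has (fun k => F k x != 0) (iota 0 N)); last first.
    move=> /hasPn H; rewrite big1_seq ?mulr_ge0// => k /andP[_ /H].
    by rewrite negbK => /eqP.
  rewrite (bigD1_seq k) ?iota_uniq//= big1_seq ?addr0.
    apply: le_trans (ler_norm _) _; apply: le_trans (fC _) _.
    suff -> : vbox r' x by rewrite mulr1.
    have bk : vbox r (k%:R / N%:R *: w + x).
      by apply: contraNT Fk => H; apply/eqP; exact: fr.
    have bw : vbox `|rw| (- (k%:R / N%:R *: w)).
      rewrite vboxN; apply/forallP => j; rewrite mxE normrM.
      apply: (@le_trans _ _ (1 * `|w 0 j|)); last first.
        by rewrite mul1r (le_trans (forallP Hw j))// ler_norm.
      rewrite ler_wpM2r// ger0_norm ?divr_ge0//.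
      rewrite mem_iota add0n in kN.
      have /andP[_ kN'] := kN.
      by rewrite ler_pdivrMr ?mul1r ?ler_nat ?ltr0n ?(ltnW kN')// (leq_trans _ kN').
    have := vboxD bk bw; rewrite addrAC subrr add0r; apply: vbox_le.
    by rewrite lerD2r ler_norm.
  move=> j /andP[jk jN]; apply/eqP; apply: contraNT jk => Fj.
  have := fd _ Fj; have := fd _ Fk.
  have wl a : ((a *: w + x) *m c) 0 0 = a + (x *m c) 0 0.
    by rewrite mulmxDl -scalemxAl mxE (_ : (a *: (w *m c)) 0 0 = a) // mxE wc mulr1.
  rewrite !wl => <- /addIr.
  have N0 : N%:R != 0 :> R.
    by move: kN; rewrite mem_iota pnatr_eq0; case: (N).
  by move=> /(divIf N0) /eqP; rewrite eqr_nat.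
apply/eqP; rewrite eq_le rint_ge0// andbT leNgt; apply/negP => p.
have := bnd (Num.truncn (B / rint f)).+1; apply/negP; rewrite -ltNge.
by rewrite -ltr_pdivrMr// truncnS_gt.
Qed.

Definition hplane m (c : 'cV[R]_m * R) (x : 'rV[R]_m) : bool := (x *m c.1) 0 0 == c.2.

Lemma measurable_nonneg : measurable_fun setT (fun z : RR => (0 <= z :> R)%R%:R : R).
Proof.
rewrite (_ : (fun z => _) = \1_(`[0, +oo[%classic)); first exact: measurable_indic.
apply: funext => z; rewrite indicE; congr (nat_of_bool _)%:R.
apply/idP/idP => [H|/set_mem /=]; last by rewrite in_itv /= andbT.
by apply/mem_set; rewrite /= in_itv /= H.
Qed.

Lemma measurable_eq0 d (P : measurableType d) (f : P -> R) : measurable_fun setT f ->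
  measurable_fun setT (fun p => (f p == 0)%R%:R : R).
Proof.
move=> mf.
rewrite (_ : (fun p => _) = (fun p => (0 <= f p)%R%:R * (0 <= - f p)%R%:R)); last first.
  apply/funext => p; rewrite oppr_ge0 -natrM mulnb andbC -eq_le.
  by [].
apply: measurable_funM; first exact: (measurableT_comp measurable_nonneg mf).
apply: (measurableT_comp measurable_nonneg (_ : measurable_fun setT (fun p => - f p))).
exact: measurableT_comp.
Qed.

Lemma rmeas_hplane m (c : 'cV[R]_m * R) : rmeas (fun x => (hplane c x)%:R).
Proof.
rewrite /rmeas /hplane.
under eq_fun do rewrite -subr_eq0.
apply: measurable_eq0; apply: measurable_funB => //.
exact: (@measurable_mulmx _ _ _ _ _ id).
Qed.

Lemma bsuppM m (f g : 'rV[R]_m -> R) : rmeas g -> (exists C, forall x, `|g x| <= C) ->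
  bsupp f -> bsupp (fun x => f x * g x).
Proof.
move=> mg [D gD] [mf [C fC] [r fr]]; split.
- exact: measurable_funM.
- by exists (C * D) => x; rewrite normrM ler_pM.
- by exists r => x /fr ->; rewrite mul0r.
Qed.

Lemma rint_hyperplane m (f : 'rV[R]_m -> R) (c : 'cV[R]_m * R) :
  bsupp f -> c.1 != 0 -> (forall x, f x != 0 -> hplane c x) -> rint f = 0.
Proof.
move=> nf c0 H.
pose g1 x := Num.max (f x) 0; pose g2 x := Num.max (-1 * f x) 0.
have n1 : bsupp g1 by exact: bsupp_max0.
have n2 : bsupp g2 by apply/bsupp_max0/bsuppZ.
have E x : f x = g1 x + -1 * g2 x.
  by rewrite /g1 /g2; case: (leP (f x) 0); case: (leP (-1 * f x) 0) => *; lra.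
rewrite (eq_rint E) rintD//; last exact: bsuppZ.
rewrite rintZ//.
have S x : f x = 0 \/ (x *m c.1) 0 0 = c.2.
  by have [->|/H/eqP] := eqVneq (f x) 0; [left|right].
rewrite (@rint_hyperplane_ge0 _ g1 c.1 c.2)//; last 2 first.
- by move=> x; rewrite /g1 le_max lexx orbT.
- by move=> x; rewrite /g1; case: (S x) => [->|//]; rewrite maxxx eqxx.
rewrite (@rint_hyperplane_ge0 _ g2 c.1 c.2) ?mulr0 ?addr0//.
- by move=> x; rewrite /g2 le_max lexx orbT.
- by move=> x; rewrite /g2; case: (S x) => [->|//]; rewrite mulr0 maxxx eqxx.
Qed.

Lemma rint_hyperplanes m (f : 'rV[R]_m -> R) (L : seq ('cV[R]_m * R)) :
  bsupp f -> (forall c, c \in L -> c.1 != 0) ->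
  (forall x, f x != 0 -> has (fun c => hplane c x) L) -> rint f = 0.
Proof.
elim: L f => [|c L IH] f nf cL fL.
  rewrite (@eq_rint _ _ _ (fun=> 0)) ?rint0// => x.
  by have [//|/fL] := eqVneq (f x) 0.
have bh : exists C, forall x, `|(hplane c x)%:R : R| <= C.
  by exists 1 => x; case: hplane; rewrite ?normr1 ?normr0.
have n1 : bsupp (fun x => f x * (hplane c x)%:R).
  by apply: bsuppM => //; exact: rmeas_hplane.
have n2 : bsupp (fun x => f x + -1 * (f x * (hplane c x)%:R)).
  by apply: bsuppD => //; exact: bsuppZ.
rewrite (@eq_rint _ _ _ (fun x => f x * (hplane c x)%:R + (f x + -1 * (f x * (hplane c x)%:R)))).
  rewrite rintD// (rint_hyperplane n1 (cL c (mem_head _ _))); last first.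
    by move=> x; case: hplane; rewrite ?mulr0 ?eqxx.
  rewrite IH ?addr0// => [c' c'L|x]; first by rewrite cL// inE c'L orbT.
  have := fL x; rewrite /=; case: (hplane c x) => /=.
    by rewrite mulr1 mulN1r subrr eqxx.
  by rewrite !mulr0 addr0.
by move=> x; ring.
Qed.

End NullSets.

                                

(** * Affine independence, barycentric weights and affine parametrisations *)

Section Simplices.
Context (R : realType).
Local Notation RR := (measurableTypeR R).
Variable n : nat.
Notation point := 'rV[R]_n.
Implicit Types (s : seq point) (P Q x : point) (w : point -> R).

(** Affine independence with coefficients indexed by the points themselves, so that reordering a
    vertex list, as the bisection rule does, leaves them unchanged. *)
Definition afree s : Prop :=
  uniq s /\ forall w, \sum_(P <- s) w P = 0 -> \sum_(P <- s) w P *: P = 0 ->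
    forall P, P \in s -> w P = 0.

Definition weights s w x : Prop :=
  \sum_(P <- s) w P = 1 /\ x = \sum_(P <- s) w P *: P.

Lemma hullP s x : uniq s ->
  hull s x <-> exists w, (forall P, 0 <= w P) /\ weights s w x.
Proof.
move=> us; split.
  move=> [lam [l0 [l1 ->]]]; exists (fun P => lam (index P s)); split => //.
  split; rewrite (big_nth 0) big_mkord -?l1; apply: eq_bigr => i _;
    by rewrite index_uniq.
move=> [w [w0 [w1 ->]]]; exists (fun i => w (nth 0 s i)); split => //.
by split; rewrite -?w1 (big_nth 0) big_mkord.
Qed.

Lemma weights_uniq s w w' x : afree s -> weights s w x -> weights s w' x ->
  forall P, P \in s -> w P = w' P.
Proof.
move=> [_ fs] [w1 wx] [w1' wx'] P Ps; apply/eqP; rewrite -subr_eq0; apply/eqP.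
apply: (fs (fun P => w P - w' P)) => //.
  by rewrite sumrB w1 w1' subrr.
by under eq_bigr do rewrite scalerBl; rewrite sumrB -wx -wx' subrr.
Qed.

Lemma weights_perm s s' w x : perm_eq s s' -> weights s w x -> weights s' w x.
Proof. by move=> ps [w1 ->]; split; rewrite -?w1 (perm_big _ ps). Qed.

Lemma hull_perm s s' : uniq s -> perm_eq s s' -> hull s = hull s'.
Proof.
move=> us ps; have us' : uniq s' by rewrite -(perm_uniq ps).
have ps' : perm_eq s' s by rewrite perm_sym.
by apply/seteqP; split => x /hullP -/(_ _)[]// w [w0 wx]; apply/hullP => //; exists w; split => //;
  apply: weights_perm wx.
Qed.

Lemma afree_perm s s' : perm_eq s s' -> afree s -> afree s'.
Proof.
move=> ps [us fs]; split; first by rewrite -(perm_uniq ps).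
move=> w; rewrite -(perm_big _ ps) => w0; rewrite -(perm_big _ ps) => wP P.
by rewrite -(perm_mem ps); exact: fs.
Qed.

Lemma weights_sub s s' w x : uniq s -> uniq s' -> {subset s <= s'} ->
  weights s w x -> weights s' (fun P => if P \in s then w P else 0) x.
Proof.
move=> us us' ss [w1 ->].
have E (V : lmodType R) (F : point -> V) :
    \sum_(P <- s') (if P \in s then F P else 0) = \sum_(P <- s) F P.
  rewrite -big_mkcond -big_filter; apply: perm_big.
  apply: uniq_perm => //; first exact: filter_uniq.
  by move=> P; rewrite mem_filter andb_idr//; exact: ss.
split; first by rewrite -w1; exact: (E R^o).
rewrite -(E _ (fun P => w P *: P)); apply: eq_bigr => P _; by case: (P \in s); rewrite ?scale0r.
Qed.

Lemma hull_sub s s' : uniq s -> uniq s' -> {subset s <= s'} -> hull s `<=` hull s'.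
Proof.
move=> us us' ss x /hullP -/(_ us)[w [w0 wx]]; apply/hullP => //.
exists (fun P => if P \in s then w P else 0); split; last exact: weights_sub.
by move=> P; case: ifP.
Qed.

Lemma afree_sub s s' : uniq s -> {subset s <= s'} -> afree s' -> afree s.
Proof.
move=> us ss [us' fs]; split => // w w0 wx P Ps.
have E (V : lmodType R) (F : point -> V) :
    \sum_(P <- s') (if P \in s then F P else 0) = \sum_(P <- s) F P.
  rewrite -big_mkcond -big_filter; apply: perm_big.
  apply: uniq_perm => //; first exact: filter_uniq.
  by move=> Q; rewrite mem_filter andb_idr//; exact: ss.
have := fs (fun P => if P \in s then w P else 0).
rewrite (E R^o) => /(_ w0) H; have := H _ P (ss P Ps); rewrite Ps; apply.
rewrite -[RHS]wx -(E _ (fun P => w P *: P)); apply: eq_bigr => Q _; by case: (Q \in s); rewrite ?scale0r.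
Qed.

Lemma afree_rem s P : afree s -> afree (rem P s).
Proof. by move=> fs; have [us _] := fs; apply: afree_sub fs; [exact: rem_uniq|exact: mem_rem]. Qed.

Lemma mem_hull s P : uniq s -> P \in s -> hull s P.
Proof.
move=> us Ps; apply/hullP => //; exists (fun Q => (Q == P)%:R); split => //.
split; rewrite (bigD1_seq P)//= eqxx ?scale1r big1 ?addr0// => Q /negbTE ->//.
by rewrite scale0r.
Qed.

Lemma weights_mid s : s != [::] -> weights s (fun _ => (size s)%:R^-1) (mid s).
Proof.
move=> s0; have : (size s)%:R != 0 :> R by rewrite pnatr_eq0 size_eq0.
move=> n0; split; last by rewrite /mid scaler_sumr.
by rewrite big_const_seq count_predT iter_addr_0 -[LHS]mulr_natr mulVf.
Qed.

Lemma mid_hull s : uniq s -> s != [::] -> hull s (mid s).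
Proof.
move=> us s0; apply/hullP => //; exists (fun _ => (size s)%:R^-1).
by split; [move=> _; rewrite invr_ge0|exact: weights_mid].
Qed.

(** Barycentric coordinates in the ambient simplex [t] are unique: a coordinate that is positive for
    the face [s] cannot belong to a vertex missing from the face [s']. *)
Lemma pos_weights_sub (s s' t : seq point) w x : afree t -> uniq s -> uniq s' ->
  {subset s <= t} -> {subset s' <= t} ->
  weights s w x -> (forall P, P \in s -> 0 < w P) -> hull s' x ->
  {subset s <= s'}.
Proof.
move=> ft us us' st s't wx wp /hullP -/(_ us')[w' [_ wx']] P Ps.
have [ut _] := ft.
have := weights_uniq ft (weights_sub us ut st wx) (weights_sub us' ut s't wx') (st P Ps).
rewrite Ps; case: ifP => // _ E; have := wp P Ps; by rewrite E ltxx.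
Qed.

Lemma afree_nondegenerate s : size s = n.+1 -> Defs.nondegenerate s -> afree s.
Proof.
move=> sz; rewrite /Defs.nondegenerate; set D := (\matrix_(i, j) _) => d0.
have uD : D \in unitmx by rewrite unitmxE unitfE.
have key (u : nat -> R) : \sum_(i < n.+1) u i = 0 ->
    \sum_(i < n.+1) u i *: nth 0 s i = 0 -> forall i, (i < n.+1)%N -> u i = 0.
  move=> u0 us.
  have E : (\row_(i < n) u i.+1) *m D = 0.
    apply/rowP => j; rewrite mxE [RHS]mxE.
    have : (\sum_(i < n.+1) u i *: nth 0 s i - (\sum_(i < n.+1) u i) *: nth 0 s 0) 0 j = 0.
      by rewrite us u0 scale0r subr0 mxE.
    rewrite scaler_suml -sumrB summxE big_ord_recl /= subrr mxE add0r => E0.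
    rewrite -[RHS]E0; by apply: eq_bigr => i _; rewrite !mxE /bump /= add1n mulrBr.
  have : (\row_(i < n) u i.+1) = 0 by rewrite -(mulmxK uD (\row_(i < n) u i.+1)) E mul0mx.
  move=> /rowP H.
  have H1 : forall i : 'I_n, u i.+1 = 0 by move=> i; have := H i; rewrite !mxE.
  move=> [|i] ilt; last exact: (H1 (Ordinal (ilt : (i < n)%N))).
  by move: u0; rewrite big_ord_recl big1 ?addr0// => i _; rewrite lift0.
have us : uniq s.
  apply/(uniqP 0) => i j; rewrite !inE sz => il jl E; apply/eqP/negPn/negP => ij.
  (* If the vertices at [i] and [j] coincided, these coefficients would form a nontrivial affine
     relation. *)
  pose u k : R := (k == i)%:R - (k == j)%:R.
  have S (V : lmodType R) (F : nat -> V) k : (k < n.+1)%N ->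
      \sum_(l < n.+1) (l == k :> nat)%:R *: F l = F k.
    move=> kl; rewrite (bigD1 (Ordinal kl))//= eqxx scale1r big1 ?addr0// => l.
    by rewrite -val_eqE /= => /negbTE ->; rewrite scale0r.
  have := key u _ _ i il; rewrite /u eqxx (negbTE ij) subr0 => H.
  have : (1 : R) = 0.
    apply: H.
      rewrite sumrB (_ : \sum_(l < n.+1) _ = 1); last first.
        rewrite -[RHS](S R^o (fun=> 1) i il); apply: eq_bigr => l _; exact/esym/mulr1.
      apply/eqP; rewrite subr_eq0 eq_sym; apply/eqP.
      by rewrite -[RHS](S R^o (fun=> 1) j jl); apply: eq_bigr => l _; exact/esym/mulr1.
    under eq_bigr do rewrite scalerBl; rewrite sumrB S// S// E subrr//.
  by move/eqP; rewrite oner_eq0.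
split => // w w0 wP P Ps.
have := key (fun i => w (nth 0 s i)) _ _ (index P s).
rewrite -sz index_mem nth_index//; apply => //.
  by rewrite -[RHS]w0 (big_nth 0) big_mkord.
by rewrite -[RHS]wP (big_nth 0) big_mkord.
Qed.

Section Par.
Variable m : nat.
Definition lin s : 'M[R]_(m, n) := \matrix_(i < m) (nth 0 s i.+1 - nth 0 s 0).
Definition par s (t : 'rV[R]_m) : point := nth 0 s 0 + t *m lin s.
Definition corner (t : 'rV[R]_m) : bool :=
  [forall i, 0 <= t 0 i] && (\sum_i t 0 i <= 1).
(** The barycentric coordinate of [par s t] at the vertex [P]; see [par_weights]. *)
Definition pw s (t : 'rV[R]_m) P : R :=
  if index P s is j.+1 then
    if insub j : option 'I_m is Some i then t 0 i else 0
  else 1 - \sum_i t 0 i.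

Lemma pwS s t (i : 'I_m) : uniq s -> size s = m.+1 -> pw s t (nth 0 s i.+1) = t 0 i.
Proof. by move=> us sz; rewrite /pw index_uniq ?sz ?ltnS// valK. Qed.

Lemma pw0 s t : uniq s -> size s = m.+1 -> pw s t (nth 0 s 0) = 1 - \sum_i t 0 i.
Proof. by move=> us sz; rewrite /pw index_uniq ?sz. Qed.

Lemma sum_simplex (V : zmodType) s (F : point -> V) : size s = m.+1 ->
  \sum_(P <- s) F P = F (nth 0 s 0) + \sum_(i < m) F (nth 0 s i.+1).
Proof. by move=> sz; rewrite (big_nth 0) big_mkord sz big_ord_recl. Qed.

Lemma par_weights s t : uniq s -> size s = m.+1 -> weights s (pw s t) (par s t).
Proof.
move=> us sz; split; rewrite sum_simplex// pw0//.
  rewrite [X in _ + X](eq_bigr (fun i => t 0 i)) ?subrK// => i _; by rewrite pwS.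
rewrite /par mulmx_sum_row scalerBl scale1r -addrA; congr (_ + _).
rewrite scaler_suml -sumrN -big_split; apply: eq_bigr => i _ /=.
by rewrite pwS// rowK scalerBr addrC.
Qed.

Lemma weights_par s w x : uniq s -> size s = m.+1 -> weights s w x ->
  x = par s (\row_i w (nth 0 s i.+1)).
Proof.
move=> us sz [w1 ->]; rewrite sum_simplex// /par mulmx_sum_row.
have -> : w (nth 0 s 0) = 1 - \sum_(i < m) w (nth 0 s i.+1).
  by rewrite -w1 sum_simplex// addrK.
rewrite scalerBl scale1r -addrA; congr (_ + _).
rewrite scaler_suml -sumrN -big_split; apply: eq_bigr => i _ /=.
by rewrite !mxE rowK scalerBr addrC.
Qed.

Lemma pw_ge0 s t : uniq s -> size s = m.+1 ->
  corner t <-> (forall P, P \in s -> 0 <= pw s t P).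
Proof.
move=> us sz; split.
  move=> /andP[/forallP t0 t1] P Ps; rewrite /pw.
  case: (index P s) => [|j]; first by rewrite subr_ge0.
  by case: insub.
move=> H; apply/andP; split; last first.
  by rewrite -subr_ge0 -(@pw0 s)// H// mem_nth// sz.
by apply/forallP => i; rewrite -(@pwS s)// H// mem_nth// sz ltnS.
Qed.

Lemma hull_par s t : afree s -> size s = m.+1 -> hull s (par s t) <-> corner t.
Proof.
move=> fs sz; have [us _] := fs; rewrite (@pw_ge0 s)//; split.
  move=> /hullP -/(_ us)[w [w0 wx]] P Ps.
  by rewrite (weights_uniq fs (par_weights t us sz) wx).
move=> H; apply/hullP => //; exists (fun P => if P \in s then pw s t P else 0).
split; first by move=> P; case: ifP => // /H.
apply: weights_sub => //; exact: par_weights.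
Qed.

Lemma row_free_lin s : afree s -> size s = m.+1 -> row_free (lin s).
Proof.
move=> fs sz; have [us _] := fs; apply: inj_row_free => t t0.
have E1 := par_weights t us sz; have E0 := par_weights 0 us sz.
have pE : par s t = par s 0 by rewrite /par t0 mul0mx.
rewrite pE in E1; apply/rowP => i.
have := weights_uniq fs E1 E0 (P := nth 0 s i.+1).
by rewrite !pwS//; apply; rewrite mem_nth// sz ltnS.
Qed.

Lemma bsupp_par s (f : point -> R) : afree s -> size s = m.+1 -> bsupp f ->
  bsupp (fun t => f (par s t)).
Proof.
move=> fs sz [mf [C fC] [r fr]]; split; [exact: rmeas_aff|by exists C|].
have [ra Ha] := vbox_ex (- nth 0 s 0).
have [r' Hr'] := vbox_mulmx (pinvmx (lin s)) (r + ra).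
exists r' => t tr; apply: fr; apply: contra tr => tr.
have := Hr' _ (vboxD tr Ha).
by rewrite /par addrAC subrr add0r -mulmxA mulmxVp ?mulmx1//; exact: row_free_lin.
Qed.

(** As the vertices of [s'] lie in the affine span of [s], the map [par s'] is [par s] after an
    affine substitution of the parameter. Its matrix [A] is invertible because both simplices have
    dimension [m]. *)
Lemma rint_par s s' : afree s -> afree s' -> size s = m.+1 -> size s' = m.+1 ->
  (forall P, P \in s' -> exists w, weights s w P) ->
  exists2 c, 0 < c & forall f : point -> R, bsupp f ->
    rint (fun t => f (par s' t)) = c * rint (fun t => f (par s t)).
Proof.
move=> fs fs' sz sz' H; have [us _] := fs; have [us' _] := fs'.
have X (i : 'I_m.+1) : {t | nth 0 s' i = par s t}.
  apply: cid; have [|w wx] := H (nth 0 s' i); first by rewrite mem_nth// sz'.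
  by exists (\row_i w (nth 0 s i.+1)); exact: weights_par.
pose x i := sval (X i).
have xE i : nth 0 s' (i : 'I_m.+1) = par s (x i) by rewrite /x; case: (X i).
pose A : 'M[R]_m := \matrix_(i < m) (x (lift ord0 i) - x ord0).
have AE : A *m lin s = lin s'.
  apply/row_matrixP => i; rewrite row_mul !rowK mulmxBl.
  rewrite -(lift0 i) xE -[nth 0 s' 0]/(nth 0 s' (@ord0 m)) xE /par.
  by rewrite opprD addrACA subrr add0r.
have uA : A \in unitmx.
  rewrite -row_free_unit /row_free.
  have := row_free_lin fs' sz'; rewrite -AE /row_free => /eqP rk.
  by rewrite eqn_leq rank_leq_row -{1}rk mxrankM_maxl.
have [c c0 Hc] := rint_aff uA; exists c => // f nf.
rewrite -(Hc _ (x ord0) (bsupp_par fs sz nf)).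
apply: eq_rint => t; congr f; rewrite /par mulmxDl -mulmxA AE addrA.
by congr (_ + _); rewrite -[RHS]/(par s (x ord0)) -xE.
Qed.

End Par.
End Simplices.

                                 

(** * Locally bounded functions and the reference simplex *)

Section LocallyBounded.
Context (R : realType).
Local Notation RR := (measurableTypeR R).

(** A class that contains the affine functions and is closed under products; cutting off by a
    simplex leads into [bsupp]. *)
Definition locbdd k (f : 'rV[R]_k -> R) : Prop :=
  rmeas f /\ forall r, exists C, forall x, vbox r x -> `|f x| <= C.

Lemma locbddD k (f g : 'rV[R]_k -> R) : locbdd f -> locbdd g -> locbdd (fun x => f x + g x).
Proof.
move=> [mf bf] [mg bg]; split; first exact: measurable_funD.
move=> r; have [C HC] := bf r; have [D HD] := bg r; exists (C + D) => x xr.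
by rewrite (le_trans (ler_normD _ _))// lerD ?HC ?HD.
Qed.

Lemma locbddM k (f g : 'rV[R]_k -> R) : locbdd f -> locbdd g -> locbdd (fun x => f x * g x).
Proof.
move=> [mf bf] [mg bg]; split; first exact: measurable_funM.
move=> r; have [C HC] := bf r; have [D HD] := bg r; exists (C * D) => x xr.
by rewrite normrM ler_pM ?HC ?HD.
Qed.

Lemma locbdd_cst k c : locbdd (fun _ : 'rV[R]_k => c).
Proof. by split; [exact: measurable_cst|move=> r; exists `|c|]. Qed.

Lemma locbddZ k (f : 'rV[R]_k -> R) c : locbdd f -> locbdd (fun x => c * f x).
Proof. by move=> nf; apply: locbddM => //; exact: locbdd_cst. Qed.

Lemma locbdd_sum k (I : Type) (s : seq I) (F : I -> 'rV[R]_k -> R) :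
  (forall i, locbdd (F i)) -> locbdd (fun x => \sum_(i <- s) F i x).
Proof.
move=> nF; elim: s => [|i s IH].
  by under eq_fun do rewrite big_nil; exact: locbdd_cst.
by under eq_fun do rewrite big_cons; exact: locbddD.
Qed.

Lemma locbdd_coord k i : locbdd (fun x : 'rV[R]_k => x 0 i).
Proof.
split; first exact: (@measurable_row _ _ _ _ id).
by move=> r; exists r => x /forallP.
Qed.

Lemma locbdd_comp k l (f : 'rV[R]_l -> R) a (A : 'M[R]_(k, l)) :
  locbdd f -> locbdd (fun x => f (a + x *m A)).
Proof.
move=> [mf bf]; split; first exact: rmeas_aff.
move=> r; have [r' Hr'] := vbox_mulmx A r; have [ra Ha] := vbox_ex a.
have [C HC] := bf (ra + r'); exists C => x xr.
by rewrite HC// vboxD// Hr'.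
Qed.

Lemma locbdd_aff n (gc : 'rV[R]_n * R) : locbdd (aff gc).
Proof.
apply: locbddD; last exact: locbdd_cst.
by apply: locbdd_sum => i; apply: locbddM; [exact: locbdd_coord|exact: locbdd_cst].
Qed.

Lemma locbdd_if k (b : 'rV[R]_k -> bool) (f g : 'rV[R]_k -> R) :
  rmeas (fun x => (b x)%:R) -> locbdd f -> locbdd g ->
  locbdd (fun x => if b x then f x else g x).
Proof.
move=> mb nf ng.
have nb : locbdd (fun x => (b x)%:R).
  split => // r; exists 1 => x _; by case: (b x); rewrite ?normr1 ?normr0.
rewrite (_ : (fun x => _) = (fun x => (b x)%:R * f x + (1 + -1 * (b x)%:R) * g x)).
  apply: locbddD; apply: locbddM => //.
  by apply: locbddD; [exact: locbdd_cst|exact: locbddZ].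
by apply/funext => x; case: (b x) => /=; ring.
Qed.

Lemma rmeas_nonneg k (f : 'rV[R]_k -> R) : rmeas f -> rmeas (fun x => (0 <= f x)%R%:R).
Proof. by move=> mf; exact: (measurableT_comp (@measurable_nonneg R) mf). Qed.

Lemma rmeas_and k (b c : 'rV[R]_k -> bool) : rmeas (fun x => (b x)%:R) ->
  rmeas (fun x => (c x)%:R) -> rmeas (fun x => (b x && c x)%:R).
Proof.
move=> mb mc; rewrite /rmeas; under eq_fun do rewrite -mulnb natrM.
exact: measurable_funM.
Qed.

Lemma rmeas_forall k (I : finType) (b : I -> 'rV[R]_k -> bool) :
  (forall i, rmeas (fun x => (b i x)%:R)) -> rmeas (fun x => [forall i, b i x]%:R).
Proof.
move=> mb; rewrite /rmeas.
rewrite (_ : (fun t => _) = (fun t : k.-tuple RR => \prod_(i : I) (b i (row_t t))%:R)).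
  by apply: measurable_prod => i _; exact: mb.
apply/funext => t; have [/forallP H|/forallPn[i H]] := boolP [forall i, b i (row_t t)].
  by rewrite big1// => i _; rewrite H.
by rewrite (bigD1 i)//= (negbTE H) mul0r.
Qed.

Lemma rmeas_corner m : rmeas (fun t : 'rV[R]_m => (corner t)%:R).
Proof.
apply: rmeas_and.
  by apply: rmeas_forall => i; have [mi _] := @locbdd_coord m i; exact: (rmeas_nonneg mi).
rewrite /rmeas; under eq_fun do rewrite -subr_ge0.
apply: (@rmeas_nonneg _ (fun x => 1 - \sum_i x 0 i)).
apply: measurable_funB => //.
by have [] := locbdd_sum (index_enum 'I_m) (@locbdd_coord m).
Qed.

Lemma corner_vbox m (t : 'rV[R]_m) : corner t -> vbox 1 t.
Proof.
move=> /andP[/forallP t0 t1]; apply/forallP => i.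
rewrite ger0_norm// (le_trans _ t1)// (bigD1 i)//= lerDl sumr_ge0//.
Qed.

Lemma bsupp_corner m (f : 'rV[R]_m -> R) : locbdd f -> bsupp (fun t => (corner t)%:R * f t).
Proof.
move=> [mf bf]; split.
- by apply: measurable_funM => //; exact: rmeas_corner.
- have [C HC] := bf 1; exists `|C| => t; case ct : (corner t).
    by rewrite mul1r (le_trans (HC _ (corner_vbox ct)))// ler_norm.
  by rewrite mul0r normr0.
- exists 1 => t H; case ct : (corner t); last by rewrite mul0r.
  by rewrite (corner_vbox ct) in H.
Qed.

(** The volume of the reference simplex, which normalises all means below. *)
Definition Vol m : R := rint (fun t : 'rV[R]_m => (corner t)%:R).

Lemma bsupp_corner1 m : bsupp (fun t : 'rV[R]_m => (corner t)%:R : R).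
Proof.
have := bsupp_corner (@locbdd_cst m 1).
by under eq_fun do rewrite mulr1.
Qed.

Lemma Vol_gt0 m : 0 < Vol m.
Proof.
(* The cube with side [2 * r] at the origin lies in the corner, since its coordinates sum to at most
   m / (m + 1). *)
pose r : R := (2 * m.+1%:R)^-1.
have r0 : 0 < r by rewrite invr_gt0 mulr_gt0.
rewrite /Vol -(@rint_shift _ _ _ (const_mx r) (bsupp_corner1 m)).
apply: (@lt_le_trans _ _ (rint (fun t : 'rV[R]_m => (vbox r t)%:R))).
  by rewrite rint_box ?ltW// exprn_gt0// mulr_gt0.
apply: le_rint; [exact: bsupp_box|exact: (bsupp_shift (const_mx r) (@bsupp_corner1 m))|] => t.
case vt : (vbox r t) => //; rewrite ler_nat lt0b.
have /forallP H := vt.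
have H1 i : - r <= t 0 i <= r by rewrite -ler_norml.
apply/andP; split.
  by apply/forallP => i; rewrite !mxE; have := H1 i; lra.
apply: (@le_trans _ _ (\sum_(i < m) (2 * r))).
  by apply: ler_sum => i _; rewrite !mxE; have := H1 i; lra.
rewrite sumr_const card_ord (_ : 2 * r = m.+1%:R^-1); last first.
  by rewrite /r invfM mulrA mulfV ?mul1r.
by rewrite -[leLHS]mulr_natl ler_pdivrMr// mul1r ler_nat.
Qed.

End LocallyBounded.

(** * Normalised integrals over simplices of any dimension *)

Section Simplex.
Context (R : realType).
Variable n : nat.
Notation point := 'rV[R]_n.
Implicit Types (s : seq point) (P Q x : point) (phi : point -> R).

Definition ind (A : set point) x : R := (`[<A x>])%:R.

Lemma hull_vbox s : uniq s -> exists r, forall x, hull s x -> vbox r x.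
Proof.
move=> us; exists (\sum_(P <- s) \sum_i `|P 0 i|) => x /hullP -/(_ us)[w [w0 [w1 ->]]].
have wle P : P \in s -> w P <= 1.
  by move=> Ps; rewrite -w1 (bigD1_seq P)//= lerDl sumr_ge0.
apply/forallP => i; rewrite summxE (le_trans (ler_norm_sum _ _ _))//.
rewrite !big_seq; apply: ler_sum => P Ps; rewrite mxE normrM ger0_norm//.
apply: (@le_trans _ _ (1 * `|P 0 i|)); first by rewrite ler_wpM2r// wle.
by rewrite mul1r (bigD1 i)//= lerDl sumr_ge0.
Qed.

Section OneDim.
Variable m : nat.

(** A pseudo-inverse yields a candidate parameter [tau x] for every point. Membership then means
    that [tau x] lies in the corner and gives back [x], which are finitely many measurable
    conditions, also when m < n. *)
Lemma rmeas_hull s : afree s -> size s = m.+1 -> rmeas (ind (hull s)).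
Proof.
move=> fs sz; have [us _] := fs.
pose p0 := nth 0 s 0; pose B : 'M[R]_(n, m) := pinvmx (lin m s).
pose tau x : 'rV_m := (- p0 *m B) + x *m B.
have BK t : tau (par s t) = t.
  by rewrite /tau /par -mulmxDl addrA addNr add0r -mulmxA mulmxVp ?mulmx1//; exact: row_free_lin.
have mtau (f : 'rV_m -> R) : rmeas f -> rmeas (fun x => f (tau x)) by move=> mf; exact: rmeas_aff.
rewrite (_ : ind _ = fun x => ([forall j, (x - par s (tau x)) 0 j == 0] && corner (tau x))%:R).
  apply: rmeas_and; last exact: (mtau _ (@rmeas_corner R m)).
  apply: rmeas_forall => j; apply: measurable_eq0.
  have H : rmeas (fun x => x 0 j - par s (tau x) 0 j).
    apply: measurable_funB; first by have [] := @locbdd_coord R n j.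
    apply: (mtau (fun t => par s t 0 j)).
    by have [] := locbdd_comp (nth 0 s 0) (lin m s) (@locbdd_coord R n j).
  have subE (x y : point) : x 0 j - y 0 j = (x - y) 0 j by rewrite !mxE.
  by apply: eq_measurable_fun H => t _; exact: subE.
apply/funext => x; congr (nat_of_bool _)%:R; apply/asboolP/andP.
  move=> hx; have /hullP -/(_ us)[w [_ wx]] := hx.
  have E := weights_par us sz wx.
  rewrite {1 2 3}E BK; split; last by apply/(hull_par _ fs sz); rewrite -E.
  by apply/forallP => j; rewrite subrr mxE.
move=> [/forallP H c].
have -> : x = par s (tau x).
  by apply/rowP => j; have := H j; rewrite !mxE subr_eq0 => /eqP.
exact/(hull_par _ fs sz).
Qed.

Lemma bsupp_hull s phi : afree s -> size s = m.+1 -> locbdd phi ->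
  bsupp (fun x => ind (hull s) x * phi x).
Proof.
move=> fs sz [mf bf]; have [us _] := fs; have [r Hr] := hull_vbox us; split.
- by apply: measurable_funM => //; exact: rmeas_hull.
- have [C HC] := bf r; exists `|C| => x; rewrite /ind; case: asboolP => hx.
    by rewrite mul1r (le_trans (HC _ (Hr _ hx)))// ler_norm.
  by rewrite mul0r normr0.
- exists r => x H; rewrite /ind; case: asboolP => hx; last by rewrite mul0r.
  by rewrite (Hr _ hx) in H.
Qed.

                                                                            
                                                                               
                                               
(** The pulled-back integral without Jacobian or Gram factor, that is, [Vol R m] times the mean of
    [phi] over the simplex. It treats simplices and their sides alike. *)
Definition bint s phi : R := rint (fun t : 'rV[R]_m => (corner t)%:R * phi (par s t)).

Lemma bint_hull s phi : afree s -> size s = m.+1 ->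
  bint s phi = rint (fun t : 'rV[R]_m => ind (hull s) (par s t) * phi (par s t)).
Proof.
move=> fs sz; apply: eq_rint => t; congr ((nat_of_bool _)%:R * _).
by apply/idP/asboolP => /(hull_par _ fs sz).
Qed.

Lemma bsupp_bint s phi : locbdd phi -> bsupp (fun t : 'rV[R]_m => (corner t)%:R * phi (par s t)).
Proof. by move=> nphi; apply: bsupp_corner; exact: locbdd_comp. Qed.

Lemma bintD s phi psi : locbdd phi -> locbdd psi ->
  bint s (fun x => phi x + psi x) = bint s phi + bint s psi.
Proof.
by move=> n1 n2; rewrite /bint -rintD; [apply: eq_rint => t; rewrite mulrDr|exact: bsupp_bint..].
Qed.

Lemma bintZ s phi c : locbdd phi -> bint s (fun x => c * phi x) = c * bint s phi.
Proof.
by move=> n1; rewrite /bint -rintZ; [apply: eq_rint => t; rewrite mulrCA|exact: bsupp_bint].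
Qed.

Lemma bint_cst s c : bint s (fun _ => c) = c * Vol R m.
Proof.
rewrite /Vol -rintZ; last exact: bsupp_corner1.
by apply: eq_rint => t; rewrite mulrC.
Qed.

Lemma eq_bint s phi psi : afree s -> size s = m.+1 -> (forall x, hull s x -> phi x = psi x) ->
  bint s phi = bint s psi.
Proof.
move=> fs sz E; apply: eq_rint => t; case ct : (corner t); rewrite ?mul0r// !mul1r.
by apply: E; apply/(hull_par _ fs sz).
Qed.

(** A reordering changes the integral by some constant factor, and the constant function 1 shows
    that this factor is 1. *)
Lemma bint_perm s s' phi : afree s -> size s = m.+1 -> perm_eq s s' -> locbdd phi ->
  bint s phi = bint s' phi.
Proof.
move=> fs sz ps nphi; have fs' := afree_perm ps fs; have [us _] := fs.
have sz' : size s' = m.+1 by rewrite -(perm_size ps).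
have [c c0 Hc] : exists2 c, 0 < c & forall f : point -> R, bsupp f ->
    rint (fun t : 'rV_m => f (par s' t)) = c * rint (fun t : 'rV_m => f (par s t)).
  apply: rint_par => // P; rewrite -(perm_mem ps) => Ps.
  by have /hullP -/(_ us)[w [_ wx]] := mem_hull us Ps; exists w.
have E f : locbdd f -> bint s' f = c * bint s f.
  move=> nf; rewrite !bint_hull// -(Hc (fun x => ind (hull s) x * f x)); last exact: bsupp_hull.
  by apply: eq_rint => t; rewrite (hull_perm us ps).
suff cE : c = 1 by rewrite E// cE mul1r.
have := E _ (@locbdd_cst R n 1); rewrite !bint_cst !mul1r => H.
by apply: (mulIf (lt0r_neq0 (Vol_gt0 R m))); rewrite -H mul1r.
Qed.

(** The boundary of the reference simplex lies in m + 1 hyperplanes, collected in [L], and is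
    therefore null. *)
Lemma bint_interior s phi psi : uniq s -> size s = m.+1 -> locbdd phi -> locbdd psi ->
  (forall x w, weights s w x -> (forall P, P \in s -> 0 < w P) -> phi x = psi x) ->
  bint s phi = bint s psi.
Proof.
move=> us sz n1 n2 E.
have nN : locbdd (fun x => -1 * psi x) by exact: locbddZ.
suff : bint s (fun x => phi x + -1 * psi x) = 0.
  by rewrite bintD// bintZ// mulN1r => /eqP; rewrite subr_eq0 => /eqP.
pose L : seq ('cV[R]_m * R) := (const_mx 1, 1) :: [seq (delta_mx i 0, 0) | i <- enum 'I_m].
(* A simplex of dimension 0 is one point of weight 1, which already counts as interior. *)
have [m0|m0] := posnP m.
  have z (t : 'rV[R]_m) i : t 0 i = 0 by have := ltn_ord i; rewrite [X in (_ < X)%N]m0.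
  rewrite -(rint0 R m); apply: eq_rint => t; rewrite (E _ (pw s t)) ?mulN1r ?subrr ?mulr0//.
    exact: par_weights.
  move=> P Ps; rewrite /pw.
  have : (index P s < m.+1)%N by rewrite -sz index_mem.
  rewrite [X in (_ < X.+1)%N]m0; case: (index P s) => // _.
  by rewrite big1 ?subr0// => i _; exact: z.
apply: (@rint_hyperplanes _ _ _ L).
- exact: (bsupp_bint s (locbddD n1 nN)).
- move=> c; rewrite inE => /orP[/eqP ->|/mapP[i _ ->]] /=.
    apply/eqP => /matrixP /(_ (Ordinal m0) 0) /eqP; rewrite !mxE oner_eq0//.
  by apply/eqP => /matrixP /(_ i 0) /eqP; rewrite !mxE !eqxx oner_eq0.
- move=> t; apply: contraNT => H; case ct : (corner t); last by rewrite mul0r.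
  rewrite mul1r (E _ (pw s t)) ?mulN1r ?subrr//; first exact: par_weights.
  move: H; rewrite /= negb_or => /andP[H0 /hasPn H1] P Ps.
  have := (pw_ge0 t us sz).1 ct P Ps; rewrite le_eqVlt => /predU1P[|//].
  rewrite -{1}(nth_index 0 Ps); have : (index P s < m.+1)%N by rewrite -sz index_mem.
  case: (index P s) => [_|j jm].
    rewrite pw0// => /eqP; rewrite eq_sym subr_eq0 => /eqP e; move: H0.
    rewrite /hplane /= mxE; under eq_bigr do rewrite mxE mulr1.
    by rewrite -e eqxx.
  rewrite (pwS _ (Ordinal (jm : (j < m)%N)))// => e.
  have /H1 : (delta_mx (Ordinal (jm : (j < m)%N)) 0, 0 : R) \in
      [seq (delta_mx i 0 : 'cV[R]_m, 0 : R) | i <- enum 'I_m].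
    by apply/mapP; exists (Ordinal (jm : (j < m)%N)); rewrite ?mem_enum.
  by rewrite /hplane /= -colE mxE -e eqxx.
Qed.

End OneDim.
End Simplex.

(** * Barycentric coordinates under bisection *)

Section Bisection.
Context (R : realType).
Variable n : nat.
Notation point := 'rV[R]_n.
Implicit Types (s r : seq point) (P Q x a b : point) (w phi : point -> R).

Definition midpt a b : point := 2^-1 *: (a + b).

Lemma midptC a b : midpt a b = midpt b a. Proof. by rewrite /midpt addrC. Qed.

(** Passage from coordinates in the child (a, c, ...) to coordinates in the parent (a, b, ...): the
    weight of the midpoint [c] is shared equally by [a] and [b]. *)
Definition bisw a b (c : point) w : point -> R := fun P =>
  if P == a then w a + w c / 2 else if P == b then w c / 2 else w P.

Lemma sum_bisw (V : lmodType R) a b r w (F : point -> V) : uniq (a :: b :: r) ->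
  \sum_(P <- a :: b :: r) bisw a b (midpt a b) w P *: F P =
  w a *: F a + w (midpt a b) *: (2^-1 *: (F a + F b)) + \sum_(P <- r) w P *: F P.
Proof.
rewrite /= inE negb_or => /and3P[/andP[ab ar] br ur].
rewrite !big_cons /bisw eqxx eq_sym (negbTE ab) eqxx.
rewrite scalerDl scalerA scalerDr !addrA; congr (_ + _).
apply: eq_big_seq => P Pr; case: eqP => [E|_]; first by rewrite -E Pr in ar.
by case: eqP => [E|//]; rewrite -E Pr in br.
Qed.

Lemma sum_bisw1 a b r w : uniq (a :: b :: r) ->
  \sum_(P <- a :: b :: r) bisw a b (midpt a b) w P = w a + w (midpt a b) + \sum_(P <- r) w P.
Proof.
rewrite /= inE negb_or => /and3P[/andP[ab ar] br ur].
rewrite !big_cons /bisw eqxx eq_sym (negbTE ab) eqxx addrA.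
congr (_ + _); first by field.
apply: eq_big_seq => P Pr; case: eqP => [E|_]; first by rewrite -E Pr in ar.
by case: eqP => [E|//]; rewrite -E Pr in br.
Qed.

Lemma bisw_weights a b r w x : uniq (a :: b :: r) ->
  weights (a :: midpt a b :: r) w x -> weights (a :: b :: r) (bisw a b (midpt a b) w) x.
Proof.
move=> us [w1 wx]; split; last first.
  by rewrite wx sum_bisw// !big_cons addrA /midpt.
by rewrite sum_bisw1// -w1 !big_cons addrA.
Qed.

Lemma weights_midpt a b r : uniq (a :: b :: r) ->
  weights (a :: b :: r) (fun P => ((P == a)%:R + (P == b)%:R) / 2) (midpt a b).
Proof.
rewrite /= inE negb_or => /and3P[/andP[ab ar] br ur].
have ba : b == a = false by rewrite eq_sym (negbTE ab).
have E P : P \in r -> ((P == a)%:R + (P == b)%:R) / 2 = 0 :> R.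
  move=> Pr; have -> : P == a = false by apply/negbTE/eqP => e; rewrite -e Pr in ar.
  have -> : P == b = false by apply/negbTE/eqP => e; rewrite -e Pr in br.
  by rewrite addr0 mul0r.
split; rewrite !big_cons !eqxx (negbTE ab) ba.
  rewrite big1_seq ?addr0; first by rewrite add0r mul1r; field.
  by move=> P /= /E.
rewrite big1_seq ?addr0; first by rewrite add0r mul1r /midpt scalerDr.
by move=> P /= /E ->; rewrite scale0r.
Qed.

Lemma midpt_notin a b r : afree (a :: b :: r) -> midpt a b \notin a :: b :: r.
Proof.
move=> fs; have [us _] := fs; apply/negP => cs.
have := weights_midpt us => wm.
have wd : weights (a :: b :: r) (fun P => (P == midpt a b)%:R) (midpt a b).
  split; rewrite (bigD1_seq _ cs us)//= eqxx ?scale1r big1 ?addr0// => P /negbTE ->//.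
  by rewrite scale0r.
have ab : a != b by move: us; rewrite /= inE negb_or => /and3P[/andP[]].
have Ha := weights_uniq fs wm wd (P := a) (mem_head _ _).
have Hb := weights_uniq fs wm wd (P := b).
move: Ha; rewrite eqxx (negbTE ab) addr0; case: eqP => _ /=; lra.
Qed.

Lemma afree_bis1 a b r : afree (a :: b :: r) -> afree (a :: midpt a b :: r).
Proof.
move=> fs; have := midpt_notin fs; have [us fw] := fs.
rewrite !inE !negb_or => /and3P[ca cb cr].
move: (us); rewrite /= inE negb_or => /and3P[/andP[ab ar] br ur].
split; first by rewrite /= inE negb_or eq_sym ca ar cr ur.
move=> w w0 wx.
have H : forall P, P \in a :: b :: r -> bisw a b (midpt a b) w P = 0.
  apply: fw.
    by rewrite sum_bisw1// -[RHS]w0 !big_cons addrA.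
  by rewrite sum_bisw// -[RHS]wx !big_cons addrA /midpt.
have Hb : w (midpt a b) = 0.
  have := H b; rewrite /bisw eq_sym (negbTE ab) eqxx !inE eqxx orbT => /(_ isT).
  lra.
have Ha : w a = 0.
  have := H a; rewrite /bisw eqxx !inE eqxx Hb => /(_ isT).
  lra.
move=> P; rewrite !inE => /or3P[/eqP ->|/eqP ->|Pr]//.
have := H P; rewrite /bisw !inE Pr !orbT => /(_ isT).
case: eqP => [->//|_]; case: eqP => [E|//].
by rewrite -E Pr in br.
Qed.

Lemma perm_swap2 a b r : perm_eq (a :: b :: r) (b :: a :: r).
Proof. by apply/permP => p /=; rewrite addnCA. Qed.

Lemma afree_bis2 a b r : afree (a :: b :: r) -> afree (b :: midpt a b :: r).
Proof. by move=> /(afree_perm (perm_swap2 a b r)) /afree_bis1; rewrite midptC. Qed.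

Lemma hull_bis1 a b r w x : afree (a :: b :: r) -> weights (a :: b :: r) w x ->
  hull (a :: midpt a b :: r) x <->
  (forall P, P \in a :: b :: r -> 0 <= w P) /\ w b <= w a.
Proof.
move=> fs wx; have [us _] := fs; have [us1 _] := afree_bis1 fs.
move: (us); rewrite /= inE negb_or => /and3P[/andP[ab ar] br ur].
split.
  move=> /hullP -/(_ us1)[v [v0 vx]].
  have E := weights_uniq fs wx (bisw_weights us vx).
  split.
    move=> P /E ->; rewrite /bisw; case: ifP => _; first by rewrite addr_ge0// divr_ge0.
    by case: ifP => // _; rewrite divr_ge0.
  rewrite !E ?inE ?eqxx ?orbT// /bisw eqxx eq_sym (negbTE ab) eqxx.
  by rewrite lerDr.
move=> [w0 wba]; apply/hullP => //.
have := midpt_notin fs; rewrite !inE !negb_or => /and3P[ca cb cr].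
(* These weights invert [bisw]: the midpoint alone must supply the weight of [b], so it receives
   twice that weight. *)
exists (fun P => if P == a then w a - w b else if P == midpt a b then 2 * w b
  else if P \in r then w P else 0).
split.
  move=> P; case: ifP => _; first by rewrite subr_ge0.
  case: ifP => _; first by rewrite mulr_ge0// w0// !inE eqxx orbT.
  by case: ifP => // Pr; rewrite w0// !inE Pr !orbT.
have [w1 ->] := wx.
have E P : P \in r -> (if P == a then w a - w b
    else if P == midpt a b then 2 * w b else if P \in r then w P else 0) = w P.
  move=> Pr; case: eqP => [e|_]; first by rewrite -e Pr in ar.
  by case: eqP => [e|_]; [rewrite -e Pr in cr|rewrite Pr].
split.
  rewrite !big_cons eqxx (negbTE ca) eqxx -[RHS]w1 !big_cons.
  rewrite (eq_big_seq w); last by move=> P /E.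
  by ring.
rewrite !big_cons eqxx (negbTE ca) eqxx.
rewrite [in RHS](eq_big_seq (fun P => w P *: P)); last by move=> P /E ->.
rewrite /midpt scalerA (_ : 2 * w b * 2^-1 = w b); last by field.
by rewrite scalerBl scalerDr !addrA subrK.
Qed.

End Bisection.

(** * A mean over a simplex is the average of the means over its two halves *)

Section MeanValues.
Context (R : realType).
Variable n : nat.
Notation point := 'rV[R]_n.
Implicit Types (s r : seq point) (P Q x a b : point) (phi : point -> R).

Lemma locbdd_ind m s : afree s -> size s = m.+1 -> locbdd (ind (hull s)).
Proof.
move=> fs sz; split; first exact: (rmeas_hull fs sz).
by move=> r; exists 1 => x _; rewrite /ind; case: asboolP; rewrite ?normr1 ?normr0.
Qed.

Lemma midpt_hull a b r : uniq (a :: b :: r) -> hull (a :: b :: r) (midpt a b).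
Proof.
move=> us; apply/hullP => //; exists (fun P => ((P == a)%:R + (P == b)%:R) / 2).
by split; [move=> P; rewrite divr_ge0// addr_ge0|exact: weights_midpt].
Qed.

Lemma hull_bisU a b r x : afree (a :: b :: r) ->
  hull (a :: b :: r) x <-> hull (a :: midpt a b :: r) x \/ hull (b :: midpt a b :: r) x.
Proof.
move=> fs; have [us _] := fs; have fs' := afree_perm (perm_swap2 a b r) fs.
split.
  move=> /hullP -/(_ us)[w [w0 wx]]; have [wba|wab] := lerP (w b) (w a).
    by left; apply/(hull_bis1 fs wx); split.
  right; rewrite midptC; apply/(hull_bis1 fs' (weights_perm (perm_swap2 a b r) wx)).
  by split => //; exact: ltW.
have H a' b' : afree (a' :: b' :: r) -> hull (a' :: midpt a' b' :: r) x -> hull (a' :: b' :: r) x.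
  move=> f'; have [u' _] := f'; have [u1 _] := afree_bis1 f'.
  move=> hx; have /hullP -/(_ u1)[w [_ wx]] := hx.
  have wx' := bisw_weights u' wx; have [w0 _] := (hull_bis1 f' wx').1 hx.
  apply/hullP => //; exists (fun P => if P \in a' :: b' :: r then bisw a' b' (midpt a' b') w P else 0).
  split; first by move=> P; case: ifP => // /w0.
  exact: weights_sub.
case; first exact: H.
rewrite midptC => /(H _ _ fs').
by rewrite (hull_perm us (perm_swap2 a b r)).
Qed.

Lemma interior_bis a b r x w : afree (a :: b :: r) ->
  weights (a :: midpt a b :: r) w x -> (forall P, P \in a :: midpt a b :: r -> 0 < w P) ->
  ~ hull (b :: midpt a b :: r) x.
Proof.
move=> fs wx wp; have [us _] := fs; have fs' := afree_perm (perm_swap2 a b r) fs.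
have wx' := weights_perm (perm_swap2 a b r) (bisw_weights us wx).
rewrite midptC => /(hull_bis1 fs' wx')[_]; rewrite /bisw eqxx.
move: us; rewrite /= inE negb_or => /and3P[/andP[ab _] _ _].
rewrite eq_sym (negbTE ab) eqxx => H.
by have := wp a; rewrite inE eqxx => /(_ isT); lra.
Qed.

Section Bis.
Variables (a b : point) (r : seq point).
Hypothesis fs : afree (a :: b :: r).
Let m := (size r).+1.
Let c := midpt a b.
Let s := a :: b :: r.
Let s1 := a :: c :: r.
Let s2 := b :: c :: r.
Let F (psi : point -> R) := rint (fun t : 'rV[R]_m => psi (par s t)).

Let FD psi1 psi2 : bsupp psi1 -> bsupp psi2 ->
  F (fun x => psi1 x + psi2 x) = F psi1 + F psi2.
Proof. by move=> n1 n2; rewrite /F -rintD//; exact: (bsupp_par fs). Qed.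

Let FZ psi k : bsupp psi -> F (fun x => k * psi x) = k * F psi.
Proof. by move=> n1; rewrite /F -rintZ//; exact: (bsupp_par fs). Qed.

Let half s' : afree s' -> size s' = m.+1 -> (forall P, P \in s' -> hull s P) ->
  exists2 k, 0 < k & forall phi, locbdd phi ->
    bint m s' phi = k * F (fun x => ind (hull s') x * phi x).
Proof.
move=> fs' sz' H; have [us _] := fs.
have [k k0 Hk] : exists2 k, 0 < k & forall f : point -> R, bsupp f ->
    rint (fun t : 'rV_m => f (par s' t)) = k * rint (fun t : 'rV_m => f (par s t)).
  apply: rint_par => // P /H /hullP -/(_ us)[w [_ wx]]; by exists w.
exists k => // phi nphi; rewrite bint_hull// (Hk (fun x => ind (hull s') x * phi x))//.
exact: (bsupp_hull fs' sz' nphi).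
Qed.

(** In the parameters of [s] the integral is the sum over the two halves, since their overlap is
    null. Passing to the parameters of a half multiplies by an unknown factor. The affine map
    exchanging [a] and [b] swaps the halves, so both have half the volume and both factors equal
    2. *)
Lemma bint_bisect phi : locbdd phi -> bint m s phi = (bint m s1 phi + bint m s2 phi) / 2.
Proof.
have [us _] := fs.
have fs1 : afree s1 by exact: afree_bis1.
have fs2 : afree s2 by exact: afree_bis2.
have [us1 _] := fs1; have [us2 _] := fs2.
have ch : hull s c by exact: midpt_hull.
have [k1 k10 H1] : exists2 k, 0 < k & forall phi, locbdd phi ->
    bint m s1 phi = k * F (fun x => ind (hull s1) x * phi x).
  apply: half => // P; rewrite !inE => /or3P[/eqP ->|/eqP ->//|Pr]; apply: mem_hull => //.
    by rewrite inE eqxx.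
  by rewrite !inE Pr !orbT.
have [k2 k20 H2] : exists2 k, 0 < k & forall phi, locbdd phi ->
    bint m s2 phi = k * F (fun x => ind (hull s2) x * phi x).
  apply: half => // P; rewrite !inE => /or3P[/eqP ->|/eqP ->//|Pr]; apply: mem_hull => //.
    by rewrite !inE eqxx orbT.
  by rewrite !inE Pr !orbT.
have Z psi : locbdd psi -> F (fun x => ind (hull s1) x * (ind (hull s2) x * psi x)) = 0.
  move=> npsi; apply: (mulfI (lt0r_neq0 k10)); rewrite mulr0.
  have n2 : locbdd (fun x => ind (hull s2) x * psi x).
    by apply: locbddM => //; exact: (locbdd_ind fs2 (m := m)).
  rewrite -H1// -[RHS](mul0r (Vol R m)) -(bint_cst m s1 0).
  apply: bint_interior => //; first exact: locbdd_cst.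
  move=> x w wx wp; rewrite /ind; case: asboolP => [h2|]; last by rewrite mul0r.
  by case: (interior_bis fs wx wp h2).
have S psi : locbdd psi -> bint m s psi = F (fun x => ind (hull s1) x * psi x)
    + F (fun x => ind (hull s2) x * psi x).
  move=> npsi; have n1 := bsupp_hull fs1 (m := m) (erefl _) npsi.
  have n2 := bsupp_hull fs2 (m := m) (erefl _) npsi.
  have n12 : bsupp (fun x => ind (hull s1) x * (ind (hull s2) x * psi x)).
    apply: (bsupp_hull fs1 (m := m)) => //; apply: locbddM => //.
    exact: (locbdd_ind fs2 (m := m)).
  rewrite bint_hull// -[RHS]subr0 -(Z _ npsi) -mulN1r -FZ// -!FD//; last 2 first.
  - exact: bsuppD.
  - exact: bsuppZ.
  apply: eq_rint => t; rewrite /ind; case: asboolP => h; case: asboolP => h1;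
    case: asboolP => h2; rewrite ?mul0r ?mul1r ?mulr0 ?addr0 ?add0r//.
  - by ring.
  - by case: ((hull_bisU _ fs).1 h).
  - by case: h; apply/hull_bisU => //; left.
  - by case: h; apply/hull_bisU => //; left.
  - by case: h; apply/hull_bisU => //; right.
(* Equal volume of the halves: by [hull_bis1] they are cut out by comparing the weights of [a] and
   [b], which trade places when these vertices are swapped. *)
have E12 : F (ind (hull s1)) = F (ind (hull s2)).
  have ps := perm_swap2 a b r; have fs' := afree_perm ps fs; have [us' _] := fs'.
  have [k k0 Hk] : exists2 k, 0 < k & forall f : point -> R, bsupp f ->
      rint (fun t : 'rV_m => f (par (b :: a :: r) t)) = k * rint (fun t : 'rV_m => f (par s t)).
    apply: rint_par => // P; rewrite -(perm_mem ps) => Ps.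
    by have /hullP -/(_ us)[w [_ wx]] := mem_hull us Ps; exists w.
  have ni s' : afree s' -> size s' = m.+1 -> bsupp (ind (hull s')).
    move=> f' z'; have := bsupp_hull f' z' (@locbdd_cst R n 1).
    by under eq_fun do rewrite mulr1.
  have kE : k = 1.
    have V s' : afree s' -> size s' = m.+1 -> rint (fun t : 'rV_m => ind (hull s') (par s' t)) = Vol R m.
      move=> f' z'; rewrite -[RHS]mul1r -(bint_cst m s' 1) bint_hull//.
      by apply: eq_rint => t; rewrite mulr1.
    have := Hk (ind (hull s)) (ni _ fs (erefl _)).
    rewrite (V s)// {1}/s (hull_perm us ps) (V _ fs')// => /esym.
    by rewrite -[X in _ = X]mul1r => /(mulIf (lt0r_neq0 (Vol_gt0 R m))).
  rewrite [RHS]/F -[RHS]mul1r -kE -(Hk _ (ni _ fs2 (erefl _))).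
  apply: eq_rint => t; congr (nat_of_bool _)%:R; apply: asbool_equiv_eq.
  rewrite /s2 /c midptC (hull_bis1 fs' (par_weights (m := m) t us' (erefl _))).
  rewrite (hull_bis1 fs (par_weights (m := m) t us (erefl _))).
  rewrite -(pw_ge0 (m := m) t us (erefl _)) -(pw_ge0 (m := m) t us' (erefl _)).
  have := pw0 (m := m) t us (erefl _); have := pw0 (m := m) t us' (erefl _).
  have := pwS t (ord0 : 'I_m) us (erefl _).
  have := pwS t (ord0 : 'I_m) us' (erefl _).
  by rewrite /= => -> -> -> ->.
have V1 := S _ (@locbdd_cst R n 1).
have e1 f : F (fun x => f x * 1) = F f by apply: eq_rint => t; rewrite mulr1.
have := H1 _ (@locbdd_cst R n 1); have := H2 _ (@locbdd_cst R n 1).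
rewrite !e1 !bint_cst !mul1r -E12 => k2V k1V nphi.
have V0 := Vol_gt0 R m.
rewrite !e1 -E12 bint_cst mul1r in V1.
have F0 : F (ind (hull s1)) != 0.
  by apply/eqP => f0; rewrite f0 addr0 in V1; move: V0; rewrite V1 ltxx.
have -> : bint m s1 phi = 2 * F (fun x => ind (hull s1) x * phi x).
  rewrite H1//; congr (_ * _); apply: (mulIf F0); rewrite -k1V V1; ring.
have -> : bint m s2 phi = 2 * F (fun x => ind (hull s2) x * phi x).
  rewrite H2//; congr (_ * _); apply: (mulIf F0); rewrite -k2V V1; ring.
by rewrite S//; field.
Qed.

End Bis.
End MeanValues.

(** * Exact integrals of affine functions and of their squares *)

Section Moments.
Context (R : realType).
Variable n : nat.
Notation point := 'rV[R]_n.
Implicit Types (s r : seq point) (P Q x a b : point) (phi : point -> R).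

Lemma aff_weights s w x (gc : point * R) : weights s w x ->
  aff gc x = \sum_(P <- s) w P * aff gc P.
Proof.
move=> [w1 ->]; rewrite /aff /dotp.
rewrite -[gc.2]mul1r -{1}w1 mulr_suml mul1r.
under eq_bigr do rewrite summxE mulr_suml.
rewrite exchange_big -big_split; apply: eq_bigr => P _ /=.
rewrite mulrDr; congr (_ + _); rewrite mulr_sumr; apply: eq_bigr => i _.
by rewrite !mxE mulrA.
Qed.

Lemma aff_mid s (gc : point * R) : s != [::] ->
  aff gc (mid s) = (\sum_(P <- s) aff gc P) / (size s)%:R.
Proof.
move=> s0; rewrite (aff_weights gc (weights_mid s0)) mulr_suml.
by apply: eq_bigr => P _; rewrite mulrC.
Qed.

Section Dim.
Variable m : nat.

(** Barycentric coordinates extended to all points through the pseudo-inverse, so that they are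
    locally bounded functions which can be integrated. *)
Definition bary s x P : R :=
  pw s (- nth 0 s 0 *m pinvmx (lin m s) + x *m pinvmx (lin m s)) P.

Lemma bary_par s (t : 'rV[R]_m) P : afree s -> size s = m.+1 -> bary s (par s t) P = pw s (t : 'rV[R]_m) P.
Proof.
move=> fs sz; rewrite /bary; congr (pw s _ P).
rewrite /par -mulmxDl addrA addNr add0r -mulmxA mulmxVp ?mulmx1//.
exact: row_free_lin.
Qed.

Lemma locbdd_pw s P : locbdd (fun t : 'rV[R]_m => pw s t P).
Proof.
rewrite /pw; case: (index P s) => [|j].
  have := locbddD (@locbdd_cst R m 1) (locbddZ (-1) (locbdd_sum (index_enum 'I_m) (@locbdd_coord R m))).
  by under eq_fun do rewrite mulN1r.
by case: insub => [i|]; [exact: locbdd_coord|exact: locbdd_cst].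
Qed.

Lemma locbdd_bary s P : locbdd (fun x => bary s x P).
Proof. exact: (locbdd_comp _ _ (locbdd_pw s P)). Qed.

Lemma bary_weights s x : afree s -> size s = m.+1 -> hull s x -> weights s (bary s x) x.
Proof.
move=> fs sz; have [us _] := fs => /hullP -/(_ us)[w [_ wx]].
have E := weights_par us sz wx.
have := par_weights (\row_i w (nth 0 s i.+1)) us sz.
rewrite -E (_ : pw s _ = bary s x)//.
by apply/funext => P; rewrite [in RHS]E bary_par.
Qed.

Lemma bint_sum (I : Type) (l : seq I) (G : I -> point -> R) s : (forall i, locbdd (G i)) ->
  bint m s (fun x => \sum_(i <- l) G i x) = \sum_(i <- l) bint m s (G i).
Proof.
move=> nG; elim: l => [|i l IH].
  rewrite big_nil -[RHS](mul0r (Vol R m)) -(bint_cst m s 0); congr (bint m s _).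
  by apply/funext => x; rewrite big_nil.
rewrite big_cons -IH -bintD//; last exact: locbdd_sum.
by congr (bint m s _); apply/funext => x; rewrite big_cons.
Qed.

End Dim.

Section Values.
Variable k : nat.
Let m := k.+1.

(** The integral of a squared barycentric coordinate; [mom1] is that of a product of two different
    ones. By symmetry the choice of vertices is immaterial ([bint_bary_diag], [bint_bary_off]). *)
Definition mom0 : R := rint (fun t : 'rV[R]_m =>
  (corner t)%:R * ((1 - \sum_i t 0 i) * (1 - \sum_i t 0 i))).
Definition mom1 : R := rint (fun t : 'rV[R]_m =>
  (corner t)%:R * ((1 - \sum_i t 0 i) * t 0 ord0)).

Lemma bint_bary2_head s P Q s' : afree s -> size s = m.+1 -> perm_eq s s' ->
  P \in s -> Q \in s ->
  bint m s (fun x => bary m s x P * bary m s x Q) =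
  rint (fun t : 'rV[R]_m => (corner t)%:R * (pw s' t P * pw s' t Q)).
Proof.
move=> fs sz ps Ps Qs; have fs' := afree_perm ps fs; have [us _] := fs.
have sz' : size s' = m.+1 by rewrite -(perm_size ps).
rewrite (bint_perm fs sz ps); last by apply: locbddM; exact: locbdd_bary.
rewrite (@eq_bint _ _ m s' _ (fun x => bary m s' x P * bary m s' x Q))//.
  by apply: eq_rint => t; rewrite !bary_par.
move=> x hx; have wx' := bary_weights fs' sz' hx.
rewrite -(hull_perm us ps) in hx; have wx := bary_weights fs sz hx.
have ps' : perm_eq s' s by rewrite perm_sym.
by rewrite !(weights_uniq fs wx (weights_perm ps' wx')).
Qed.

Lemma bint_bary_diag s P : afree s -> size s = m.+1 -> P \in s ->
  bint m s (fun x => bary m s x P * bary m s x P) = mom0.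
Proof.
move=> fs sz Ps; rewrite (bint_bary2_head fs sz (perm_to_rem Ps) Ps Ps).
have [us _] := afree_perm (perm_to_rem Ps) fs.
have sz' : size (P :: rem P s) = m.+1 by rewrite -(perm_size (perm_to_rem Ps)).
apply: eq_rint => t; have := pw0 (m := m) t us sz'.
by rewrite /= => ->.
Qed.

Lemma bint_bary_off s P Q : afree s -> size s = m.+1 -> P \in s -> Q \in s -> P != Q ->
  bint m s (fun x => bary m s x P * bary m s x Q) = mom1.
Proof.
move=> fs sz Ps Qs PQ; have [us0 _] := fs.
have Qr : Q \in rem P s by rewrite (mem_rem_uniq _ us0) !inE eq_sym PQ.
have ps : perm_eq s (P :: Q :: rem Q (rem P s)).
  by rewrite (perm_trans (perm_to_rem Ps))// perm_cons perm_to_rem.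
rewrite (bint_bary2_head fs sz ps Ps Qs).
have [us _] := afree_perm ps fs.
have sz' : size (P :: Q :: rem Q (rem P s)) = m.+1 by rewrite -(perm_size ps).
apply: eq_rint => t; have := pw0 (m := m) t us sz'.
have := pwS t (ord0 : 'I_m) us sz'.
by rewrite /= => -> ->.
Qed.

                                                                                         
(** Bisect the integral of the squared coordinate of [a]. That coordinate is mu_a + mu_c / 2 on one
    child and nu_c / 2 on the other, in the coordinates of the children. Hence 2 mom0 = (mom0 + mom1
    + mom0 / 4) + mom0 / 4. *)
Lemma mom_half s : afree s -> size s = m.+1 -> mom0 = 2 * mom1.
Proof.
case: s => [//|a [//|b r]] fs sz; case: sz => sz.
have fs1 := afree_bis1 fs; have fs2 := afree_bis2 fs.
pose c := midpt a b; pose s := a :: b :: r.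
have [us _] := fs; have fs' := afree_perm (perm_swap2 a b r) fs; have [us' _] := fs'.
have ab : a != b by move: us; rewrite /= inE negb_or => /and3P[/andP[]].
have ca : a != c.
  by have := midpt_notin fs; rewrite !inE !negb_or eq_sym => /andP[].
have sz0 : size s = m.+1 by rewrite /= sz.
have sz1 : size (a :: c :: r) = m.+1 by rewrite /= sz.
have sz2 : size (b :: c :: r) = m.+1 by rewrite /= sz.
have := @bint_bisect R n a b r fs (fun x => bary m s x a * bary m s x a).
rewrite sz -/m -/s -/c => /(_ (locbddM (locbdd_bary m s a) (locbdd_bary m s a))).
rewrite (bint_bary_diag fs)// ?mem_head//.
pose B P x := bary m (a :: c :: r) x P.
rewrite (@eq_bint _ _ m (a :: c :: r) _ (fun x => (B a x * B a x + B a x * B c x) +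
   4^-1 * (B c x * B c x)))//; last first.
  move=> x hx; have hs : hull s x by apply/hull_bisU => //; left.
  rewrite (weights_uniq fs (bary_weights fs sz0 hs)
    (bisw_weights us (bary_weights fs1 sz1 hx))) ?mem_head//.
  by rewrite /bisw eqxx -/c -/(B a x) -/(B c x); field.
pose D P x := bary m (b :: c :: r) x P.
rewrite (@eq_bint _ _ m (b :: c :: r) _ (fun x => 4^-1 * (D c x * D c x)))//; last first.
  move=> x hx; have hs : hull s x by apply/hull_bisU => //; right.
  have wD := bary_weights fs2 sz2 hx; rewrite /= midptC in wD.
  have wD' := weights_perm (perm_swap2 b a r) (bisw_weights us' wD).
  rewrite (weights_uniq fs (bary_weights fs sz0 hs) wD') ?mem_head//.
  by rewrite /bisw (negbTE ab) eqxx midptC -/c -/(D c x); field.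
have nB P Q : locbdd (fun x => B P x * B Q x) by apply: locbddM; exact: locbdd_bary.
have nD P Q : locbdd (fun x => D P x * D Q x) by apply: locbddM; exact: locbdd_bary.
rewrite bintD//; [|exact: locbddD|exact: locbddZ].
rewrite bintD// !bintZ// !bint_bary_diag ?bint_bary_off ?inE ?eqxx ?orbT//.
by lra.
Qed.

(** Expand 1 as the square of the sum of all barycentric coordinates and integrate, using [mom_half]
    on the diagonal. *)
Lemma mom1E s : afree s -> size s = m.+1 -> mom1 = Vol R m / (m.+1 * m.+2)%:R.
Proof.
move=> fs sz; have [us _] := fs; have h := mom_half fs sz.
have nB P Q : locbdd (fun x => bary m s x P * bary m s x Q).
  by apply: locbddM; exact: locbdd_bary.
have E1 : Vol R m = bint m s (fun x => \sum_(P <- s) \sum_(Q <- s) bary m s x P * bary m s x Q).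
  rewrite -[LHS]mul1r -(bint_cst m s 1); apply: eq_bint => // x hx.
  have [w1 _] := bary_weights fs sz hx.
  by under eq_bigr do rewrite -mulr_sumr w1 mulr1; rewrite w1.
have E2 : Vol R m = \sum_(P <- s) \sum_(Q <- s) (mom1 + (P == Q)%:R * mom1).
  rewrite {}E1 bint_sum; last by move=> P; apply: locbdd_sum.
  apply: eq_big_seq => P Ps; rewrite bint_sum//; apply: eq_big_seq => Q Qs.
  have [<-|PQ] := eqVneq P Q; first by rewrite bint_bary_diag// h mul1r; ring.
  by rewrite bint_bary_off// mul0r addr0.
rewrite E2 [X in X / _](_ : _ = \sum_(P <- s) (m.+2%:R * mom1)); last first.
  apply: eq_big_seq => P Ps; rewrite big_split /= big_const_seq count_predT sz iter_addr_0.
  rewrite (bigD1_seq P)//= eqxx mul1r big1 ?addr0.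
    by rewrite -mulrSr mulr_natl.
  by move=> Q /negbTE; rewrite eq_sym => ->; rewrite mul0r.
rewrite big_const_seq count_predT sz iter_addr_0 -[_ *+ _]mulr_natl natrM.
by rewrite mulrA [RHS]mulrC mulKf// mulf_neq0 ?pnatr_eq0.
Qed.

Lemma bint_aff2 s (gc : point * R) : afree s -> size s = m.+1 ->
  bint m s (fun x => aff gc x ^+ 2) =
  Vol R m * ((\sum_(P <- s) aff gc P ^+ 2 + (\sum_(P <- s) aff gc P) ^+ 2)
             / (m.+1 * m.+2)%:R).
Proof.
move=> fs sz; have [us _] := fs; have h := mom_half fs sz.
pose a := aff gc.
have nB P Q : locbdd (fun x => a P * a Q * (bary m s x P * bary m s x Q)).
  by apply: locbddZ; apply: locbddM; exact: locbdd_bary.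
rewrite (@eq_bint _ _ m s _ (fun x => \sum_(P <- s) \sum_(Q <- s)
    a P * a Q * (bary m s x P * bary m s x Q)))//; last first.
  move=> x hx; rewrite (aff_weights gc (bary_weights fs sz hx)) expr2 mulr_suml.
  apply: eq_bigr => P _; rewrite mulr_sumr; apply: eq_bigr => Q _.
  by rewrite /a; ring.
rewrite bint_sum; last by move=> P; exact: locbdd_sum.
transitivity (\sum_(P <- s) \sum_(Q <- s) (a P * a Q * mom1 + (P == Q)%:R * (a P * a Q * mom1))).
  apply: eq_big_seq => P Ps; rewrite bint_sum//; apply: eq_big_seq => Q Qs.
  rewrite bintZ; last by apply: locbddM; exact: locbdd_bary.
  have [<-|PQ] := eqVneq P Q; first by rewrite bint_bary_diag// h mul1r; ring.
  by rewrite bint_bary_off// mul0r addr0.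
rewrite mulrCA -(mom1E fs sz) addrC mulrDl expr2 !mulr_suml -big_split.
apply: eq_big_seq => P Ps /=; rewrite big_split /= mulr_sumr mulr_suml; congr (_ + _).
rewrite (bigD1_seq P)//= eqxx mul1r big1 ?addr0 ?expr2//.
by move=> Q /negbTE; rewrite eq_sym => ->; rewrite mul0r.
Qed.

(** Multiplication by the sum of the barycentric coordinates, which is 1, reduces the integral to
    the second moments already known. *)
Lemma bint_aff s (gc : point * R) : afree s -> size s = m.+1 ->
  bint m s (aff gc) = Vol R m * aff gc (mid s).
Proof.
move=> fs sz; have [us _] := fs; have h := mom_half fs sz.
pose a := aff gc.
have nB P Q : locbdd (fun x => a P * (bary m s x P * bary m s x Q)).
  by apply: locbddZ; apply: locbddM; exact: locbdd_bary.
rewrite (@eq_bint _ _ m s _ (fun x => \sum_(P <- s) \sum_(Q <- s)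
    a P * (bary m s x P * bary m s x Q)))//; last first.
  move=> x hx; have wx := bary_weights fs sz hx; have [w1 _] := wx.
  rewrite (aff_weights gc wx); apply: eq_bigr => P _.
  by rewrite -!mulr_sumr w1 mulr1 mulrC.
rewrite bint_sum; last by move=> P; exact: locbdd_sum.
transitivity (\sum_(P <- s) (a P * (m.+2%:R * mom1))).
  apply: eq_big_seq => P Ps; rewrite bint_sum//.
  rewrite (eq_big_seq (fun Q => a P * (mom1 + (P == Q)%:R * mom1))); last first.
    move=> Q Qs; rewrite bintZ; last by apply: locbddM; exact: locbdd_bary.
    have [<-|PQ] := eqVneq P Q; first by rewrite bint_bary_diag// h mul1r; ring.
    by rewrite bint_bary_off// mul0r addr0.
  rewrite -mulr_sumr; congr (_ * _).
  rewrite big_split /= big_const_seq count_predT sz iter_addr_0.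
  rewrite (bigD1_seq P)//= eqxx mul1r big1 ?addr0.
    by rewrite -mulrSr mulr_natl.
  by move=> Q /negbTE; rewrite eq_sym => ->; rewrite mul0r.
have s0 : s != [::] by case: (s) sz.
rewrite -mulr_suml (mom1E fs sz) aff_mid// sz natrM.
have : (m.+1%:R : R) != 0 by rewrite pnatr_eq0.
have : (m.+2%:R : R) != 0 by rewrite pnatr_eq0.
move: (m.+1%:R : R) (m.+2%:R : R) => A B B0 A0; rewrite -/a.
by field; rewrite A0.
Qed.

End Values.
End Moments.

(** * Integrals over full-dimensional simplices *)

Section Volume.
Context (R : realType).
Variable n : nat.
Implicit Types (s : seq 'rV[R]_n).

Lemma rint_hull s : afree s -> size s = n.+1 ->
  exists2 c, 0 < c & forall phi, locbdd phi ->
    rint (fun x => ind (hull s) x * phi x) = c * bint n s phi.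
Proof.
move=> fs sz; have uA : lin n s \in unitmx by rewrite -row_free_unit; exact: row_free_lin.
have [c c0 H] := rint_aff uA.
exists c^-1; first by rewrite invr_gt0.
move=> phi nphi; rewrite bint_hull// /par.
rewrite (H (fun x => ind (hull s) x * phi x)) ?mulKf ?lt0r_neq0//.
exact: (bsupp_hull fs sz).
Qed.

End Volume.

                        

(** * Bisection trees, and means over simplices and sides assembled along them *)

Inductive btree := Leaf | Node of btree & btree.

Section Trees.
Context (R : realType).
Variable n : nat.
Notation point := 'rV[R]_n.
Notation tsimplex := (tsimplex R n).
Implicit Types (D T K : tsimplex) (P Q x : point) (t : btree) (phi : point -> R).

Definition vfirst D : point := nth 0 D.1 0.
Definition vlast D : point := nth 0 D.1 n.
Definition vmid D : point := midpt (vfirst D) (vlast D).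
Definition vinner D : seq point := [seq nth 0 D.1 i | i <- iota 1 n.-1].
Definition child1 D : tsimplex := (vfirst D :: vmid D :: vinner D, (D.2.+1 %% n)%N).
Definition child2 D : tsimplex :=
  (vlast D :: vmid D :: take D.2 (vinner D) ++ rev (drop D.2 (vinner D)), (D.2.+1 %% n)%N).

Lemma bisectE D : bisect D = [:: child1 D; child2 D].
Proof. by []. Qed.

Definition wf D : Prop := size D.1 = n.+1 /\ afree D.1.

Fixpoint leaves t D : seq tsimplex :=
  if t is Node t1 t2 then leaves t1 (child1 D) ++ leaves t2 (child2 D) else [:: D].

(** Since each bisection halves the volume, this is the volume-weighted mean of the leaf values. *)
Fixpoint tavg (V : lmodType R) (q : tsimplex -> V) t D : V :=
  if t is Node t1 t2 then 2^-1 *: (tavg q t1 (child1 D) + tavg q t2 (child2 D)) else q D.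

                                                                                  
                                                      
(** The mean of [v] over the side of [D] opposite [P]. The sides opposite the endpoints of the
    refinement edge survive as sides of one child, opposite the new vertex; every other side is
    itself bisected. *)
Fixpoint savg (v : paff R n) t D P : R :=
  if t is Node t1 t2 then
    if P == vfirst D then savg v t2 (child2 D) (vmid D)
    else if P == vlast D then savg v t1 (child1 D) (vmid D)
    else (savg v t1 (child1 D) P + savg v t2 (child2 D) P) / 2
  else aff (v D) (mid (rem P D.1)).

Hypothesis n0 : (0 < n)%N.

Lemma wf_perm D : wf D -> perm_eq D.1 (vfirst D :: vlast D :: vinner D).
Proof.
move=> [sz _].
have E : D.1 = [seq nth 0 D.1 i | i <- iota 0 n.+1] by rewrite -{1}(mkseq_nth 0 D.1) sz.
have Ei : iota 0 n.+1 = 0 :: rcons (iota 1 n.-1) n.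
  rewrite -[n in iota 0 n.+1](prednK n0) -(addn1 n.-1.+1) iotaD -cats1.
  by rewrite add0n prednK// -[n in iota 0 n](prednK n0).
rewrite {1}E Ei /= perm_cons map_rcons -cats1.
by rewrite -[_ :: vinner D]cat1s perm_catC.
Qed.

Lemma child2_perm D : perm_eq (child2 D).1 (vlast D :: vmid D :: vinner D).
Proof.
rewrite /= !perm_cons -{3}(cat_take_drop D.2 (vinner D)) perm_cat2l.
by rewrite perm_rev.
Qed.

Lemma wf_free D : wf D -> afree (vfirst D :: vlast D :: vinner D).
Proof. by move=> wD; have [_] := wD; apply: afree_perm; exact: wf_perm. Qed.

Lemma size_vinner D : size (vinner D) = n.-1.
Proof. by rewrite size_map size_iota. Qed.

Lemma wf_child1 D : wf D -> wf (child1 D).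
Proof.
move=> wD; split; first by rewrite /= size_vinner prednK.
exact: afree_bis1 (wf_free wD).
Qed.

Lemma wf_child2 D : wf D -> wf (child2 D).
Proof.
move=> wD; split; first by rewrite (perm_size (child2_perm D)) /= size_vinner prednK.
apply: (@afree_perm _ _ (vlast D :: vmid D :: vinner D)); first by rewrite perm_sym child2_perm.
exact: afree_bis2 (wf_free wD).
Qed.

Lemma hull_child2 D : wf D -> hull (child2 D).1 = hull (vlast D :: midpt (vfirst D) (vlast D) :: vinner D).
Proof.
by move=> /wf_child2[_ [us _]]; apply: hull_perm => //; exact: child2_perm.
Qed.

Lemma hull_node D x : wf D -> hull D.1 x <-> hull (child1 D).1 x \/ hull (child2 D).1 x.
Proof.
move=> wD; have [_ [us _]] := wD.
by rewrite (hull_perm us (wf_perm wD)) (hull_bisU x (wf_free wD)) hull_child2.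
Qed.

Lemma leaves_hull t D T : wf D -> T \in leaves t D -> hull T.1 `<=` hull D.1.
Proof.
elim: t D => [|t1 IH1 t2 IH2] D wD /=; first by rewrite inE => /eqP ->.
rewrite mem_cat => /orP[/IH1|/IH2] H x Hx; apply/hull_node => //.
  by left; apply: H => //; exact: wf_child1.
by right; apply: H => //; exact: wf_child2.
Qed.

Lemma leaves_cover t D x : wf D -> hull D.1 x -> exists2 T, T \in leaves t D & hull T.1 x.
Proof.
elim: t D => [|t1 IH1 t2 IH2] D wD /=; first by exists D; rewrite ?inE.
move=> /(hull_node _ wD)[/(IH1 _ (wf_child1 wD))|/(IH2 _ (wf_child2 wD))][T TL hx];
  by exists T => //; rewrite mem_cat TL ?orbT.
Qed.

(** Along the sequence of bisections, [K] either survives a step or is replaced by its children,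
    whose trees are then joined. *)
Lemma reach_leaves Tr Trh : bisect_reach Tr Trh -> forall K, K \in Tr ->
  exists t, {subset leaves t K <= Trh}.
Proof.
elim => [Tr' K KT|Tr1 Tr2 Tr3 [T TT1 ps] _ IH K KT].
  by exists Leaf => T; rewrite inE => /eqP ->.
have [KT'|KT'] := eqVneq K T; last first.
  by apply: IH; rewrite (perm_mem ps) mem_cat (rem_mem KT' KT).
have [|t1 H1] := IH (child1 K); first by rewrite (perm_mem ps) -KT' mem_cat bisectE !inE eqxx orbT.
have [|t2 H2] := IH (child2 K); first by rewrite (perm_mem ps) -KT' mem_cat bisectE !inE eqxx !orbT.
by exists (Node t1 t2) => S /=; rewrite mem_cat => /orP[/H1|/H2].
Qed.

Lemma bint_tavg (q : tsimplex -> R^o) phi t D : locbdd phi -> wf D ->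
  (forall T, T \in leaves t D -> bint n T.1 phi = Vol R n * q T) ->
  bint n D.1 phi = Vol R n * tavg q t D.
Proof.
move=> np; elim: t D => [|t1 IH1 t2 IH2] D wD H /=; first by rewrite H ?inE.
have [sz fs] := wD.
rewrite (bint_perm fs sz (wf_perm wD) np).
have := bint_bisect (wf_free wD) np; rewrite size_vinner prednK// => ->.
have [sz2 fs2] := wf_child2 wD.
rewrite -[vlast D :: _]/(vlast D :: vmid D :: vinner D) -(bint_perm fs2 sz2 (child2_perm D) np) -/(child1 D).1.
rewrite (IH1 (child1 D) (wf_child1 wD)); last by move=> T TL; apply: H; rewrite /= mem_cat TL.
rewrite (IH2 (child2 D) (wf_child2 wD)); last by move=> T TL; apply: H; rewrite /= mem_cat TL orbT.
by rewrite -mulrDr -mulrA; congr (_ * _); exact: mulrC.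
Qed.

                                                                                      
                                                                                   
               
(** One function [phi] of points has, on every side of every leaf, the mean that the leaf's own
    affine piece predicts. Both neighbours of a side are thus tied to the same integral, whatever
    the two subtrees look like. *)
Definition compat (v : paff R n) phi t D : Prop :=
  forall T, T \in leaves t D -> forall Q, Q \in T.1 ->
    bint n.-1 (rem Q T.1) phi = Vol R n.-1 * aff (v T) (mid (rem Q T.1)).

Lemma compat_node v phi t1 t2 D : compat v phi (Node t1 t2) D ->
  compat v phi t1 (child1 D) /\ compat v phi t2 (child2 D).
Proof. by move=> H; split => T TL; apply: H; rewrite /= mem_cat TL ?orbT. Qed.

Lemma rem_perm (s s' : seq point) P : perm_eq s s' -> perm_eq (rem P s) (rem P s').
Proof.
move=> ps; have [Ps|Ps] := boolP (P \in s); last first.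
  by rewrite !rem_id// -(perm_mem ps).
have Ps' : P \in s' by rewrite -(perm_mem ps).
by rewrite -(perm_cons P) (perm_trans _ (perm_to_rem Ps'))// (perm_trans _ ps)// perm_sym perm_to_rem.
Qed.

Lemma rem2 (a b : point) (r : seq point) : a != b -> rem b (a :: b :: r) = a :: r.
Proof. by move=> /negbTE ab /=; rewrite ab eqxx. Qed.

Lemma size_rem_wf D P : wf D -> P \in D.1 -> size (rem P D.1) = n.-1.+1.
Proof. by move=> [sz _] PD; rewrite size_rem// sz /= prednK. Qed.

Lemma node_neq D : wf D -> [/\ vfirst D != vlast D, vfirst D != vmid D & vlast D != vmid D].
Proof.
move=> wD; have [us _] := wf_free wD; have := midpt_notin (wf_free wD).
rewrite !inE !negb_or -/(vmid D) => /and3P[m0 mN _].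
move: us; rewrite /= inE negb_or => /and3P[/andP[ab _] _ _].
by split; rewrite // eq_sym.
Qed.

Lemma bint_savg v phi t D P : locbdd phi -> wf D -> P \in D.1 -> compat v phi t D ->
  bint n.-1 (rem P D.1) phi = Vol R n.-1 * savg v t D P.
Proof.
move=> np; elim: t D P => [|t1 IH1 t2 IH2] D P wD PD cD /=.
  by rewrite cD ?inE.
have [cc1 cc2] := compat_node cD; have [sz fs] := wD.
have [w1 w2] := (wf_child1 wD, wf_child2 wD).
have [ab a0 aN] := node_neq wD.
have szr Q : Q \in D.1 -> size (rem Q D.1) = n.-1.+1 by exact: size_rem_wf.
case: eqP => [P0|/eqP P0].
  have mc : vmid D \in (child2 D).1 by rewrite !inE eqxx orbT.
  rewrite -IH2//; apply: bint_perm => //; [exact: afree_rem|exact: szr|].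
  rewrite P0; apply: perm_trans (rem_perm _ (wf_perm wD)) _.
  rewrite perm_sym; apply: perm_trans (rem_perm _ (child2_perm D)) _.
  by rewrite rem2// /= eqxx.
case: eqP => [PN|/eqP PN].
  have mc : vmid D \in (child1 D).1 by rewrite !inE eqxx orbT.
  rewrite -IH1//; apply: bint_perm => //; [exact: afree_rem|exact: szr|].
  rewrite PN; apply: perm_trans (rem_perm _ (wf_perm wD)) _.
  by rewrite rem2// /child1 /= (negbTE a0) eqxx.
have := PD; rewrite (perm_mem (wf_perm wD)) !inE (negbTE P0) (negbTE PN) /= => Pr.
have P1 : P \in (child1 D).1 by rewrite !inE Pr !orbT.
have P2 : P \in (child2 D).1 by rewrite (perm_mem (child2_perm D)) !inE Pr !orbT.
have Pm : P != vmid D.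
  apply/eqP => E; have := midpt_notin (wf_free wD).
  by rewrite !inE -/(vmid D) -E Pr !orbT.
have rE (a b : point) : P != a -> P != b ->
    rem P (a :: b :: vinner D) = a :: b :: rem P (vinner D).
  by move=> Pa Pb /=; rewrite eq_sym (negbTE Pa) eq_sym (negbTE Pb).
have p0 := rem_perm P (wf_perm wD); rewrite rE// in p0.
have p2 := rem_perm P (child2_perm D); rewrite rE// in p2.
have fr := afree_rem P fs.
rewrite (bint_perm fr (szr _ PD) p0 np).
have szi : (size (rem P (vinner D))).+1 = n.-1.
  rewrite size_rem// size_vinner prednK//.
  by rewrite -(size_vinner D); case: (vinner D) Pr.
have := bint_bisect (afree_perm p0 fr) np; rewrite szi => ->.
have [sz2 fs2] := w2.
rewrite -[midpt _ _]/(vmid D) -(bint_perm (afree_rem P fs2) _ p2 np); last exact: size_rem_wf.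
rewrite (IH2 (child2 D))// -(rE (vfirst D) (vmid D))// -[vfirst D :: _]/(child1 D).1 (IH1 (child1 D))//.
by rewrite -mulrDr mulrA.
Qed.

(** Both numbers are the mean of [phi] over the side along which [D] is cut. *)
Lemma savg_match v phi t1 t2 D : locbdd phi -> wf D -> compat v phi (Node t1 t2) D ->
  savg v t1 (child1 D) (vfirst D) = savg v t2 (child2 D) (vlast D).
Proof.
move=> np wD cD; have [cc1 cc2] := compat_node cD.
have [w1 w2] := (wf_child1 wD, wf_child2 wD).
have X1 : vfirst D \in (child1 D).1 by rewrite !inE eqxx.
have X2 : vlast D \in (child2 D).1 by rewrite !inE eqxx.
apply: (mulfI (lt0r_neq0 (Vol_gt0 R n.-1))).
rewrite -(bint_savg np w1 X1 cc1) -(bint_savg np w2 X2 cc2).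
have [_ f1] := w1; apply: (bint_perm (afree_rem _ f1) (size_rem_wf w1 X1) _ np).
 rewrite perm_sym; apply: perm_trans (rem_perm _ (child2_perm D)) _.
  by rewrite /= !eqxx.
Qed.

End Trees.

                                          

(** * Discrete Cauchy-Schwarz and variance inequalities *)

Section Inequalities.
Context (R : realType).

(** The inductive step of Cauchy-Schwarz: the cross term 2pq is at most ad + cb, by comparing
    squares. *)
Lemma cauchy_add (p q a b c d : R) : 0 <= a -> 0 <= b -> 0 <= c -> 0 <= d ->
  p ^+ 2 <= a * b -> q ^+ 2 <= c * d -> (p + q) ^+ 2 <= (a + c) * (b + d).
Proof.
move=> a0 b0 c0 d0 pab qcd.
have H : 2 * (p * q) <= a * d + c * b.
  apply: le_trans (ler_norm _) _; rewrite -ler_sqr ?nnegrE ?addr_ge0 ?mulr_ge0//.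
  rewrite real_normK ?num_real//.
  have : (p * q) ^+ 2 <= (a * b) * (c * d) by rewrite exprMn ler_pM ?sqr_ge0.
  have : 0 <= (a * d - c * b) ^+ 2 by exact: sqr_ge0.
  nra.
nra.
Qed.

Lemma cauchy_sum (I : Type) (s : seq I) (p a b : I -> R) :
  (forall i, 0 <= a i) -> (forall i, 0 <= b i) -> (forall i, p i ^+ 2 <= a i * b i) ->
  (\sum_(i <- s) p i) ^+ 2 <= (\sum_(i <- s) a i) * (\sum_(i <- s) b i).
Proof.
move=> a0 b0 pab; elim: s => [|i s IH]; first by rewrite !big_nil expr0n mulr0.
by rewrite !big_cons cauchy_add// sumr_ge0.
Qed.

Lemma cauchy_size (I : Type) (s : seq I) (p : I -> R) :
  (\sum_(i <- s) p i) ^+ 2 <= (size s)%:R * \sum_(i <- s) p i ^+ 2.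
Proof.
have := @cauchy_sum I s p (fun=> 1) (fun i => p i ^+ 2).
rewrite big_const_seq count_predT iter_addr_0; apply => // i.
  exact: sqr_ge0.
by rewrite mul1r.
Qed.

Lemma seq_min (I : eqType) (s : seq I) (h : I -> R) : s != [::] ->
  exists2 i, i \in s & forall j, j \in s -> h i <= h j.
Proof.
elim: s => [//|i s IH] _; have [->|/IH[j js hj]] := eqVneq s [::].
  by exists i; rewrite ?inE// => j; rewrite inE => /eqP ->.
have [ij|ji] := lerP (h i) (h j).
  exists i; rewrite ?mem_head// => k; rewrite inE => /predU1P[->//|/hj].
  exact: le_trans.
exists j; rewrite ?inE ?js ?orbT// => k; rewrite inE => /predU1P[->|/hj//].
exact: ltW.
Qed.

(** Popoviciu's inequality: sum (h k - min)(max - h k) >= 0 over all [k] and complete the square.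
    The number [e] bounds the squared range. *)
Lemma variance_range (I : eqType) (s : seq I) (h : I -> R) e : s != [::] ->
  (forall i j, i \in s -> j \in s -> (h i - h j) ^+ 2 <= e) ->
  \sum_(i <- s) h i ^+ 2 - (\sum_(i <- s) h i) ^+ 2 / (size s)%:R <= (size s)%:R * e / 4.
Proof.
move=> s0 H.
have [i si hi] := seq_min h s0; have [j sj hj] := seq_min (fun k => - h k) s0.
have N0 : 0 < (size s)%:R :> R by rewrite ltr0n lt0n size_eq0.
set S := \sum_(k <- s) h k; set N := (size s)%:R.
have A : \sum_(k <- s) h k ^+ 2 <= (h i + h j) * S - N * (h i * h j).
  have -> : (h i + h j) * S - N * (h i * h j) =
      \sum_(k <- s) ((h i + h j) * h k - h i * h j).
    rewrite sumrB -mulr_sumr big_const_seq count_predT iter_addr_0.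
    by rewrite -[_ *+ size s]mulr_natl.
  rewrite !big_seq; apply: ler_sum => k ks.
  by have := hi _ ks; have := hj _ ks; rewrite lerN2 => *; nra.
have B := H _ _ sj si.
rewrite -subr_ge0; set X := \sum_(k <- s) _ in A *.
have : 0 <= N * (N * e / 4 - (X - S ^+ 2 / N)).
  have -> : N * (N * e / 4 - (X - S ^+ 2 / N)) = N * N * e / 4 - N * X + S ^+ 2.
    by field; exact: lt0r_neq0.
  have A' : N * X <= N * ((h i + h j) * S - N * (h i * h j)) by rewrite ler_pM2l.
  have B' : N * N * (h j - h i) ^+ 2 <= N * N * e by rewrite ler_pM2l ?mulr_gt0.
  have C : 0 <= (S - N * (h i + h j) / 2) ^+ 2 by exact: sqr_ge0.
  nra.
by rewrite pmulr_rge0.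
Qed.

End Inequalities.

(** * Second moments of simplices *)

Section Dot.
Context (R : realType).
Variable n : nat.
Notation point := 'rV[R]_n.
Implicit Types (s r : seq point) (P Q x a b u v : point).

Lemma dotpDl u v x : dotp (u + v) x = dotp u x + dotp v x.
Proof. by rewrite /dotp -big_split; apply: eq_bigr => i _; rewrite mxE mulrDl. Qed.

Lemma dotpZl k u x : dotp (k *: u) x = k * dotp u x.
Proof. by rewrite /dotp mulr_sumr; apply: eq_bigr => i _; rewrite mxE mulrA. Qed.

Lemma dotpC u v : dotp u v = dotp v u.
Proof. by apply: eq_bigr => i _; rewrite mulrC. Qed.

Lemma dotpNl u x : dotp (- u) x = - dotp u x.
Proof. by rewrite -scaleN1r dotpZl mulN1r. Qed.

Lemma dotpBl u v x : dotp (u - v) x = dotp u x - dotp v x.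
Proof. by rewrite dotpDl dotpNl. Qed.

Lemma dotp_subsq u v : dotp (u - v) (u - v) = dotp u u + dotp v v - 2 * dotp v u.
Proof. by rewrite dotpBl ![dotp _ (u - v)]dotpC !dotpBl (dotpC u v); ring. Qed.

Lemma dotp_ge0 u : 0 <= dotp u u.
Proof. by apply: sumr_ge0 => i _; rewrite -expr2 sqr_ge0. Qed.

Lemma dotp_suml (I : Type) (l : seq I) (F : I -> point) x :
  dotp (\sum_(i <- l) F i) x = \sum_(i <- l) dotp (F i) x.
Proof.
elim: l => [|i l IH]; last by rewrite !big_cons dotpDl IH.
by rewrite !big_nil /dotp big1// => i _; rewrite mxE mul0r.
Qed.

Lemma dotp_cs u v : dotp u v ^+ 2 <= dotp u u * dotp v v.
Proof.
apply: cauchy_sum => i; rewrite -?expr2 ?sqr_ge0//.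
by rewrite exprMn.
Qed.

Lemma dotp_add_le u v (r s : R) : 0 <= r -> 0 <= s -> dotp u u <= r ^+ 2 ->
  dotp v v <= s ^+ 2 -> dotp (u + v) (u + v) <= (r + s) ^+ 2.
Proof.
move=> r0 s0 ur vs.
have E : dotp (u + v) (u + v) = dotp u u + 2 * dotp u v + dotp v v.
  by rewrite dotpDl ![dotp _ (u + v)]dotpC !dotpDl (dotpC v u); ring.
have H : dotp u v <= r * s.
  apply: le_trans (ler_norm _) _; rewrite -ler_sqr ?nnegrE ?mulr_ge0//.
  rewrite real_normK ?num_real// (le_trans (dotp_cs u v))// exprMn.
  by rewrite ler_pM ?dotp_ge0.
by rewrite E; nra.
Qed.

Lemma dotp_sum_le (l : seq point) (d : R) : 0 <= d ->
  (forall u, u \in l -> dotp u u <= d ^+ 2) ->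
  dotp (\sum_(u <- l) u) (\sum_(u <- l) u) <= ((size l)%:R * d) ^+ 2.
Proof.
move=> d0; elim: l => [|u l IH] H.
  by rewrite big_nil /dotp big1 ?sqr_ge0// => i _; rewrite mxE mul0r.
rewrite big_cons (_ : _ * d = d + (size l)%:R * d); last first.
  by rewrite /= -natr1 mulrDl mul1r addrC.
apply: dotp_add_le; rewrite ?mulr_ge0//; first by rewrite H ?mem_head.
by apply: IH => v vl; rewrite H// inE vl orbT.
Qed.

Lemma aff_sub (gc : point * R) x y : aff gc x - aff gc y = dotp (x - y) gc.1.
Proof. by rewrite /aff dotpBl; ring. Qed.

                                                                                        
(** For n + 1 vertices this is the mean of |y - x|^2 over the simplex, in closed form. *)
Definition smom s x : R :=
  (\sum_(P <- s) dotp (P - x) (P - x) +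
   dotp (\sum_(P <- s) (P - x)) (\sum_(P <- s) (P - x))) / (n.+1 * n.+2)%:R.

Lemma smom_perm s s' x : perm_eq s s' -> smom s x = smom s' x.
Proof. by move=> ps; rewrite /smom !(perm_big _ ps). Qed.

Lemma smom_bis a b r x :
  smom (a :: b :: r) x = (smom (a :: midpt a b :: r) x + smom (b :: midpt a b :: r) x) / 2.
Proof.
rewrite /smom !big_cons.
have -> : midpt a b - x = 2^-1 *: ((a - x) + (b - x)).
  rewrite /midpt addrACA -opprD scalerBr; congr (_ - _).
  by rewrite scalerDr -scalerDl -[LHS]scale1r; congr (_ *: _); field.
move: (a - x) (b - x) (\sum_(P <- r) (P - x)) (\sum_(P <- r) dotp (P - x) (P - x)) => u v S A.
have D2 (y z : point) : dotp (y + z) (y + z) = dotp y y + 2 * dotp y z + dotp z z.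
  by rewrite dotpDl ![dotp _ (y + z)]dotpC !dotpDl (dotpC z y); ring.
have Dr (y z w : point) : dotp y (z + w) = dotp y z + dotp y w.
  by rewrite dotpC dotpDl ![dotp _ y]dotpC.
have Zr (k : R) (y z : point) : dotp y (k *: z) = k * dotp y z.
  by rewrite dotpC dotpZl dotpC.
rewrite !(D2, Dr, Zr, dotpZl, dotpDl) ?(dotpC v u) ?(dotpC S u) ?(dotpC S v).
rewrite -mulrDl [RHS]mulrAC; congr (_ / _).
by field.
Qed.

Lemma mid_sub_sum s x : s != [::] ->
  mid s - x = (size s)%:R^-1 *: \sum_(P <- s) (P - x).
Proof.
move=> s0; have N0 : (size s)%:R != 0 :> R by rewrite pnatr_eq0 size_eq0.
rewrite /mid sumrB big_const_seq count_predT iter_addr_0 scalerBr.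
by rewrite -[x *+ _]scaler_nat scalerA mulVf// scale1r.
Qed.

(** Jensen's inequality for the squared distance. In closed form it is Cauchy-Schwarz for the sum of
    the n + 1 vectors P - x. *)
Lemma smom_mid s x : size s = n.+1 -> dotp (mid s - x) (mid s - x) <= smom s x.
Proof.
move=> sz; have s0 : s != [::] by case: (s) sz.
rewrite mid_sub_sum// /smom sz.
set S := \sum_(P <- s) (P - x); set A := \sum_(P <- s) _.
have H : dotp S S <= n.+1%:R * A.
  rewrite /A /dotp [in X in _ * X]exchange_big mulr_sumr; apply: ler_sum => i _.
  rewrite /S summxE -expr2 -sz (le_trans (cauchy_size _ _))//.
rewrite dotpZl dotpC dotpZl natrM.
have : n.+2%:R = n.+1%:R + 1 :> R by rewrite natr1.
have p0 : 0 < n.+1%:R :> R by rewrite ltr0n.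
move: (n.+1%:R : R) p0 H => p p0 H ->.
rewrite ler_pdivlMr ?mulr_gt0 ?addr_gt0//.
rewrite [leLHS](_ : _ = dotp S S + dotp S S / p); last by field; exact: lt0r_neq0.
by rewrite addrC lerD2r ler_pdivrMr// mulrC.
Qed.

(** Seen from [a], the midpoint is at distance at most d/2 and the n - 1 remaining vertices at most
    d. The squares sum to at most (1/4 + n - 1) d^2 and the vector sum has norm at most (n - 1/2) d;
    here 1/4 + (n - 1) + (n - 1/2)^2 = n^2 - 1/2. *)
Lemma smom_edge a b r d : (0 < n)%N -> size r = n.-1 -> 0 <= d ->
  dotp (b - a) (b - a) <= d ^+ 2 ->
  (forall P, P \in r -> dotp (P - a) (P - a) <= d ^+ 2) ->
  smom (a :: midpt a b :: r) a <= (n%:R ^+ 2 - 2^-1) / (n.+1 * n.+2)%:R * d ^+ 2.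
Proof.
move=> n0 sz d0 hb hr; rewrite /smom !big_cons subrr.
have -> : midpt a b - a = 2^-1 *: (b - a).
  rewrite /midpt scalerDr scalerBr [_ + 2^-1 *: b]addrC -addrA; congr (_ + _).
  by rewrite -[X in _ - X]scale1r -scalerBl -scaleNr; congr (_ *: _); field.
have hm : dotp (2^-1 *: (b - a)) (2^-1 *: (b - a)) <= (2^-1 * d) ^+ 2.
  rewrite dotpZl dotpC dotpZl mulrA -expr2 exprMn ler_wpM2l// sqr_ge0.
rewrite add0r -{1}[0 : point](subrr a) subrr.
have z0 : dotp (0 : point) 0 = 0 by rewrite /dotp big1// => i _; rewrite mxE mul0r.
rewrite z0 add0r.
have h1 : \sum_(P <- r) dotp (P - a) (P - a) <= (n%:R - 1) * d ^+ 2.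
  have -> : (n%:R - 1) * d ^+ 2 = \sum_(P <- r) d ^+ 2 :> R.
    rewrite big_const_seq count_predT iter_addr_0 sz -[RHS]mulr_natl.
    by rewrite -[in LHS](prednK n0) -natr1 addrK.
  by rewrite !big_seq; apply: ler_sum.
have h2 : dotp (\sum_(P <- r) (P - a)) (\sum_(P <- r) (P - a)) <= ((n%:R - 1) * d) ^+ 2.
  have := @dotp_sum_le [seq P - a | P <- r] d d0.
  rewrite big_map size_map sz (_ : n.-1%:R = n%:R - 1 :> R); last first.
    by rewrite -[in RHS](prednK n0) -natr1 addrK.
  by apply => u /mapP[P /hr H ->].
have n1 : 0 <= n%:R - 1 :> R by rewrite subr_ge0 ler1n.
have i0 : 0 <= 2^-1 :> R by rewrite invr_ge0.
have h3 := dotp_add_le (mulr_ge0 i0 d0) (mulr_ge0 n1 d0) hm h2.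
rewrite mulrAC ler_wpM2r ?invr_ge0//.
apply: le_trans (lerD (lerD hm h1) h3) _.
by rewrite le_eqVlt; apply/orP; left; apply/eqP; field.
Qed.

(** The squared distances to the barycenter sum to those of all ordered pairs of vertices divided by
    2 (n + 1), and only n (n + 1) of these pairs can contribute. Here [d] bounds squared
    distances. *)
Lemma smom_center s d : (forall P Q, P \in s -> Q \in s -> dotp (P - Q) (P - Q) <= d) ->
  size s = n.+1 -> smom s (mid s) <= n%:R / 2 * d / (n.+1 * n.+2)%:R.
Proof.
move=> H sz; have s0 : s != [::] by case: (s) sz.
have p0 : (n.+1%:R : R) != 0 by rewrite pnatr_eq0.
have S0 : \sum_(P <- s) (P - mid s) = 0.
  have := mid_sub_sum (mid s) s0; rewrite subrr => /esym/eqP.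
  by rewrite scaler_eq0 invr_eq0 sz (negbTE p0) => /eqP.
rewrite /smom S0 (_ : dotp 0 0 = 0) ?addr0; last first.
  by rewrite /dotp big1// => i _; rewrite mxE mul0r.
rewrite ler_wpM2r ?invr_ge0//.
set A := \sum_(P <- s) _.
have E : \sum_(P <- s) \sum_(Q <- s) dotp (P - Q) (P - Q) = 2 * n.+1%:R * A.
  have T (P Q : point) : dotp (P - Q) (P - Q) = dotp (P - mid s) (P - mid s)
      + dotp (Q - mid s) (Q - mid s) - 2 * dotp (Q - mid s) (P - mid s).
    have -> : P - Q = (P - mid s) - (Q - mid s) by rewrite opprB addrA subrK.
    exact: dotp_subsq.
  under eq_bigr do under eq_bigr do rewrite T.
  under eq_bigr => P _.
    rewrite sumrB big_split /= big_const_seq count_predT iter_addr_0 sz -mulr_sumr.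
    rewrite -dotp_suml S0 (_ : dotp 0 _ = 0); last by rewrite /dotp big1// => i _; rewrite mxE mul0r.
    rewrite mulr0 subr0 -[_ *+ _]mulr_natl. over.
  rewrite big_split /= -mulr_sumr big_const_seq count_predT iter_addr_0 sz -/A.
  by rewrite -[A *+ _]mulr_natl; ring.
have B : \sum_(P <- s) \sum_(Q <- s) dotp (P - Q) (P - Q) <= n.+1%:R * (n%:R * d).
  apply: (@le_trans _ _ (\sum_(P <- s) (n%:R * d))); last first.
    by rewrite big_const_seq count_predT iter_addr_0 sz -[_ *+ _]mulr_natl.
  rewrite [leLHS]big_seq [leRHS]big_seq; apply: ler_sum => P Ps.
  rewrite (perm_big _ (perm_to_rem Ps)) big_cons /= subrr (_ : dotp 0 0 = 0) ?add0r; last first.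
    by rewrite /dotp big1// => i _; rewrite mxE mul0r.
  apply: (@le_trans _ _ (\sum_(Q <- rem P s) d)).
    rewrite [leLHS]big_seq [leRHS]big_seq; apply: ler_sum => Q Qs.
    by rewrite H// (mem_rem Qs).
  by rewrite big_const_seq count_predT iter_addr_0 size_rem// sz -[_ *+ _]mulr_natl.
rewrite E in B; have pp : 0 < n.+1%:R :> R by rewrite ltr0n.
have : n.+1%:R * (2 * A) <= n.+1%:R * (n%:R * d) by rewrite mulrCA mulrA.
by rewrite ler_pM2l//; lra.
Qed.

End Dot.

                                                  

(** * The trace identity and the jump of means across one bisection *)

Section TreeAverages.
Context (R : realType).
Variable n : nat.
Notation point := 'rV[R]_n.
Notation tsimplex := (tsimplex R n).
Implicit Types (D T K : tsimplex) (P Q x : point) (t : btree).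
Hypothesis n0 : (0 < n)%N.

Local Notation ravg := (@tavg R n R^o).

Lemma ravgN q t1 t2 D :
  ravg q (Node t1 t2) D = (ravg q t1 (child1 D) + ravg q t2 (child2 D)) / 2.
Proof. exact: mulrC. Qed.

Lemma eq_ravg (q q' : tsimplex -> R) t D : (forall T, q T = q' T) -> ravg q t D = ravg q' t D.
Proof. by move=> /funext ->. Qed.

Lemma ravgD (q q' : tsimplex -> R) t D :
  ravg (fun T => q T + q' T) t D = ravg q t D + ravg q' t D.
Proof.
elim: t D => [//|t1 IH1 t2 IH2] D; rewrite !ravgN IH1 IH2; ring.
Qed.

Lemma ravgZ (q : tsimplex -> R) k t D : ravg (fun T => k * q T) t D = k * ravg q t D.
Proof.
elim: t D => [//|t1 IH1 t2 IH2] D; rewrite !ravgN IH1 IH2; ring.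
Qed.

Lemma ravg_sum (I : Type) (l : seq I) (q : I -> tsimplex -> R) t D :
  ravg (fun T => \sum_(i <- l) q i T) t D = \sum_(i <- l) ravg (q i) t D.
Proof.
elim: l => [|i l IH].
  rewrite big_nil -[RHS](mul0r (ravg (fun=> 0) t D)) -ravgZ.
  by apply: eq_ravg => T; rewrite big_nil mul0r.
rewrite big_cons -IH -ravgD; apply: eq_ravg => T; by rewrite big_cons.
Qed.

Lemma ravg_ge0 (q : tsimplex -> R) t D : (forall T, 0 <= q T) -> 0 <= ravg q t D.
Proof.
move=> q0; elim: t D => [//|t1 IH1 t2 IH2] D; rewrite ravgN.
by rewrite divr_ge0// addr_ge0.
Qed.

Lemma ravg_cs (p a b : tsimplex -> R) t D : (forall T, 0 <= a T) -> (forall T, 0 <= b T) ->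
  (forall T, p T ^+ 2 <= a T * b T) ->
  ravg p t D ^+ 2 <= ravg a t D * ravg b t D.
Proof.
move=> a0 b0 pab; elim: t D => [|t1 IH1 t2 IH2] D; first exact: pab.
have := cauchy_add (ravg_ge0 t1 (child1 D) a0) (ravg_ge0 t1 (child1 D) b0)
  (ravg_ge0 t2 (child2 D) a0) (ravg_ge0 t2 (child2 D) b0) (IH1 _) (IH2 _).
rewrite !ravgN; set u := _ + _; set v := ravg a _ _ + _; set w := ravg b _ _ + _ => H.
rewrite expr_div_n mulrACA -invfM -expr2 ler_wpM2r ?invr_ge0 ?sqr_ge0//.
Qed.

Variable f : paff R n.

Definition fmean T : R := aff (f T) (mid T.1).
(** The mean of (x - P) . grad f over [T], where the gradient is constant. *)
Definition gmom P T : R := dotp (mid T.1 - P) (f T).1.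
Definition gsq T : R := dotp (f T).1 (f T).1.

Lemma gsq_ge0 T : 0 <= gsq T. Proof. exact: dotp_ge0. Qed.

Lemma ravg_gmom_midpt a b t D :
  ravg (gmom (midpt a b)) t D = (ravg (gmom a) t D + ravg (gmom b) t D) / 2.
Proof.
rewrite -ravgD mulrC -ravgZ; apply: eq_ravg => T.
rewrite /gmom -dotpDl -dotpZl; congr (dotp _ _).
rewrite /midpt addrACA -opprD scalerBr; congr (_ - _).
by rewrite scalerDr -scalerDl -[LHS]scale1r; congr (_ *: _); field.
Qed.

Fixpoint matched t D : Prop :=
  if t is Node t1 t2 then
    [/\ savg f t1 (child1 D) (vfirst D) = savg f t2 (child2 D) (vlast D),
        matched t1 (child1 D) & matched t2 (child2 D)]
  else True.

Lemma compat_matched phi t D : locbdd phi -> wf D -> compat f phi t D -> matched t D.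
Proof.
move=> np; elim: t D => [//|t1 IH1 t2 IH2] D wD cD; have [cc1 cc2] := compat_node cD.
split; first exact: (savg_match n0 np wD cD).
  by apply: IH1 => //; exact: wf_child1.
by apply: IH2 => //; exact: wf_child2.
Qed.

                                                                                  
                                                                             
(** This is the divergence theorem for the field (x - P) f, whose normal component vanishes on the
    sides through [P]. On a leaf it holds because n times the barycenter of the opposite side is n +
    1 times that of the simplex minus [P]. At a node it is a linear combination of the identities of
    the children: [ravg_gmom_midpt] resolves those at the new vertex, and [matched] cancels the
    cutting side. *)
Lemma trace_identity t D P : wf D -> P \in D.1 -> matched t D ->
  n%:R * (ravg fmean t D - savg f t D P) = - ravg (gmom P) t D.
Proof.
elim: t D P => [|t1 IH1 t2 IH2] D P wD PD.
  move=> _; have [sz _] := wD.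
  rewrite /= /fmean /gmom aff_sub -dotpZl -dotpNl; congr (dotp _ _).
  have s0 : D.1 != [::] by case: (D.1) sz.
  have r0 : rem P D.1 != [::].
    by rewrite -size_eq0 size_rem// sz -lt0n.
  have nn : n%:R != 0 :> R by rewrite pnatr_eq0 -lt0n.
  have E : n%:R *: mid (rem P D.1) = n.+1%:R *: mid D.1 - P.
    rewrite /mid size_rem// sz /= !scalerA !mulfV ?pnatr_eq0 -?lt0n//.
    by rewrite !scale1r (perm_big _ (perm_to_rem PD)) big_cons /= addrAC subrr add0r.
  rewrite scalerBr E -natr1 scalerDl scale1r.
  by rewrite -addrA opprD addrA subrr sub0r.
move=> [mt m1 m2].
have [w1 w2] := (wf_child1 n0 wD, wf_child2 n0 wD).
have [ab a0 aN] := node_neq n0 wD.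
rewrite !ravgN [savg _ _ _ _]/=.
have a1 : vfirst D \in (child1 D).1 by rewrite !inE eqxx.
have b1 : vmid D \in (child1 D).1 by rewrite !inE eqxx orbT.
have a2 : vlast D \in (child2 D).1 by rewrite !inE eqxx.
have b2 : vmid D \in (child2 D).1 by rewrite !inE eqxx orbT.
have E1 := IH1 _ _ w1 a1 m1; have E1m := IH1 _ _ w1 b1 m1.
have E2 := IH2 _ _ w2 a2 m2; have E2m := IH2 _ _ w2 b2 m2.
rewrite ravg_gmom_midpt in E1m; rewrite ravg_gmom_midpt in E2m.
case: eqP => [->|/eqP P0]; first by rewrite mt in E1; lra.
case: eqP => [->|/eqP PN]; first by rewrite -mt in E2; lra.
have := PD; rewrite (perm_mem (wf_perm n0 wD)) !inE (negbTE P0) (negbTE PN) /= => Pr.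
have P1 : P \in (child1 D).1 by rewrite !inE Pr !orbT.
have P2 : P \in (child2 D).1 by rewrite (perm_mem (child2_perm D)) !inE Pr !orbT.
have F1 := IH1 _ _ w1 P1 m1; have F2 := IH2 _ _ w2 P2 m2.
by lra.
Qed.

Lemma ravg_dist_smom t D x : wf D ->
  ravg (fun T => dotp (mid T.1 - x) (mid T.1 - x)) t D <= smom D.1 x.
Proof.
elim: t D => [|t1 IH1 t2 IH2] D wD.
  by have [sz _] := wD; exact: smom_mid.
rewrite ravgN.
rewrite (smom_perm x (wf_perm n0 wD)) smom_bis.
rewrite -[midpt _ _]/(vmid D) -(smom_perm x (child2_perm D)).
by have := IH1 _ (wf_child1 n0 wD); have := IH2 _ (wf_child2 n0 wD); lra.
Qed.

Definition edge_const : R := (n%:R ^+ 2 - 2^-1) / (n.+1 * n.+2)%:R.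

Lemma edge_const_ge0 : 0 <= edge_const.
Proof.
rewrite divr_ge0// subr_ge0 -natrX; have : (1 : R) <= (n ^ 2)%:R by rewrite ler1n expn_gt0 n0.
by move=> H; apply: le_trans H; lra.
Qed.

Definition spread D (d : R) : Prop :=
  0 <= d /\ forall P Q, P \in D.1 -> Q \in D.1 -> dotp (P - Q) (P - Q) <= d ^+ 2.

(** The left side is the squared Haar coefficient of f at this node. The children share the cutting
    side, opposite [vfirst D] in one and [vlast D] in the other, so the difference of their trace
    identities contains only gradient terms. Cauchy-Schwarz bounds these by the second moments of
    [smom_edge]. *)
Lemma haar_step t1 t2 D d : wf D -> spread D d -> matched (Node t1 t2) D ->
  ((ravg fmean t1 (child1 D) - ravg fmean t2 (child2 D)) / 2) ^+ 2 <=
  edge_const / n%:R ^+ 2 * d ^+ 2 * ravg gsq (Node t1 t2) D.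
Proof.
move=> wD [d0 Hd] [mt m1 m2].
have [w1 w2] := (wf_child1 n0 wD, wf_child2 n0 wD).
have a1 : vfirst D \in (child1 D).1 by rewrite !inE eqxx.
have a2 : vlast D \in (child2 D).1 by rewrite !inE eqxx.
have E1 := trace_identity w1 a1 m1; have E2 := trace_identity w2 a2 m2.
rewrite mt in E1.
have pm := perm_mem (wf_perm n0 wD).
have X0D : vfirst D \in D.1 by rewrite pm !inE eqxx.
have XND : vlast D \in D.1 by rewrite pm !inE eqxx orbT.
have S1 : smom (child1 D).1 (vfirst D) <= edge_const * d ^+ 2.
  apply: smom_edge => //; first exact: size_vinner.
    exact: Hd.
  by move=> P Pr; apply: Hd => //; rewrite pm !inE Pr !orbT.
have S2 : smom (child2 D).1 (vlast D) <= edge_const * d ^+ 2.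
  rewrite (smom_perm _ (child2_perm D)) /vmid midptC.
  apply: smom_edge => //; first exact: size_vinner.
    exact: Hd.
  by move=> P Pr; apply: Hd => //; rewrite pm !inE Pr !orbT.
have Y t D' P : wf D' -> smom D'.1 P <= edge_const * d ^+ 2 ->
    ravg (gmom P) t D' ^+ 2 <= (edge_const * d ^+ 2) * ravg gsq t D'.
  move=> w' S.
  have := @ravg_cs (gmom P) (fun T => dotp (mid T.1 - P) (mid T.1 - P)) gsq t D'
    (fun T => dotp_ge0 _) gsq_ge0 (fun T => dotp_cs _ _).
  move=> /le_trans; apply; rewrite ler_wpM2r ?ravg_ge0//; first exact: gsq_ge0.
  exact: le_trans (ravg_dist_smom t P w') S.
have Y1 := Y t1 _ _ w1 S1; have Y2 := Y t2 _ _ w2 S2.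
have k0 : 0 <= edge_const * d ^+ 2 by rewrite mulr_ge0 ?sqr_ge0// edge_const_ge0.
have Y2' : (- ravg (gmom (vlast D)) t2 (child2 D)) ^+ 2 <= edge_const * d ^+ 2 * ravg gsq t2 (child2 D).
  by rewrite sqrrN.
have g1 : 0 <= ravg gsq t1 (child1 D) by apply: ravg_ge0; exact: gsq_ge0.
have g2 : 0 <= ravg gsq t2 (child2 D) by apply: ravg_ge0; exact: gsq_ge0.
have := cauchy_add k0 g1 k0 g2 Y1 Y2'.
rewrite ravgN.
set F1 := ravg fmean t1 _ in E1 *; set F2 := ravg fmean t2 _ in E2 *.
have -> : ravg (gmom (vfirst D)) t1 (child1 D) - ravg (gmom (vlast D)) t2 (child2 D) = - (n%:R * (F1 - F2)).
  by lra.
set G1 := ravg gsq t1 _; set G2 := ravg gsq t2 _ => H.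
have nn : 0 < n%:R :> R by rewrite ltr0n.
rewrite [leRHS](_ : _ = (edge_const * d ^+ 2 + edge_const * d ^+ 2) * (G1 + G2) / (4 * n%:R ^+ 2)); last first.
  by field; exact: lt0r_neq0.
rewrite ler_pdivlMr ?mulr_gt0 ?exprn_gt0//.
apply: le_trans H; rewrite le_eqVlt; apply/orP; left; apply/eqP.
by field.
Qed.

(** The exact mean of the squared affine piece over [T], as computed in [bint_aff2]. *)
Definition qmean T : R :=
  (\sum_(P <- T.1) aff (f T) P ^+ 2 + (\sum_(P <- T.1) aff (f T) P) ^+ 2) / (n.+1 * n.+2)%:R.

(** The left side is 1 / (n + 2) times the variance of the vertex values, to which [variance_range]
    applies. *)
Lemma leaf_variance T d : wf T -> spread T d ->
  qmean T - fmean T ^+ 2 <= (4 * n.+2%:R)^-1 * d ^+ 2 * gsq T.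
Proof.
move=> [sz _] [d0 Hd]; have s0 : T.1 != [::] by case: (T.1) sz.
rewrite /qmean /fmean aff_mid// sz natrM.
have H : forall P Q, P \in T.1 -> Q \in T.1 ->
    (aff (f T) P - aff (f T) Q) ^+ 2 <= d ^+ 2 * gsq T.
  move=> P Q PT QT; rewrite aff_sub (le_trans (dotp_cs _ _))//.
  by rewrite ler_wpM2r ?gsq_ge0// Hd.
have := variance_range s0 H; rewrite sz.
set A := \sum_(P <- T.1) aff _ _ ^+ 2; set S := \sum_(P <- T.1) aff _ _.
set G := gsq T.
have -> : n.+2%:R = n.+1%:R + 1 :> R by rewrite natr1.
have p0 : 0 < n.+1%:R :> R by rewrite ltr0n.
move: (n.+1%:R : R) p0 => p p0 L.
have q0 : 0 < p + 1 by rewrite addr_gt0.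
have -> : (A + S ^+ 2) / (p * (p + 1)) - (S / p) ^+ 2 = (A - S ^+ 2 / p) / (p * (p + 1)).
  by field; rewrite !lt0r_neq0.
rewrite ler_pdivrMr ?mulr_gt0//; apply: le_trans L _.
rewrite le_eqVlt; apply/orP; left; apply/eqP.
by field; rewrite lt0r_neq0.
Qed.

End TreeAverages.

                              

(** * The variance bound over the whole tree, and the inequality n <= M *)

Section Diameter.
Context (R : realType).
Variable n : nat.
Notation point := 'rV[R]_n.
Notation tsimplex := (tsimplex R n).
Implicit Types (D T K : tsimplex) (P Q x y : point) (t : btree).

Definition dists (A : set point) : set R :=
  [set d | exists x y, A x /\ A y /\ d = enorm (x - y)].

Lemma enorm_ge0 x : 0 <= enorm x. Proof. exact: sqrtr_ge0. Qed.

Lemma enorm_sq x : enorm x ^+ 2 = dotp x x.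
Proof. by rewrite sqr_sqrtr// dotp_ge0. Qed.

Lemma enorm_vbox r x : vbox r x -> enorm x <= Num.sqrt (n%:R * r ^+ 2).
Proof.
move=> /forallP H; rewrite ler_wsqrtr//.
apply: (@le_trans _ _ (\sum_(i < n) r ^+ 2)); last first.
  by rewrite sumr_const card_ord [leRHS]mulr_natl.
apply: ler_sum => i _; rewrite -expr2 -real_normK ?num_real//.
have := H i; have := normr_ge0 (x 0 i); nra.
Qed.

Lemma vbox_enorm x : vbox (enorm x) x.
Proof.
apply/forallP => i; rewrite -ler_sqr ?nnegrE ?enorm_ge0// enorm_sq real_normK ?num_real//.
by rewrite /dotp (bigD1 i)//= -expr2 lerDl sumr_ge0// => j _; rewrite -expr2 sqr_ge0.
Qed.

Lemma dists_ub (s : seq point) : uniq s -> has_ubound (dists (hull s)).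
Proof.
move=> us; have [r Hr] := hull_vbox us.
exists (Num.sqrt (n%:R * (r + r) ^+ 2)) => d [x [y [hx [hy ->]]]].
by apply: enorm_vbox; apply: vboxD; [exact: Hr|rewrite vboxN; exact: Hr].
Qed.

Lemma le_diam (s : seq point) x y : uniq s -> hull s x -> hull s y ->
  enorm (x - y) <= diam (hull s).
Proof.
move=> us hx hy; apply: (ub_le_sup (dists_ub us)); by exists x, y.
Qed.

Lemma diam_ge0 (s : seq point) : uniq s -> s != [::] -> 0 <= diam (hull s).
Proof.
move=> us s0; apply: le_trans (le_diam us (mid_hull us s0) (mid_hull us s0)).
exact: enorm_ge0.
Qed.

Hypothesis n0 : (0 < n)%N.
Local Notation ravg := (@tavg R n R^o).
Definition dia D : R := diam (hull D.1).

Lemma wf_nil D : wf D -> D.1 != [::].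
Proof. by move=> [sz _]; case: (D.1) sz. Qed.

Lemma spread_sub D D0 : wf D -> wf D0 -> hull D.1 `<=` hull D0.1 -> spread D (dia D0).
Proof.
move=> wD wD0 H; have [_ [us0 _]] := wD0; have [_ [us _]] := wD; split.
  by apply: diam_ge0 => //; exact: wf_nil.
move=> P Q PD QD; rewrite -enorm_sq ler_sqr ?nnegrE ?enorm_ge0//; last first.
  by apply: diam_ge0 => //; exact: wf_nil.
by apply: le_diam => //; apply: H; exact: mem_hull.
Qed.

Lemma desc1 D C : C \in bisect D -> C \in desc 1 D.
Proof. by rewrite bisectE /= !inE. Qed.

Lemma descS k D : desc k.+1 D = flatten [seq desc k C | C <- bisect D].
Proof. by []. Qed.

Lemma desc_trans i j K D D' : D \in desc i K -> D' \in desc j D -> D' \in desc (i + j) K.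
Proof.
elim: i K => [|i IH] K; first by rewrite inE => /eqP ->.
rewrite addSn !descS => /flatten_mapP[C CK DC] D'D; apply/flatten_mapP.
by exists C => //; exact: IH.
Qed.

Lemma desc_wf i K D : wf K -> D \in desc i K -> wf D /\ hull D.1 `<=` hull K.1.
Proof.
elim: i K => [|i IH] K wK; first by rewrite inE => /eqP ->; split.
rewrite descS => /flatten_mapP[C]; rewrite bisectE !inE => CK DC.
have [wC hC] : wf C /\ hull C.1 `<=` hull K.1.
  move: CK => /orP[/eqP ->|/eqP ->]; split; first exact: wf_child1.
  - by move=> x hx; apply/hull_node => //; left.
  - exact: wf_child2.
  - by move=> x hx; apply/hull_node => //; right.
have [wD hD] := IH _ wC DC; split => // x /hD; exact: hC.
Qed.

Section VarBound.
Variables (f : paff R n) (Tr : seq tsimplex) (M : nat) (K : tsimplex).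
Hypotheses (hM : halving Tr M) (KTr : K \in Tr) (n2 : (2 <= n)%N) (nM : (n <= M)%N).
Hypothesis wK : wf K.

Definition haar_const : R := edge_const R n / n%:R ^+ 2.

(** The variance inside a leaf costs no more than 1 + n/3 Haar levels, and the budget M - r + M/3 of
    [var_bound] still holds that much when r < M and n <= M. *)
Lemma haar_const_leaf : (4 * n.+2%:R)^-1 <= haar_const * (1 + n%:R / 3).
Proof.
rewrite /haar_const /edge_const natrM.
have : n.+1%:R = n%:R + 1 :> R by rewrite natr1.
have : n.+2%:R = n%:R + 2 :> R by rewrite -addn2 natrD.
have : 2 <= n%:R :> R by rewrite ler_nat.
move: (n%:R : R) (n.+1%:R : R) (n.+2%:R : R) => p ? ? p2 -> ->.
have h1 : 0 < p by lra.
have h2 : 0 < p + 1 by lra.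
have h3 : 0 < p + 2 by lra.
rewrite -subr_ge0.
have -> : (p ^+ 2 - 2^-1) / ((p + 1) * (p + 2)) / p ^+ 2 * (1 + p / 3) - (4 * (p + 2))^-1 =
   (4 * (p ^+ 2 - 2^-1) * (3 + p) - 3 * p ^+ 2 * (p + 1)) / (12 * (p + 2) * (p + 1) * p ^+ 2).
  by field; rewrite !lt0r_neq0.
apply: divr_ge0; last by rewrite !mulr_ge0 ?sqr_ge0// ltW.
have : 0 <= (p - 2) * p ^+ 2 by rewrite mulr_ge0 ?sqr_ge0// subr_ge0.
have : 0 <= (p - 2) * p by rewrite mulr_ge0 ?subr_ge0// ltW.
nra.
Qed.

Lemma haar_const_ge0 : 0 <= haar_const.
Proof. by rewrite divr_ge0 ?sqr_ge0// edge_const_ge0. Qed.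

(** [D0] is the ancestor whose diameter measures the current scale and [D] lies [r] bisections below
    it. The summand M - r pays for the levels left at this scale, one Haar step each; M/3 pays for
    all finer scales, where squared diameters shrink geometrically by 1/4. *)
Lemma var_bound t D D0 k0 r : D0 \in desc k0 K -> D \in desc r D0 -> (r < M)%N ->
  matched f t D ->
  ravg (qmean f) t D - ravg (fmean f) t D ^+ 2 <=
  haar_const * (M%:R - r%:R + M%:R / 3) * dia D0 ^+ 2 * ravg (gsq f) t D.
Proof.
have g0 t' D' : 0 <= ravg (gsq f) t' D' by apply: ravg_ge0; exact: gsq_ge0.
elim: t D D0 k0 r => [|t1 IH1 t2 IH2] D D0 k0 r D0K DD0 rM mD.
  have [wD0 _] := desc_wf wK D0K; have [wD hD] := desc_wf wD0 DD0.
  apply: le_trans (leaf_variance f wD (spread_sub wD wD0 hD)) _.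
  rewrite ler_wpM2r ?gsq_ge0// ler_wpM2r ?sqr_ge0//.
  apply: le_trans haar_const_leaf _; rewrite ler_wpM2l ?haar_const_ge0//.
  have : r%:R + 1 <= M%:R :> R by rewrite natr1 ler_nat.
  have : n%:R <= M%:R :> R by rewrite ler_nat.
  by lra.
have [wD0 _] := desc_wf wK D0K; have [wD hD] := desc_wf wD0 DD0.
have HS := haar_step n0 wD (spread_sub wD wD0 hD) mD; have [_ m1 m2] := mD.
have step C t' : C \in bisect D -> (forall D0' k0' r', D0' \in desc k0' K -> C \in desc r' D0' ->
     (r' < M)%N -> ravg (qmean f) t' C - ravg (fmean f) t' C ^+ 2 <=
     haar_const * (M%:R - r'%:R + M%:R / 3) * dia D0' ^+ 2 * ravg (gsq f) t' C) ->
   ravg (qmean f) t' C - ravg (fmean f) t' C ^+ 2 <=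
     haar_const * (M%:R - r%:R - 1 + M%:R / 3) * dia D0 ^+ 2 * ravg (gsq f) t' C.
  move=> CD H; have CD0 := desc_trans DD0 (desc1 CD).
  have [rM1|Mr1] := ltnP (r + 1) M.
    apply: le_trans (H D0 k0 (r + 1)%N D0K CD0 rM1) _.
    by rewrite natrD opprD !addrA.
  (* The scale is used up: the child becomes the new reference with at most half the diameter, and
     its full budget (M + M/3) / 4 is exactly the remaining M/3. *)
  have E : (r + 1)%N = M by apply/eqP; rewrite eqn_leq Mr1 addn1 rM.
  rewrite E in CD0.
  have hC := hM KTr D0K CD0.
  have CK := desc_trans D0K CD0.
  have [wC _] := desc_wf wK CK.
  have C0 : 0 <= dia C by apply: diam_ge0; [have [_ []] := wC|exact: wf_nil].
  apply: le_trans (H C _ 0%N CK _ _) _; rewrite ?inE//; first by rewrite -E addn1.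
  rewrite ler_wpM2r ?g0// -[leLHS]mulrA -[leRHS]mulrA ler_wpM2l ?haar_const_ge0//.
  have -> : M%:R - r%:R - 1 + M%:R / 3 = M%:R / 3 :> R by rewrite -E natrD; ring.
  rewrite subr0; have : dia C ^+ 2 <= (dia D0 / 2) ^+ 2.
    by rewrite ler_sqr ?nnegrE// (le_trans C0).
  have : 0 <= M%:R :> R by [].
  rewrite expr_div_n => M0 h; rewrite [leRHS](_ : _ = (M%:R + M%:R / 3) * (dia D0 ^+ 2 / 2 ^+ 2)).
    by rewrite ler_wpM2l// addr_ge0// divr_ge0.
  by field.
have B1 := step (child1 D) t1 _ (fun D0' k0' r' h1 h2 h3 => IH1 _ D0' k0' r' h1 h2 h3 m1).
have B2 := step (child2 D) t2 _ (fun D0' k0' r' h1 h2 h3 => IH2 _ D0' k0' r' h1 h2 h3 m2).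
move: {B1 B2} (B1 (mem_head _ _)) (B2 (mem_last _ [:: child2 D])) HS.
rewrite -/haar_const !ravgN.
set d := dia D0 ^+ 2; set F1 := ravg (fmean f) t1 _; set F2 := ravg (fmean f) t2 _.
set Q1 := ravg (qmean f) t1 _; set Q2 := ravg (qmean f) t2 _.
set G1 := ravg (gsq f) t1 _; set G2 := ravg (gsq f) t2 _.
move: (M%:R - r%:R : R) (M%:R / 3 : R) => A B B1 B2 HS.
(* The law of total variance for two halves of equal volume. *)
have -> : (Q1 + Q2) / 2 - ((F1 + F2) / 2) ^+ 2 =
  ((Q1 - F1 ^+ 2) + (Q2 - F2 ^+ 2)) / 2 + ((F1 - F2) / 2) ^+ 2 by field.
have -> : haar_const * (A + B) * d * ((G1 + G2) / 2) =
  (haar_const * (A - 1 + B) * d * G1 + haar_const * (A - 1 + B) * d * G2) / 2 + haar_const * d * ((G1 + G2) / 2).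
  by field.
by lra.
Qed.

End VarBound.

Definition vol D : R := rint (ind (hull D.1)).

Lemma vol_gt0 D : wf D -> 0 < vol D.
Proof.
move=> [sz fs]; have [c c0 H] := rint_hull fs sz.
have := H _ (@locbdd_cst R n 1); rewrite bint_cst mul1r.
rewrite (@eq_rint _ _ _ (ind (hull D.1))); last by move=> x; rewrite mulr1.
by rewrite -/(vol D) => ->; rewrite mulr_gt0 ?Vol_gt0.
Qed.

Lemma vol_child1 D : wf D -> vol (child1 D) = vol D / 2.
Proof.
move=> wD; have [sz fs] := wD; have [c c0 H] := rint_hull fs sz.
have fn := wf_free n0 wD; have fn' := afree_perm (perm_swap2 _ _ _) fn.
have w1 := wf_child1 n0 wD; have [sz1 fs1] := w1; have [us1 _] := fs1.
have n1 : locbdd (ind (hull (child1 D).1)) by exact: (locbdd_ind fs1 sz1).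
have V : vol D = c * Vol R n.
  have := H _ (@locbdd_cst R n 1); rewrite bint_cst mul1r => <-.
  by apply: eq_rint => x; rewrite mulr1.
have V1 : vol (child1 D) = c * bint n D.1 (ind (hull (child1 D).1)).
  rewrite -(H _ n1); apply: eq_rint => x; rewrite /ind; case: asboolP => h; last by rewrite mulr0.
  by case: asboolP => [_|[]]; [rewrite mulr1|apply/hull_node => //; left].
have e1 s' : uniq s' -> size s' = n.+1 -> bint n s' (fun=> 1) = Vol R n by rewrite bint_cst mul1r.
rewrite V1 V -mulrA; congr (_ * _).
rewrite (bint_perm fs sz (wf_perm n0 wD) n1).
have := bint_bisect fn n1; rewrite size_vinner prednK// => ->; congr (_ / _).
rewrite -[_ :: midpt _ _ :: _]/(child1 D).1.
rewrite (@eq_bint _ _ n (child1 D).1 _ (fun=> 1) fs1 sz1); last first.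
  by move=> x hx; rewrite /ind; case: asboolP.
rewrite bint_cst mul1r.
have fs2 := afree_bis2 fn; have [us2 _] := fs2.
rewrite (@bint_interior _ _ n _ _ (fun=> 0) us2)//; last 2 first.
- exact: locbdd_cst.
- move=> x w wx wp; rewrite /ind; case: asboolP => // h1.
  have := @interior_bis _ _ _ _ (vinner D) x w fn'; rewrite midptC => /(_ wx wp).
  by move=> /(_ h1).
- by rewrite bint_cst mul0r addr0.
Qed.

(** The simplex lies in the cube of half-width [dia D] around its vertex [vfirst D]. *)
Lemma vol_le D : wf D -> vol D <= (2 * dia D) ^+ n.
Proof.
move=> wD; have [sz fs] := wD; have [us _] := fs.
have d0 : 0 <= dia D by apply: diam_ge0 => //; exact: wf_nil.
have ni : bsupp (ind (hull D.1)).
  have := bsupp_hull fs sz (@locbdd_cst R n 1).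
  by under eq_fun do rewrite mulr1.
rewrite -(rint_box n d0) /vol -(rint_shift (vfirst D) ni).
have XD : hull D.1 (vfirst D) by apply: mem_hull => //; rewrite mem_nth// sz.
apply: le_rint; [exact: bsupp_shift|exact: bsupp_box|] => x.
rewrite /ind; case: asboolP => // h.
suff -> : vbox (dia D) x by [].
apply: vbox_le (vbox_enorm x).
have -> : x = (vfirst D + x) - vfirst D by rewrite addrAC subrr add0r.
exact: le_diam.
Qed.

(** Along the chain of [child1], k M bisections divide the volume by 2^(kM) and the diameter by at
    least 2^k. With [vol_le], the assumption M < n would bound [vol K] by a constant times 2^(-k)
    for every k, contradicting its positivity. *)
Lemma halving_ge Tr M K : halving Tr M -> K \in Tr -> wf K -> (n <= M)%N.
Proof.
move=> hM KTr wK; rewrite leqNgt; apply/negP => Mn.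
have IT k D : wf D -> iter k (@child1 R n) D \in desc k D /\ vol (iter k (@child1 R n) D) = vol D / 2 ^+ k.
  move=> wD; elim: k => [|k [IH1 IH2]]; first by rewrite inE expr0 divr1.
  have [w' _] := desc_wf wD IH1.
  split; last by rewrite iterS vol_child1// IH2 exprSr; field; rewrite expf_neq0.
  rewrite -addn1; apply: desc_trans IH1 _; rewrite addn1 iterS.
  by apply: desc1; rewrite bisectE mem_head.
have dk k : dia (iter (k * M) (@child1 R n) K) <= dia K / 2 ^+ k.
  elim: k => [|k IH]; first by rewrite expr0 divr1.
  rewrite mulSn iterD.
  have [A _] := IT (k * M)%N K wK.
  have [w' _] := desc_wf wK A.
  have [B _] := IT M _ w'.
  have HM := hM _ KTr _ _ A _ B; rewrite -!/(dia _) in HM; apply: le_trans HM _.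
  have -> : dia K / 2 ^+ k.+1 = dia K / 2 ^+ k / 2.
    by rewrite exprSr; field; rewrite expf_neq0.
  by rewrite ler_pM2r.
have key k : vol K * 2 ^+ k <= (2 * dia K) ^+ n.
  have [A VA] := IT (k * M)%N K wK; have [w' _] := desc_wf wK A.
  have := vol_le w'; rewrite VA => H.
  have d0 : 0 <= dia (iter (k * M) (@child1 R n) K).
    by apply: diam_ge0; [have [_ []] := w'|exact: wf_nil].
  have H2 : vol K / 2 ^+ (k * M) <= (2 * (dia K / 2 ^+ k)) ^+ n.
    have e0 := le_trans d0 (dk k).
    apply: le_trans H _; apply: lerXn2r; rewrite ?nnegrE; try exact: mulr_ge0.
    by rewrite ler_pM2l.
  have p2 j : 0 < 2 ^+ j :> R by rewrite exprn_gt0.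
  rewrite mulrA expr_div_n -exprM ler_pdivlMr// in H2.
  apply: le_trans H2; rewrite -mulrA ler_pM2l ?vol_gt0//.
  rewrite mulrC ler_pdivlMr// -exprD ler_weXn2l ?ler1n//.
  by rewrite -mulnS leq_mul2l Mn orbT.
have v0 := vol_gt0 wK.
pose B := (2 * dia K) ^+ n / vol K.
have := key (Num.truncn B).+1; rewrite mulrC -ler_pdivlMr// -/B; apply/negP; rewrite -ltNge.
apply: lt_le_trans (truncnS_gt _) _.
by rewrite -natrX ler_nat ltnW// ltn_expl.
Qed.

End Diameter.

                                                              

(** * Volume and side integrals of the statement in terms of [rint] and [bint] *)

Section IteratedIntegrals.
Context (R : realType).
Local Notation RR := (measurableTypeR R).

Lemma iint_tint m (F : (nat -> R) -> \bar R) :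
  iint m F = tint (fun t : m.-tuple RR => F (nth 0 t)).
Proof.
elim: m F => [|m IH] F /=; first by congr F; apply/funext => i; rewrite nth_nil.
apply: eq_integral => x _; rewrite IH; apply: eq_tint => t; congr F.
by apply/funext => -[|i].
Qed.

Lemma integral_overE n (A : set 'rV[R]_n) f :
  integral_over A f = rint (fun x => ind A x * f x).
Proof.
rewrite /integral_over iint_tint /rint /erint; congr fine; apply: eq_tint => t.
rewrite (_ : \row_(i < n) nth 0 t i = row_t t); last first.
  by apply/rowP => i; rewrite !mxE (tnth_nth 0).
by rewrite /ind /=; case: ifP => _; rewrite ?mul1r ?mul0r.
Qed.

Lemma side_integralE n (E : seq 'rV[R]_n) f :
  side_integral E f =
  Num.sqrt (\det (lin n.-1 E *m (lin n.-1 E)^T)) * bint n.-1 E f.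
Proof.
rewrite /side_integral; congr (Num.sqrt (\det (_ *m _)) * _).
rewrite iint_tint /bint /rint /erint; congr fine; apply: eq_tint => t.
have rE i : nth 0 t (i : 'I_n.-1) = row_t t 0 i by rewrite mxE (tnth_nth 0).
have -> : nth 0 E 0 + \sum_(i < n.-1) nth 0 t i *: (nth 0 E i.+1 - nth 0 E 0) =
    par E (row_t t).
  rewrite /par mulmx_sum_row; congr (_ + _); apply: eq_bigr => i _.
  by rewrite rE rowK.
rewrite (_ : `[< _ >] = corner (row_t t)).
  by case: corner; rewrite ?mul1r ?mul0r.
apply/asboolP/andP => [[H1 H2]|[/forallP H1 H2]]; split.
- by apply/forallP => i; rewrite -rE H1.
- by under eq_bigr do rewrite -rE.
- by move=> i il; have := H1 (Ordinal il); rewrite -rE.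
- by under eq_bigr do rewrite rE.
Qed.

(** A kernel vector v satisfies (1 - t)|v|^2 + t|vA|^2 = 0 with both terms nonnegative. *)
Lemma posdef_unit m n (A : 'M[R]_(m, n)) (t : R) : row_free A -> 0 <= t <= 1 ->
  (1 - t)%:M + t *: (A *m A^T) \in unitmx.
Proof.
move=> fA /andP[t0 t1]; rewrite -row_free_unit.
apply: inj_row_free => v vA.
have dE k (u : 'rV[R]_k) : (u *m u^T) 0 0 = dotp u u.
  by rewrite mxE; apply: eq_bigr => i _; rewrite [in LHS]mxE.
have : (1 - t) * dotp v v + t * dotp (v *m A) (v *m A) = 0.
  have : (v *m ((1 - t)%:M + t *: (A *m A^T)) *m v^T) 0 0 = 0.
    by rewrite vA mul0mx mxE.
  have dA : (v *m (A *m A^T) *m v^T) 0 0 = dotp (v *m A) (v *m A).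
    by rewrite -dE trmx_mul !mulmxA.
  rewrite mulmxDr mul_mx_scalar -scalemxAr mulmxDl -!scalemxAl.
  have lin2 (a b : R) (X Y : 'M[R]_1) : (a *: X + b *: Y) 0 0 = a * X 0 0 + b * Y 0 0.
    by rewrite !mxE.
  by rewrite lin2 dE dA.
have p1 : 0 <= (1 - t) * dotp v v by rewrite mulr_ge0 ?subr_ge0// dotp_ge0.
have p2 : 0 <= t * dotp (v *m A) (v *m A) by rewrite mulr_ge0 ?dotp_ge0.
have z k (u : 'rV[R]_k) : dotp u u = 0 -> u = 0.
  move=> /eqP; rewrite psumr_eq0; last by move=> i _; rewrite -expr2 sqr_ge0.
  move=> /allP H; apply/rowP => i.
  by have := H i (mem_index_enum _); rewrite /= mulf_eq0 orbb mxE => /eqP.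
move=> /eqP; rewrite paddr_eq0// !mulf_eq0 => /andP[/orP[t'|/eqP/z//] /orP[/eqP t''|/eqP/z vA0]].
  by move: t'; rewrite t'' subr0 oner_eq0.
by apply: (row_free_inj fA); rewrite vA0 mul0mx.
Qed.

                                                                                
(** On the segment from the identity to the Gram matrix the determinant is a polynomial in the
    parameter that starts at 1 and, by [posdef_unit], has no root; the intermediate value theorem
    keeps it positive. *)
Lemma gram_gt0 m n (A : 'M[R]_(m, n)) : row_free A -> 0 < \det (A *m A^T).
Proof.
move=> fA; set G := A *m A^T.
pose q : {poly R} := \det ((1 - 'X)%:M + 'X *: map_mx polyC G).
have qE t : q.[t] = \det ((1 - t)%:M + t *: G).
  rewrite -[LHS]/(horner_eval t q) -det_map_mx; congr (\det _); apply/matrixP => i j.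
  rewrite !mxE; set g := \sum_k _.
  rewrite -[LHS]/(((1 - 'X) *+ (i == j) + 'X * g%:P).[t]).
  by rewrite hornerD hornerMn !hornerE.
rewrite ltNge; apply/negP => G0.
have [t t01] : exists2 t, 0 <= t <= 1 & root (- q) t.
  apply: poly_ivt; first exact: ler01.
  by rewrite !hornerN !qE subr0 subrr !scale0r scale1r addr0 det1 raddf0 add0r
    oppr_le0 ler01 oppr_ge0.
rewrite rootN /root qE; apply/negP.
by rewrite -unitfE -unitmxE posdef_unit.
Qed.

(** The Gram factor is nonzero and cancels between the integral and the measure of the side. *)
Lemma side_meanE n (E : seq 'rV[R]_n) f : afree E -> size E = n.-1.+1 ->
  side_mean E f = bint n.-1 E f / Vol R n.-1.
Proof.
move=> fE sz; rewrite /side_mean !side_integralE bint_cst mul1r.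
rewrite -mulf_div divff ?mul1r// sqrtr_eq0 -ltNge.
by apply: gram_gt0; exact: row_free_lin.
Qed.

End IteratedIntegrals.

(** * Which fine simplex [piece] selects, in the interior and on sides *)

Section Pieces.
Context (R : realType).
Variable n : nat.
Notation point := 'rV[R]_n.
Notation tsimplex := (tsimplex R n).
Implicit Types (D T K : tsimplex) (P Q x : point).

Definition inpiece K x T : bool := `[< hull T.1 `<=` hull K.1 /\ hull T.1 x >].

(** Generalises [evalK] to any quantity attached to the simplices; the squared gradient is the other
    instance. *)
Definition sel (Phi : tsimplex -> point -> R) (L : seq tsimplex) K x : R :=
  if piece L K x is Some T then Phi T x else 0.

Lemma piece_cons T L K x :
  piece (T :: L) K x = if inpiece K x T then Some T else piece L K x.
Proof. by rewrite /piece -!/(inpiece K x) /=; case: (inpiece K x T). Qed.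

Lemma locbdd_sel (Phi : tsimplex -> point -> R) L K :
  (forall T, T \in L -> wf T) -> (forall T, locbdd (Phi T)) -> locbdd (sel Phi L K).
Proof.
move=> + nPhi; elim: L => [|T L IH] wL.
  by rewrite /sel /piece /=; exact: locbdd_cst.
rewrite (_ : sel _ _ _ = fun x => if inpiece K x T then Phi T x else sel Phi L K x).
  apply: locbdd_if => //; last by apply: IH => S SL; apply: wL; rewrite inE SL orbT.
  have [sz fT] := wL T (mem_head _ _).
  have [TK|TK] := pselect (hull T.1 `<=` hull K.1).
    rewrite (_ : (fun x => _) = ind (hull T.1)); first exact: (rmeas_hull fT sz).
    apply/funext => x; congr (nat_of_bool _)%:R; apply: asbool_equiv_eq.
    by split => [[]|].
  rewrite (_ : (fun x => _) = fun=> 0); first by have [] := @locbdd_cst R n 0.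
  by apply/funext => x; rewrite /inpiece; case: asboolP => // -[].
by apply/funext => x; rewrite /sel piece_cons; case: ifP.
Qed.

Lemma filter_perm (s s' : seq point) : uniq s -> uniq s' -> {subset s <= s'} ->
  size s = size s' -> perm_eq s s'.
Proof.
move=> us us' ss sz; apply: uniq_perm => //.
by have [] := uniq_min_size us ss _; rewrite ?sz.
Qed.

Lemma bint_aff_gt0 m (s : seq point) (gc : point * R) : (0 < m)%N -> afree s ->
  size s = m.+1 -> bint m s (aff gc) = Vol R m * aff gc (mid s).
Proof. by case: m => // k _; exact: bint_aff. Qed.

Lemma bint_aff2_gt0 m (s : seq point) (gc : point * R) : (0 < m)%N -> afree s ->
  size s = m.+1 -> bint m s (fun x => aff gc x ^+ 2) =
  Vol R m * ((\sum_(P <- s) aff gc P ^+ 2 + (\sum_(P <- s) aff gc P) ^+ 2)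
             / (m.+1 * m.+2)%:R).
Proof. by case: m => // k _; exact: bint_aff2. Qed.

Section Conforming.
Variable L : seq tsimplex.
Hypothesis wL : forall T, T \in L -> wf T.
Hypothesis cL : forall T T', T \in L -> T' \in L -> T != T' ->
  ~~ perm_eq T.1 T'.1 /\
  hull T.1 `&` hull T'.1 = hull [seq P <- T.1 | P \in T'.1].

(** Conformity puts [x] in the hull of the common vertices of [T] and [T'], and [pos_weights_sub]
    then places all of [E] among these. *)
Lemma face_sub T T' (E : seq point) x w : T \in L -> T' \in L -> uniq E ->
  {subset E <= T.1} -> weights E w x -> (forall P, P \in E -> 0 < w P) ->
  hull T'.1 x -> {subset E <= T'.1}.
Proof.
move=> TL T'L uE ET wx wp hx.
have [<-//|TT'] := eqVneq T T'.
have [_ fT] := wL TL; have [uT _] := fT.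
have [_ E0] := cL TL T'L TT'.
have hxT : hull T.1 x.
  apply: (hull_sub uE uT ET); apply/hullP => //.
  exists (fun P => if P \in E then w P else 0); split.
    by move=> P; case: ifP => // /wp /ltW.
  exact: weights_sub.
have hf : hull [seq P <- T.1 | P \in T'.1] x by rewrite -E0.
have fs : {subset [seq P <- T.1 | P \in T'.1] <= T.1}.
  by move=> P; rewrite mem_filter => /andP[].
move=> P PE; have := pos_weights_sub fT uE (filter_uniq _ uT) ET fs wx wp hf PE.
by rewrite mem_filter => /andP[].
Qed.

Lemma piece_mem K x T : piece L K x = Some T ->
  [/\ T \in L, hull T.1 `<=` hull K.1 & hull T.1 x].
Proof.
rewrite /piece; case: ifP => // h [<-].
have := nth_find K h; move/asboolP => [h1 h2]; split => //.
by rewrite mem_nth// -has_find.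
Qed.

Lemma piece_ex K x T : T \in L -> hull T.1 `<=` hull K.1 -> hull T.1 x ->
  exists T', piece L K x = Some T'.
Proof.
move=> TL TK Tx; rewrite /piece; case: ifPn => [h|/hasPn /(_ T TL)]; first by eexists.
by move=> /asboolPn[].
Qed.

Lemma piece_interior K T x w : T \in L -> hull T.1 `<=` hull K.1 ->
  weights T.1 w x -> (forall P, P \in T.1 -> 0 < w P) -> piece L K x = Some T.
Proof.
move=> TL TK wx wp; have [sT [uT _]] := wL TL.
have hx : hull T.1 x.
  apply/hullP => //; exists (fun P => if P \in T.1 then w P else 0); split.
    by move=> P; case: ifP => // /wp /ltW.
  exact: weights_sub.
have [T' pT'] := piece_ex TL TK hx; rewrite pT'; congr Some.
have [T'L _ T'x] := piece_mem pT'.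
apply/eqP; apply: contraT; rewrite eq_sym => TT'.
have [/negP + _] := cL TL T'L TT'; case.
have [sT' [uT' _]] := wL T'L.
apply: filter_perm => //; last by rewrite sT sT'.
exact: (face_sub TL T'L uT _ wx wp T'x).
Qed.

Lemma piece_face K T (E : seq point) : T \in L -> hull T.1 `<=` hull K.1 -> uniq E ->
  E != [::] -> {subset E <= T.1} ->
  exists T0, [/\ T0 \in L, {subset E <= T0.1} &
    forall x w, weights E w x -> (forall P, P \in E -> 0 < w P) -> piece L K x = Some T0].
Proof.
move=> TL TK uE E0 ET; have [sT [uT _]] := wL TL.
pose q T' := `[< hull T'.1 `<=` hull K.1 >] && all (mem T'.1) E.
have qT : has q L.
  by apply/hasP; exists T => //; apply/andP; split; [exact/asboolP|exact/allP].
exists (nth K L (find q L)); split.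
- by rewrite mem_nth// -has_find.
- by have /andP[_ /allP] := nth_find K qT.
move=> x w wx wp.
have pq : {in L, inpiece K x =1 q}.
  move=> T' T'L; apply/asboolP/andP => [[h1 h2]|[/asboolP h1 /allP h2]].
    by split; [exact/asboolP|apply/allP; exact: (face_sub TL T'L uE ET wx wp h2)].
  split => //; have [_ [uT' _]] := wL T'L.
  apply: (hull_sub uE uT') => //; apply/hullP => //.
  exists (fun P => if P \in E then w P else 0); split.
    by move=> P; case: ifP => // /wp /ltW.
  exact: weights_sub.
by rewrite /piece -/(inpiece K x) (eq_in_has pq) (eq_in_find pq) qT.
Qed.

Lemma sides_rem (s : seq point) Q : uniq s -> Q \in s -> rem Q s \in sides s.
Proof.
move=> us Qs; apply/mapP; exists (index Q s); first by rewrite mem_iota index_mem.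
rewrite rem_filter// -{1}(mkseq_nth 0 s) /mkseq filter_map; congr map.
apply: eq_in_filter => j; rewrite mem_iota add0n /= => js.
by rewrite -{1}(nth_index 0 Qs) nth_uniq// index_mem.
Qed.

Lemma mid_perm (s s' : seq point) : perm_eq s s' -> mid s = mid s'.
Proof. by move=> ps; rewrite /mid (perm_size ps) (perm_big _ ps). Qed.

Hypothesis n2 : (2 <= n)%N.

(** On the side, [sel] follows the affine piece of a single simplex [T0], possibly the neighbour of
    [T]. Its mean is its value at the barycenter of the side, where the Crouzeix-Raviart condition
    equates it with the value from [T]. *)
Lemma bint_side v K T Q : CR0 L v -> T \in L -> hull T.1 `<=` hull K.1 -> Q \in T.1 ->
  bint n.-1 (rem Q T.1) (sel (fun T => aff (v T)) L K) =
  Vol R n.-1 * aff (v T) (mid (rem Q T.1)).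
Proof.
move=> cr TL TK QT; have [sT fT] := wL TL; have [uT _] := fT.
have fE := afree_rem Q fT; have [uE _] := fE.
have sE : size (rem Q T.1) = n.-1.+1.
  by rewrite size_rem// sT /= prednK// ltnW.
have E0 : rem Q T.1 != [::] by case: (rem Q T.1) sE.
have ET : {subset rem Q T.1 <= T.1} by exact: mem_rem.
have [T0 [T0L ET0 H]] := piece_face TL TK uE E0 ET.
have -> : aff (v T) (mid (rem Q T.1)) = aff (v T0) (mid (rem Q T.1)).
  have [->//|TT0] := eqVneq T T0.
  have [sT0 [uT0 _]] := wL T0L.
  have [Q0 Q0T Q0E] : exists2 Q0, Q0 \in T0.1 & Q0 \notin rem Q T.1.
    apply/hasP; apply: contraT => /hasPn h.
    have sub : {subset T0.1 <= rem Q T.1} by move=> P /h; rewrite negbK.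
    by have := uniq_leq_size uT0 sub; rewrite sE sT0 prednK ?ltnn// ltnW.
  have ps : perm_eq (rem Q T.1) (rem Q0 T0.1).
    apply: filter_perm => //; first exact: rem_uniq.
      move=> P PE; rewrite mem_rem_uniq// !inE ET0// andbT.
      by apply: contraNneq Q0E => <-.
    by rewrite sE size_rem// sT0 /= prednK// ltnW.
  have [c _] := cr T TL _ (sides_rem uT QT).
  by rewrite (c T0 T0L _ _ (sides_rem uT0 Q0T) ps) ?(mid_perm ps)// eq_sym.
have nv : locbdd (sel (fun T => aff (v T)) L K).
  by apply: locbdd_sel => // S; exact: locbdd_aff.
rewrite (bint_interior uE sE nv (locbdd_aff (v T0))); last first.
  by move=> x w wx wp; rewrite /sel (H x w wx wp).
by apply: bint_aff_gt0 => //; rewrite -ltnS prednK// ltnW.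
Qed.

Lemma bint_piece (Phi : tsimplex -> point -> R) K T : (forall S, locbdd (Phi S)) ->
  T \in L -> hull T.1 `<=` hull K.1 ->
  bint n T.1 (sel Phi L K) = bint n T.1 (Phi T).
Proof.
move=> nP TL TK; have [sT [uT _]] := wL TL.
apply: bint_interior => //; first exact: locbdd_sel.
by move=> x w wx wp; rewrite /sel (piece_interior TL TK wx wp).
Qed.

End Conforming.
End Pieces.

(** * The bound on the mean, and comparison of the constants *)

Section Bounds.
Context (R : realType).
Variable n : nat.
Notation point := 'rV[R]_n.
Notation tsimplex := (tsimplex R n).
Implicit Types (D T K : tsimplex) (P Q x : point).
Local Notation ravg := (@tavg R n R^o).

(** The left side adds the full Haar budget 4M/3 and the constant 1 / (2n(n+1)(n+2)) of
    [mean_bound]. For n > 2 the latter exceeds the second summand of kappa^2, but the Haar part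
    leaves enough room below [Cpoinc2]. *)
Lemma kappa_sq_ge M : (2 <= n)%N -> (n <= M)%N ->
  haar_const R n * (M%:R + M%:R / 3) + n%:R / 2 / (n.+1 * n.+2)%:R / n%:R ^+ 2
  <= Cpoinc2 R n M + ((n.+1 * n.+2 * n ^ 2)%N%:R)^-1.
Proof.
move=> n2 nM; rewrite /haar_const /edge_const /Cpoinc2 !natrM.
have : n.+1%:R = n%:R + 1 :> R by rewrite natr1.
have : n.+2%:R = n%:R + 2 :> R by rewrite -addn2 natrD.
have : 2 <= n%:R :> R by rewrite ler_nat.
have : n%:R <= M%:R :> R by rewrite ler_nat.
move: (M%:R : R) (n%:R : R) (n.+1%:R : R) (n.+2%:R : R) => m p ? ? pm p2 -> ->.
have h1 : 0 < p by lra.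
have h2 : 0 < p + 1 by lra.
have h3 : 0 < p + 2 by lra.
rewrite -subr_ge0.
set X := (X in 0 <= X).
have -> : X = (8 * m * p + 4 * m - 6 * p ^+ 2 - 9 * p + 6) / (6 * p ^+ 2 * (p + 1) * (p + 2)).
  by rewrite /X; field; rewrite !lt0r_neq0.
apply: divr_ge0; last by rewrite !mulr_ge0 ?sqr_ge0// ltW.
have : 0 <= (m - p) * p by rewrite mulr_ge0 ?subr_ge0// ltW.
have : 0 <= (p - 2) * p by rewrite mulr_ge0 ?subr_ge0// ltW.
nra.
Qed.

(** With vanishing side means, the trace identity reads n F = - mean of (x - P) . grad f for every
    vertex. Averaging over the vertices replaces [P] by the barycenter, about which the second
    moment is small ([smom_center]). *)
Lemma mean_bound (f : paff R n) t K d : (2 <= n)%N -> wf K -> spread K d -> matched f t K ->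
  (forall P, P \in K.1 -> savg f t K P = 0) ->
  ravg (fmean f) t K ^+ 2 <=
  n%:R / 2 / (n.+1 * n.+2)%:R / n%:R ^+ 2 * d ^+ 2 * ravg (gsq f) t K.
Proof.
move=> n2 wK [d0 Hd] mt sv; have n0 : (0 < n)%N by exact: ltnW.
have [sz _] := wK.
have s0 : K.1 != [::] by case: (K.1) sz.
have p0 : (n.+1%:R : R) != 0 by rewrite pnatr_eq0.
have nn : 0 < n%:R :> R by rewrite ltr0n.
set c := mid K.1.
have E : n%:R * ravg (fmean f) t K = - ravg (gmom f c) t K.
  have -> : ravg (gmom f c) t K = n.+1%:R^-1 * \sum_(P <- K.1) ravg (gmom f P) t K.
    rewrite -ravg_sum -ravgZ; apply: eq_ravg => T.
    rewrite /gmom -dotp_suml -dotpZl; congr (dotp _ _).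
    rewrite -[LHS]opprB (mid_sub_sum _ s0) sz -scalerN; congr (_ *: _).
    by rewrite -sumrN; apply: eq_bigr => P _; rewrite opprB.
  rewrite (eq_big_seq (fun=> - (n%:R * ravg (fmean f) t K))); last first.
    by move=> P PK; have := trace_identity n0 wK PK mt; rewrite sv// subr0 => ->; rewrite opprK.
  rewrite big_const_seq count_predT iter_addr_0 sz -[(- _) *+ _]mulr_natl.
  by rewrite mulrA mulVf// mul1r opprK.
have H : ravg (gmom f c) t K ^+ 2 <= smom K.1 c * ravg (gsq f) t K.
  apply: le_trans (@ravg_cs _ _ _ (fun T => dotp (mid T.1 - c) (mid T.1 - c)) (gsq f) t K
    (fun T => dotp_ge0 _) (gsq_ge0 f) (fun T => dotp_cs _ _)) _.
  by rewrite ler_wpM2r ?ravg_dist_smom// ravg_ge0// => T; exact: gsq_ge0.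
have S := smom_center Hd sz.
have G0 : 0 <= ravg (gsq f) t K by rewrite ravg_ge0// => T; exact: gsq_ge0.
have {H} : (n%:R * ravg (fmean f) t K) ^+ 2 <=
    n%:R / 2 * d ^+ 2 / (n.+1 * n.+2)%:R * ravg (gsq f) t K.
  by rewrite E sqrrN (le_trans H)// ler_wpM2r.
move: (ravg (fmean f) t K) (ravg (gsq f) t K) ((n.+1 * n.+2)%:R : R) => F G q H.
rewrite [leRHS](_ : _ = n%:R / 2 * d ^+ 2 / q * G / n%:R ^+ 2); last by ring.
by rewrite ler_pdivlMr ?exprn_gt0// mulrC -exprMn.
Qed.

End Bounds.

Theorem theorem3p5 (R : realType) (n : nat) (Om : set 'rV[R]_n)
    (Tr Trh : seq (tsimplex R n)) (M : nat) (vh INCvh : paff R n)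
    (K : tsimplex R n) :
  (2 <= n)%N ->
  lipschitz_domain Om ->
  regular_triangulation Om Tr ->
  refinement Om Tr Trh ->
  halving Tr M ->
  CR0 Trh vh ->
  CR0 Tr INCvh ->
  (forall K', K' \in Tr -> forall E, E \in sides K'.1 ->
     aff (INCvh K') (mid E) = side_mean E (evalK Trh K' vh)) ->
  K \in Tr ->
  (diam (hull K.1))^-1 *
    Num.sqrt (integral_over (hull K.1)
                (fun x => (evalK Trh K vh x - aff (INCvh K) x) ^+ 2))
  <= @kappaNC R n M *
    Num.sqrt (integral_over (hull K.1)
                (fun x => \sum_(i < n) ((gradK Trh K vh x - (INCvh K).1) 0 i) ^+ 2)).
Proof.
move=> n2 _ [_ [wTr _]] [reach [_ [wTrh [_ cTrh]]]] hM cr _ hI KTr.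
have n0 : (0 < n)%N by exact: ltnW.
have wK : wf K by have [sz nd _] := wTr K KTr; split => //; exact: afree_nondegenerate.
have wL T : T \in Trh -> wf T.
  by move=> /wTrh[sz nd _]; split => //; exact: afree_nondegenerate.
have [szK fK] := wK; have [uK _] := fK.
have [t tL] := reach_leaves reach KTr.
have tK T : T \in leaves t K -> hull T.1 `<=` hull K.1 by exact: leaves_hull.
have nM := halving_ge n0 hM KTr wK.
set gI := INCvh K.
(* The error as a piecewise affine function on the fine mesh: on [K] the interpolant is the single
   affine function [gI]. Below, [phi] is the same error as a function of points, as [compat]
   requires. *)
pose f : paff R n := fun T => ((vh T).1 - gI.1, (vh T).2 - gI.2).
have fE T x : aff (f T) x = aff (vh T) x - aff gI x.
  by rewrite /aff /= dotpC dotpBl !(dotpC _ x); ring.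
pose v := sel (fun T => aff (vh T)) Trh K.
have nv : locbdd v by apply: locbdd_sel => // T; exact: locbdd_aff.
pose phi x := v x + -1 * aff gI x.
have nphi : locbdd phi by apply: locbddD => //; apply: locbddZ; exact: locbdd_aff.
have m0 : (0 < n.-1)%N by rewrite -ltnS prednK.
have Jphi s : afree s -> size s = n.-1.+1 ->
    bint n.-1 s phi = bint n.-1 s v - Vol R n.-1 * aff gI (mid s).
  move=> fs sz; rewrite bintD//; last by apply: locbddZ; exact: locbdd_aff.
  by rewrite bintZ ?mulN1r ?bint_aff_gt0//; exact: locbdd_aff.
have V0 := lt0r_neq0 (Vol_gt0 R n.-1).
have cf : compat f phi t K.
  move=> T Tt Q QT; have [sT fT] := wL T (tL T Tt).
  rewrite Jphi; [|exact: afree_rem|by apply: size_rem_wf => //; exact: wL (tL T Tt)].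
  rewrite /v (bint_side wL (fun T T' h h' => cTrh T T' h h') n2 cr (tL T Tt) (tK T Tt) QT).
  by rewrite fE mulrBr.
(* The interpolation condition: [gI] has at each side barycenter the side mean of [vh], so the side
   means of the error vanish. *)
have sv P : P \in K.1 -> savg f t K P = 0.
  move=> PK; apply: (mulfI V0); rewrite mulr0 -(bint_savg n0 nphi wK PK cf).
  have sr := size_rem_wf n0 wK PK; have fr := afree_rem P fK.
  rewrite Jphi// (hI K KTr _ (sides_rem uK PK)) side_meanE// mulrCA mulfV// mulr1.
  by rewrite subrr.
have mt := compat_matched n0 nphi wK cf.
have [c c0 Hc] := rint_hull fK szK.
have pp : locbdd (fun x => phi x ^+ 2).
  by under eq_fun do rewrite expr2; exact: locbddM.
(* Both squared norms acquire the same factor [c * Vol R n], so only tree averages remain to be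
   compared. *)
have E1 : integral_over (hull K.1) (fun x => (evalK Trh K vh x - aff gI x) ^+ 2) =
    c * (Vol R n * @tavg R n R^o (qmean f) t K).
  rewrite integral_overE (eq_rint (g := fun x => ind (hull K.1) x * phi x ^+ 2)); last first.
    by move=> x; rewrite /phi mulN1r.
  rewrite Hc//; congr (_ * _); apply: bint_tavg => // T Tt.
  have [sT fT] := wL T (tL T Tt); have [uT _] := fT.
  rewrite -(bint_aff2_gt0 (f T) n0 fT sT); apply: bint_interior => //.
    by under eq_fun do rewrite expr2; apply: locbddM; exact: locbdd_aff.
  move=> x w wx wp; rewrite /phi /v /sel.
  rewrite (piece_interior wL (fun T T' h h' => cTrh T T' h h') (tL T Tt) (tK T Tt) wx wp).
  by rewrite fE mulN1r.
pose g := sel (fun T _ => gsq f T) Trh K.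
have ng : locbdd g by apply: locbdd_sel => // T; exact: locbdd_cst.
have E2 : integral_over (hull K.1)
      (fun x => \sum_(i < n) ((gradK Trh K vh x - gI.1) 0 i) ^+ 2) =
    c * (Vol R n * @tavg R n R^o (gsq f) t K).
  rewrite integral_overE (eq_rint (g := fun x => ind (hull K.1) x * g x)); last first.
    move=> x; rewrite /ind; case: asboolP => hx; last by rewrite !mul0r.
    congr (_ * _); have [T Tt Tx] := leaves_cover n0 t wK hx.
    have [T' pT'] := piece_ex (tL T Tt) (tK T Tt) Tx.
    by rewrite /gradK /g /sel pT'; apply: eq_bigr => i _; rewrite expr2.
  rewrite Hc//; congr (_ * _); apply: bint_tavg => // T Tt.
  have nc S : locbdd (fun _ : 'rV[R]_n => gsq f S) by exact: locbdd_cst.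
  rewrite /g (bint_piece wL (fun T T' h h' => cTrh T T' h h') nc (tL T Tt) (tK T Tt)).
  by rewrite bint_cst mulrC.
rewrite E1 E2.
set Q := @tavg R n R^o (qmean f) t K; set G := @tavg R n R^o (gsq f) t K.
have G0 : 0 <= G by rewrite ravg_ge0// => T; exact: gsq_ge0.
have sK : spread K (dia K) by exact: spread_sub.
(* [K] is its own reference ancestor here (r = 0), so the whole budget M + M/3 = 4M/3 is
   available. *)
have VB : Q - @tavg R n R^o (fmean f) t K ^+ 2 <=
    haar_const R n * (M%:R - 0%:R + M%:R / 3) * dia K ^+ 2 * G.
  by apply: (var_bound n0 hM KTr n2 nM wK (k0 := 0) (r := 0)) => //=;
    rewrite ?inE// (leq_trans n0).
have MB := mean_bound n2 wK sK mt sv.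
have KB := kappa_sq_ge R n2 nM.
(* A zero diameter would force zero volume. *)
have d0 : 0 < dia K.
  have [dge _] := sK; rewrite lt_neqAle dge andbT eq_sym; apply: contraTneq (vol_gt0 wK) => z.
  by rewrite -leNgt (le_trans (vol_le wK))// z mulr0 expr0n gtn_eqF.
have QB : Q <= (Cpoinc2 R n M + ((n.+1 * n.+2 * n ^ 2)%N%:R)^-1) * dia K ^+ 2 * G.
  have dG : 0 <= dia K ^+ 2 * G by rewrite mulr_ge0 ?sqr_ge0.
  have := ler_wpM2r dG KB; move: VB MB; rewrite subr0.
  move: (haar_const R n * _) (_ / n%:R ^+ 2) (Cpoinc2 R n M + _) (dia K ^+ 2) => A B k d.
  by rewrite -/G; lra.
rewrite -/(dia K) ler_pdivrMl// /kappaNC.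
set k2 := Cpoinc2 R n M + _ in QB KB *.
have k20 : 0 <= k2.
  apply: le_trans KB; rewrite addr_ge0//.
  by rewrite mulr_ge0 ?haar_const_ge0// addr_ge0// divr_ge0.
have cV0 : 0 <= c * Vol R n by rewrite ltW// mulr_gt0 ?Vol_gt0.
rewrite -sqrtrM// -{1}(ger0_norm (ltW d0)) -sqrtr_sqr -sqrtrM ?sqr_ge0//.
rewrite ler_wsqrtr// [leRHS](_ : _ = c * (Vol R n * (k2 * dia K ^+ 2 * G))); last by ring.
by rewrite !(mulrA c) ler_wpM2l.
Qed.
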